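(* Let $\nu>-1$ and $-1<\mu<\nu+2$ be real, and let $f$ be a positive integrable function on $(0,1)$ such that, in the case $\nu<-1/2$, $\int_0^1 t^{\nu+1/2}|f(t)|\,dt<\infty$. Put $$\sigma_m=(-1)^{m+1}\,\mathbb{H}_\nu(f)(j_{\mu,m}),\qquad m=1,2,\dots.$$ If $(\sigma_m)$ keeps constant (strict) sign for all $m$, then $\mathbb{H}_\nu(f)(z)$ has infinitely many zeros, all of which are real and simple, and its positive zeros are distributed as follows. (i) If $\sigma_m>0$ for all $m$, then each of the intervals $(j_{\mu,m},\,j_{\mu,m+1})$, $m=1,2,\dots$, contains exactly one zero, and there are no positive zeros elsewhere. (ii) If $\sigma_m<0$ for all $m$, then each of the intervals $(0,\,j_{\mu,1})$ and $(j_{\mu,m},\,j_{\mu,m+1})$, $m=1,2,\dots$, contains exactly one zero, and there are no positive zeros elsewhere.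
   Context: $J_\nu$ denotes the Bessel function of the first kind of order $\nu$. For real $\mu>-1$, $(j_{\mu,m})_{m\ge1}$ denotes the sequence of all positive zeros of $J_\mu$ in ascending order. For $\nu>-1$, $\mathbb{J}_\nu$ is the entire function $\mathbb{J}_\nu(z)=\sum_{m=0}^\infty \frac{(-1)^m(z/2)^{2m}}{m!\,(\nu+1)_m}=\Gamma(\nu+1)(z/2)^{-\nu}J_\nu(z)$, where $(x)_m$ is the Pochhammer symbol (rising factorial). The normalized Hankel transform of $f$ is the (even, entire) function $\mathbb{H}_\nu(f)(z)=\int_0^1 t^{\nu+1/2}f(t)\,\mathbb{J}_\nu(zt)\,dt$, $z\in\mathbb{C}$. *)

(* Defs.v *)
From HB Require Import structures.
From mathcomp Require Import all_boot all_order all_algebra.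
From mathcomp Require Import all_classical all_reals all_analysis.
From mathcomp Require Export complex.

Set Implicit Arguments.
Unset Strict Implicit.
Unset Printing Implicit Defensive.

Import Order.TTheory GRing.Theory Num.Theory.
Import numFieldNormedType.Exports.

Local Open Scope classical_set_scope.
Local Open Scope ring_scope.
Local Open Scope complex_scope.

(* The complex field over R. Packing R[i] as a numClosedFieldType makes the
   canonical topology, norm and derivatives of numeric fields available on it
   (R[i] alone has only its algebraic and order structures). *)
Definition CC (R : realType) : numClosedFieldType := R[i].

Definition toCC (R : realType) (x : R) : CC R := x%:C.

(* Euler's integral; only used for x > 0. *)
Definition Gamma (R : realType) (x : R) : R :=
  \int[@lebesgue_measure R]_(t in `]0, +oo[) (t `^ (x - 1) * expR (- t)).

Definition pochhammer (R : realType) (x : R) (m : nat) : R :=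
  \prod_(i < m) (x + i%:R).

(* J_mu at real arguments x > 0, where the real power in its series is
   unambiguous; for mu > -1 all the values of Gamma are at positive points. *)
Definition bessel_J (R : realType) (mu x : R) : R :=
  limn (series (fun m : nat =>
    (-1) ^+ m / (m`!%:R * Gamma (m%:R + mu + 1)) *
      (x / 2) `^ (2 * m%:R + mu))).

(* j lists, in ascending order and starting from j 0, all the positive zeros
   of J_mu. *)
Definition enumerates_bessel_zeros (R : realType) (mu : R) (j : nat -> R) :
    Prop :=
  {homo j : m n / (m < n)%N >-> m < n} /\
  range j = [set x | 0 < x /\ bessel_J mu x = 0].

(* j_(mu, m), with the customary numbering m = 1, 2, ... (the index 0 carries
   no information). *)
Definition bessel_zero (R : realType) (mu : R) (m : nat) : R :=
  xget (fun=> 0) [set j | enumerates_bessel_zeros mu j] m.-1.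

(* The normalized Bessel function, as a function on the complex plane. *)
Definition bessel_JJ (R : realType) (nu : R) (z : CC R) : CC R :=
  limn (series (fun m : nat =>
    (-1) ^+ m * (z / 2) ^+ (2 * m) /
      (m`!%:R * toCC (pochhammer (nu + 1) m)))).

Definition complex_integral (R : realType) (D : set R) (g : R -> CC R) : CC R :=
  (\int[@lebesgue_measure R]_(t in D) complex.Re (g t)) +i*
  (\int[@lebesgue_measure R]_(t in D) complex.Im (g t)).

Definition hankel (R : realType) (nu : R) (f : R -> R) (z : CC R) : CC R :=
  complex_integral `]0, 1[
    (fun t => toCC (t `^ (nu + 1 / 2) * f t) * bessel_JJ nu (z * toCC t)).

Definition simple_zero (R : realType) (F : CC R -> CC R) (z : CC R) : Prop :=
  [/\ F z = 0, derivable F z 1 & derive1 F z != 0].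

(* A complex number with zero imaginary part. In the order of CC R, 0 < sigma
   (resp. sigma < 0) means that sigma is real and positive (resp. negative). *)
Definition hankel_sigma (R : realType) (nu mu : R) (f : R -> R) (m : nat) :
    CC R :=
  (-1) ^+ m.+1 * hankel nu f (toCC (bessel_zero mu m)).

(* Main.v *)
(* In the variable w = (z / 2)^2 the functions J_mu and H_nu(f) become entire
   functions Phi(w) and F(w), and the zeros of Phi are lam_m = (j_m / 2)^2. All
   the claims follow from the expansion
     F(w) / Phi(w) = F(0) + w * sum_m D_m / (lam_m - w),
   where D_m = - F(lam_m) / (lam_m Phi'(lam_m)) has the constant sign of the
   sigma_m, because Phi' alternates: the sum has nonzero imaginary part off the
   real axis and is strictly monotone between two consecutive lam_m.
   The expansion is proved without contour integrals. Its Taylor coefficients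
   at 0 satisfy c_k = sum_m D_m / lam_m^k. For large k this comes from
   Fourier-Bessel series: the remainders u_k of the k-th coefficients of
   Phi(w x) / Phi(w) solve L u_(k+1) = - u_k for the Bessel operator L, and
   Rellich's identity bounds the growth rate of their norms by 1 / lam_M;
   Sonine's integral and the contiguous relations carry the decay from order mu
   to order nu. Then k decreases to 1: since the D_m have constant sign, it is
   enough that F(-y) / Phi(-y) = o(y), and this is where mu < nu + 2 is used. *)

Require Import Defs.
From mathcomp Require Import all_boot all_order all_algebra.
From mathcomp Require Import all_classical all_reals all_analysis.
From mathcomp Require Import measurable_realfun ring lra zify.

Set Implicit Arguments.
Unset Strict Implicit.
Unset Printing Implicit Defensive.

Import Order.TTheory GRing.Theory Num.Theory.
Import numFieldNormedType.Exports.

Local Open Scope classical_set_scope.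
Local Open Scope ring_scope.

(** * Entire power series *)

(** As f is only integrable, its weighted integral can be paired with the Fourier-Bessel remainders
    only if these tend to 0 uniformly on [0, 1], whereas Rellich's identity controls their quadratic
    mean. Passing to the sup norm takes absolutely convergent tails; the coefficients [gcoef] are
    only shown to grow at most polynomially, and each unit of k gains a factor 1 / lam_m. Hence
    large k come first. No spectral decomposition of L enters: the gap above the first M eigenvalues
    is read off the log-convexity of the moments of the iterates u_k. The function f itself enters
    through two facts about the moments of t^(nu + 1/2) f(t): they are nonnegative, and they define
    a functional bounded by its mass times the sup norm. F / Phi is never formed as a function with
    poles. It appears as a formal series, through the reciprocal series [r] of Phi, and every
    analytic statement is multiplied by Phi and bears on partial sums over m < M. Monotonicity and
    imaginary parts are therefore used as lower bounds that hold for all M at once. *)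

Section EntireSeries.
Variable R : realType.
Implicit Types (c : nat -> R) (x y : R).

(** Infinite radius of convergence, as a bound by every geometric sequence. In this form it passes
    to shifts, derivatives and dominated sequences without keeping track of radii. *)
Definition entire c :=
  forall r, 0 < r -> exists2 C, 0 <= C & forall i, `|c i| <= C * r ^+ i.

Definition ps c x : R := limn (pseries c x).

(** This is the bound with r = 1 / (4 (B + 1)). The ratio 1/4, rather than 1/2, leaves room for the
    factor n of a Cauchy product in [fsum_conv]. *)
Lemma entire_bound c B : entire c -> 0 <= B ->
  exists2 C, 0 <= C & forall i x, `|x| <= B -> `|c i * x ^+ i| <= C * 4^-1 ^+ i.
Proof.
move=> /(_ (4 * (B + 1))^-1) + B0 => -[]; first by rewrite invr_gt0; lra.
move=> C C0 cC; exists C => // i x xB; rewrite normrM normrX.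
have xi : `|x| ^+ i <= (B + 1) ^+ i by rewrite lerXn2r ?nnegrE//; lra.
apply: le_trans (ler_pM _ _ (cC i) xi) _ => //.
rewrite -mulrA ler_wpM2l// -exprMn invfM -mulrA mulVf ?mulr1//; lra.
Qed.

Lemma geo_sum (q : R) n : 0 <= q -> q <= 2^-1 -> \sum_(i < n) q ^+ i <= 2 - 2 * q ^+ n.
Proof.
move=> q0 q1; elim: n => [|n IH]; first by rewrite big_ord0 expr0; lra.
rewrite big_ord_recr/= exprS.
have : 0 <= q ^+ n by rewrite exprn_ge0.
have : q * q ^+ n <= 2^-1 * q ^+ n by rewrite ler_wpM2r// exprn_ge0.
by move: IH; lra.
Qed.

Lemma geo_tail (q : R) m n : 0 <= q -> q <= 2^-1 ->
  \sum_(m <= i < m + n) q ^+ i <= 2 * q ^+ m.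
Proof.
move=> q0 q1; rewrite -{1}[m]add0n big_addn addKn big_mkord.
under eq_bigr do rewrite exprD mulrC.
rewrite -mulr_sumr mulrC ler_wpM2r ?exprn_ge0//.
by apply: le_trans (geo_sum _ q0 q1) _; rewrite lerBlDr lerDl mulr_ge0// exprn_ge0.
Qed.

Lemma is_cvg_geo (a : nat -> R) C q : 0 <= q -> q <= 2^-1 ->
  (forall i, `|a i| <= C * q ^+ i) -> cvgn (series a).
Proof.
move=> q0 q1 aC; apply: normed_cvg.
apply: (@series_le_cvg _ _ (geometric C q)).
- by move=> n /=.
- by move=> n; apply: le_trans (aC n).
- by move=> n; apply: aC.
- by apply: is_cvg_geometric_series; rewrite ger0_norm//; lra.
Qed.

Lemma is_cvg_ps c x : entire c -> cvgn (pseries c x).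
Proof.
move=> ec; have [C C0 H] := entire_bound ec (normr_ge0 x).
apply: (@is_cvg_geo _ C 4^-1); [lra|lra|] => i; exact: H.
Qed.

Lemma ps_cvg c x : entire c -> (fun n => \sum_(i < n) c i * x ^+ i) @ \oo --> ps c x.
Proof.
move=> ec; have := @is_cvg_ps c x ec; rewrite /ps.
have -> : pseries c x = (fun n => \sum_(i < n) c i * x ^+ i).
  by rewrite /pseries seriesEord.
by [].
Qed.

Lemma cvg_ubound (u : nat -> R) l b : u @ \oo --> l ->
  (exists N, forall n, (N <= n)%N -> u n <= b) -> l <= b.
Proof.
move=> ul [N H].
rewrite -(cvg_lim (@norm_hausdorff _ R) ul).
apply: limr_le; first by apply/cvg_ex; exists l.
by near=> n; apply: H; near: n; exists N.
Unshelve. all: by end_near. Qed.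

Lemma cvg_lbound (u : nat -> R) l b : u @ \oo --> l ->
  (exists N, forall n, (N <= n)%N -> b <= u n) -> b <= l.
Proof.
move=> ul [N H].
rewrite -(cvg_lim (@norm_hausdorff _ R) ul).
apply: limr_ge; first by apply/cvg_ex; exists l.
by near=> n; apply: H; near: n; exists N.
Unshelve. all: by end_near. Qed.

Lemma cvg_geo_tail (a : nat -> R) l C q : 0 <= q -> q <= 2^-1 -> 0 <= C ->
  (forall i, `|a i| <= C * q ^+ i) -> (fun n => \sum_(i < n) a i) @ \oo --> l ->
  forall n, `|l - \sum_(i < n) a i| <= 2 * C * q ^+ n.
Proof.
move=> q0 q1 C0 aC al n.
apply: (@cvg_ubound (fun m => `|\sum_(i < m) a i - \sum_(i < n) a i|)).
  by apply: cvg_norm; apply: cvgB => //; exact: cvg_cst.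
exists n => m /subnKC <-; rewrite -!(big_mkord xpredT a).
rewrite (@big_cat_nat _ _ _ n 0%N (n + (m - n))%N) ?leq_addr//= [X in X - _]addrC addrK.
apply: le_trans (ler_norm_sum _ _ _) _.
apply: (@le_trans _ _ (\sum_(n <= i < n + (m - n)) C * q ^+ i)).
  by apply: ler_sum => i _; apply: aC.
rewrite -mulr_sumr -mulrA mulrCA ler_wpM2l//; exact: geo_tail.
Qed.

Lemma ps_tail c B : entire c -> 0 <= B -> exists2 C, 0 <= C &
  forall n x, `|x| <= B -> `|ps c x - \sum_(i < n) c i * x ^+ i| <= C * 4^-1 ^+ n.
Proof.
move=> ec B0; have [C C0 H] := entire_bound ec B0.
exists (2 * C) => [|n x xB]; first lra.
apply: (@cvg_geo_tail (fun i => c i * x ^+ i)) => //; [lra| |exact: ps_cvg].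
by move=> i; exact: H.
Qed.

Lemma entire_diffs c : entire c -> entire (pseries_diffs c).
Proof.
(* The bound at r / 2 absorbs the factor i + 1, because i + 1 < 2 ^ (i + 1). *)
move=> ec r r0; have r2 : 0 < r / 2 by lra.
have [C C0 cC] := ec (r / 2) r2.
exists (C * (r / 2)) => [|i]; first by rewrite mulr_ge0//; lra.
rewrite /pseries_diffs normrM ger0_norm//.
apply: le_trans (ler_wpM2l _ (cC _)) _ => //.
rewrite exprS mulrCA -[leRHS]mulrA; apply: ler_wpM2l => //.
rewrite mulrCA; apply: ler_wpM2l; first lra.
rewrite exprMn mulrCA ger_pMr ?exprn_gt0//.
rewrite exprVn ler_pdivrMr ?mul1r ?exprn_gt0// -natrX ler_nat.
exact: ltn_expl.
Qed.

Lemma is_derive_ps c x : entire c -> is_derive x (1:R) (ps c) (ps (pseries_diffs c) x).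
Proof.
move=> ec; apply: (@pseries_snd_diffs _ _ (`|x| + 1)).
- exact: is_cvg_ps.
- by apply: is_cvg_ps; exact: entire_diffs.
- by apply: is_cvg_ps; do 2 apply: entire_diffs.
- by rewrite (@ger0_norm _ (_ + 1)) ?addr_ge0// ltrDl.
Qed.

Lemma continuous_ps c : entire c -> continuous (ps c).
Proof.
move=> ec x; apply: differentiable_continuous; apply/derivable1_diffP.
exact: (@ex_derive _ _ _ _ _ _ _ (is_derive_ps x ec)).
Qed.

Lemma entireZ k c : entire c -> entire (fun i => k * c i).
Proof.
move=> ec r r0; have [C C0 cC] := ec r r0.
exists (`|k| * C) => [|i]; first by rewrite mulr_ge0.
by rewrite normrM -mulrA ler_wpM2l.
Qed.

Lemma entireD c d : entire c -> entire d -> entire (fun i => c i + d i).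
Proof.
move=> ec ed r r0; have [C C0 cC] := ec r r0; have [D D0 dD] := ed r r0.
exists (C + D) => [|i]; first by rewrite addr_ge0.
by rewrite mulrDl (le_trans (ler_normD _ _))// lerD.
Qed.

Lemma ps_unique c x l : entire c ->
  (fun n => \sum_(i < n) c i * x ^+ i) @ \oo --> l -> l = ps c x.
Proof.
move=> ec cl; have H := @ps_cvg c x ec.
by rewrite -(cvg_lim (@norm_hausdorff _ R) cl) -(cvg_lim (@norm_hausdorff _ R) H).
Qed.

Lemma psZ k c x : entire c -> ps (fun i => k * c i) x = k * ps c x.
Proof.
move=> ec; symmetry; apply: ps_unique; first exact: entireZ.
have -> : (fun n => \sum_(i < n) k * c i * x ^+ i) = (fun n => k * \sum_(i < n) c i * x ^+ i).
  by apply/funext => n; rewrite mulr_sumr; apply: eq_bigr => i _; rewrite mulrA.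
by apply: cvgM; [exact: cvg_cst|exact: ps_cvg].
Qed.

Lemma psD c d x : entire c -> entire d -> ps (fun i => c i + d i) x = ps c x + ps d x.
Proof.
move=> ec ed; symmetry; apply: ps_unique; first exact: entireD.
have -> : (fun n => \sum_(i < n) (c i + d i) * x ^+ i) =
  (fun n => \sum_(i < n) c i * x ^+ i + \sum_(i < n) d i * x ^+ i).
  by apply/funext => n; rewrite -big_split; apply: eq_bigr => i _; rewrite mulrDl.
by apply: cvgD; exact: ps_cvg.
Qed.

Definition shiftX c i := if i is j.+1 then c j else 0.

Lemma entire_shiftX c : entire c -> entire (shiftX c).
Proof.
move=> ec r r0; have [C C0 cC] := ec r r0.
exists (C / r) => [|[|i]/=]; first by rewrite divr_ge0// ltW.
- by rewrite normr0 expr0 mulr1 divr_ge0// ltW.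
- by rewrite exprS mulrA divfK ?gt_eqF.
Qed.

Lemma ps_shiftX c x : entire c -> ps (shiftX c) x = x * ps c x.
Proof.
move=> ec; symmetry; apply: ps_unique; first exact: entire_shiftX.
rewrite -(cvg_shiftS (fun n => \sum_(i < n) shiftX c i * x ^+ i)).
have -> : (fun n => \sum_(i < n.+1) shiftX c i * x ^+ i) = (fun n => x * \sum_(i < n) c i * x ^+ i).
  apply/funext => n; rewrite big_ord_recl/= mul0r add0r mulr_sumr.
  by apply: eq_bigr => i _ /=; rewrite /bump/= exprS mulrCA.
by apply: cvgM; [exact: cvg_cst|exact: ps_cvg].
Qed.

Lemma ps0 c : entire c -> ps c 0 = c 0%N.
Proof.
move=> ec; symmetry; apply: ps_unique => //.
rewrite -(cvg_shiftS (fun n => \sum_(i < n) c i * 0 ^+ i)).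
have -> : (fun n => \sum_(i < n.+1) c i * 0 ^+ i) = (fun n => c 0%N).
  apply/funext => n; rewrite big_ord_recl/= mulr1 big1 ?addr0// => i _.
  by rewrite expr0n mulr0.
exact: cvg_cst.
Qed.

End EntireSeries.

(** * Bessel functions as entire functions of the squared variable *)

Section BesselClifford.
Variable R : realType.
Implicit Types (a : R).

Lemma pochhammer0 a : pochhammer a 0 = 1.
Proof. by rewrite /pochhammer big_ord0. Qed.

Lemma pochhammerS a n : pochhammer a n.+1 = pochhammer a n * (a + n%:R).
Proof. by rewrite /pochhammer big_ord_recr. Qed.

Lemma pochhammerSl a n : pochhammer a n.+1 = a * pochhammer (a + 1) n.
Proof.
rewrite /pochhammer big_ord_recl/= addr0; congr (_ * _).
by apply: eq_bigr => i _; rewrite /bump/= natrD addrA.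
Qed.

Lemma pochhammer_gt0 a n : 0 < a -> 0 < pochhammer a n.
Proof.
move=> a0; elim: n => [|n IH]; first by rewrite pochhammer0.
by rewrite pochhammerS mulr_gt0// ltr_wpDr.
Qed.

Lemma pochhammer_ge a n : 0 < a -> Num.min a 1 <= pochhammer a n.
Proof.
move=> a0; case: n => [|n]; first by rewrite pochhammer0 ge_min lexx orbT.
elim: n => [|n IH]; first by rewrite pochhammerS pochhammer0 mul1r addr0 ge_min lexx.
rewrite pochhammerS (le_trans IH)// ler_peMr ?ltW ?pochhammer_gt0//.
by rewrite -natr1; have := ler0n R n; lra.
Qed.

(** Taylor coefficients of the hypergeometric function 0F1(; a; - w); [a] is the order of the Bessel
    function plus one. *)
Definition phi a i : R := (-1) ^+ i / (i`!%:R * pochhammer a i).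

(* The normalized Bessel function of order [a - 1] at [z] is [Phi a (z ^+ 2 / 4)]. *)
Definition Phi a : R -> R := ps (phi a).

(** One term of the exponential series at 1 / r is at most its sum. *)
Lemma fact_entire (r : R) : 0 < r -> exists2 C, 0 <= C & forall i : nat, (i`!%:R)^-1 <= C * r ^+ i.
Proof.
move=> r0; exists (expR r^-1) => [|i]; first exact: expR_ge0.
have /exp_coeff_ge0 H : 0 <= r^-1 by rewrite invr_ge0 ltW.
have : exp_coeff r^-1 i <= expR r^-1.
  rewrite /expR; apply: (@le_trans _ _ (series (exp_coeff r^-1) i.+1)).
    by rewrite seriesEord/= big_ord_recr/= lerDr sumr_ge0.
  apply: nondecreasing_cvgn_le; first by apply: nondecreasing_series.
  exact: is_cvg_series_exp_coeff.
rewrite /exp_coeff/= exprVn => H1.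
by rewrite -ler_pdivrMr ?exprn_gt0// mulrC.
Qed.

Lemma norm_phi a i : 0 < a -> `|phi a i| = (i`!%:R * pochhammer a i)^-1.
Proof.
move=> a0; rewrite /phi normrM normrX normrN1 expr1n mul1r ger0_norm// invr_ge0.
by rewrite mulr_ge0// ltW// pochhammer_gt0.
Qed.

Lemma entire_phi a : 0 < a -> entire (phi a).
Proof.
move=> a0 r r0; have [C C0 H] := fact_entire r0.
have m0 : 0 < Num.min a 1 by rewrite lt_min a0 ltr01.
exists (C / Num.min a 1) => [|i]; first by rewrite divr_ge0// ltW.
rewrite norm_phi// invfM mulrAC ler_pM ?invr_ge0//.
  by rewrite ltW// pochhammer_gt0.
by rewrite lef_pV2 ?posrE ?pochhammer_gt0// pochhammer_ge.
Qed.

Lemma phi0 a : phi a 0 = 1.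
Proof. by rewrite /phi fact0 pochhammer0 expr0 mulr1 divr1. Qed.

Lemma phi_diffs a : 0 < a -> pseries_diffs (phi a) = (fun i => - a^-1 * phi (a + 1) i).
Proof.
move=> a0; apply/funext => i; rewrite /pseries_diffs /phi.
rewrite factS natrM pochhammerSl exprS.
have := pochhammer_gt0 i (addr_gt0 a0 ltr01) => p0.
field; rewrite ?gt_eqF//= ?ltr0n ?fact_gt0//.
Qed.

(** Coefficient form of J_(a-1) + J_(a+1) = (2 a / z) J_a. It serves both as the Bessel equation
    ([L_E], [Phi_ode]) and as the means of lowering the order of a remainder ([remainder_shift]). *)
Lemma phi_contig a : 0 < a ->
  phi a = (fun i => phi (a + 1) i + (- (a * (a + 1))^-1) * shiftX (phi (a + 2)) i).
Proof.
move=> a0; apply/funext => -[|i]/=; first by rewrite !phi0 mulr0 addr0.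
rewrite /phi factS natrM [pochhammer a _]pochhammerSl [pochhammer (a + 1) _.+1]pochhammerS exprS.
have p0 := pochhammer_gt0 i (addr_gt0 a0 ltr01).
have E : (a + 1) * pochhammer (a + 2) i = pochhammer (a + 1) i * (a + 1 + i%:R).
  by rewrite -pochhammerS pochhammerSl -addrA.
have i0 := ler0n R i.
have -> : pochhammer (a + 2) i = pochhammer (a + 1) i * (a + 1 + i%:R) / (a + 1).
  by rewrite -E mulrAC mulfV ?mul1r// gt_eqF//; lra.
field; rewrite ?gt_eqF//= ?ltr0n ?fact_gt0//; lra.
Qed.

Lemma is_derive_Phi a x : 0 < a -> is_derive x (1:R) (Phi a) (- a^-1 * Phi (a + 1) x).
Proof.
move=> a0; have := is_derive_ps x (entire_phi a0).
by rewrite phi_diffs// psZ//; apply: entire_phi; lra.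
Qed.

Lemma Phi_contig a x : 0 < a -> Phi a x = Phi (a + 1) x - x / (a * (a + 1)) * Phi (a + 2) x.
Proof.
move=> a0; rewrite /Phi phi_contig//.
have e1 : entire (phi (a + 1)) by apply: entire_phi; lra.
have e2 : entire (phi (a + 2)) by apply: entire_phi; lra.
rewrite psD//; last exact/entireZ/entire_shiftX.
by rewrite psZ ?ps_shiftX//; [ring|exact: entire_shiftX].
Qed.

Lemma Phi0 a : 0 < a -> Phi a 0 = 1.
Proof. by move=> a0; rewrite /Phi ps0 ?phi0//; exact: entire_phi. Qed.

Lemma continuous_Phi a : 0 < a -> continuous (Phi a).
Proof. by move=> a0; apply/continuous_ps/entire_phi. Qed.

End BesselClifford.

(** * The Bessel operator on [[0, 1]] *)

Section RPow.
Variable R : realType.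
Implicit Types p x : R.

(* [x `^ p] is [1] for [x < 0], hence the truncation. *)
Definition rpow p x : R := (Num.max 0 x) `^ p.

Lemma rpow_ge0 p x : 0 <= rpow p x.
Proof. exact: powR_ge0. Qed.

Lemma rpowE p x : 0 <= x -> rpow p x = x `^ p.
Proof. by move=> x0; rewrite /rpow max_r. Qed.

Lemma rpow0 p x : p != 0 -> x <= 0 -> rpow p x = 0.
Proof. by move=> p0 x0; rewrite /rpow max_l// powR0. Qed.

Lemma rpow1 p : rpow p 1 = 1.
Proof. by rewrite rpowE// powR1. Qed.

Lemma rpow_le1 p x : 0 < p -> x <= 1 -> rpow p x <= 1.
Proof.
move=> p0 x1; rewrite /rpow.
have := @ge0_ler_powR _ _ (ltW p0) (Num.max 0 x) 1.
by rewrite !nnegrE powR1; apply; rewrite ?le_max ?lexx// ge_max x1 ler01.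
Qed.

Lemma powR_lt1 p x : 0 < p -> 0 <= x < 1 -> x `^ p < 1.
Proof.
move=> p0 /andP[x0 x1]; have := @gt0_ltr_powR _ _ p0 x 1.
by rewrite !nnegrE powR1; apply.
Qed.

Lemma is_derive_rpow p x : 0 < x -> is_derive x (1:R) (rpow p) (p * x `^ (p - 1)).
Proof.
move=> x0; have H := is_derive1_powR p x0.
apply: (near_eq_is_derive _ H) => //.
by near=> y; rewrite rpowE// ltW//; near: y; exact: lt_nbhsr.
Unshelve. all: by end_near. Qed.

Lemma continuous_rpow p : 0 < p -> continuous (rpow p).
Proof.
move=> p0 x; have [x0|x0|<-] := ltgtP 0 x.
- apply: differentiable_continuous; apply/derivable1_diffP.
  exact: (@ex_derive _ _ _ _ _ _ _ (is_derive_rpow p x0)).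
- have H : \forall y \near x, rpow p x = rpow p y.
    near=> y; rewrite !rpow0 ?gt_eqF ?ltW//; near: y; exact: lt_nbhsl.
  exact: (cvg_trans (near_eq_cvg H) (cvg_cst _)).
- apply/left_right_continuousP; split; rewrite (rpow0 _ (lexx 0)) ?gt_eqF//.
  + have H : \forall y \near 0^'-, (0 : R) = rpow p y.
      by near=> y; rewrite rpow0 ?gt_eqF ?ltW//.
    exact: (cvg_trans (near_eq_cvg H) (cvg_cst _)).
  + have H : \forall y \near 0^'+, y `^ p = rpow p y.
      by near=> y; rewrite rpowE.
    exact: (cvg_trans (near_eq_cvg H) (powR_cvg0 p0)).
Unshelve. all: by end_near. Qed.

End RPow.

Section RealContinuity.
Variable R : realType.
Implicit Types f g : R -> R.

Lemma cont_cst (c : R) : continuous (fun _ : R => c).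
Proof. by move=> x; exact: cvg_cst. Qed.

Lemma cont_id : continuous (fun x : R => x).
Proof. by move=> x; exact: cvg_id. Qed.

Lemma contD f g : continuous f -> continuous g -> continuous (fun x => f x + g x).
Proof. by move=> cf cg x; apply: cvgD; [exact: cf|exact: cg]. Qed.

Lemma contB f g : continuous f -> continuous g -> continuous (fun x => f x - g x).
Proof. by move=> cf cg x; apply: cvgB; [exact: cf|exact: cg]. Qed.

Lemma contM f g : continuous f -> continuous g -> continuous (fun x => f x * g x).
Proof. by move=> cf cg x; apply: cvgM; [exact: cf|exact: cg]. Qed.

Lemma cont_comp f g : continuous f -> continuous g -> continuous (fun x => f (g x)).
Proof. by move=> cf cg x; apply: continuous_comp; [exact: cg|exact: cf]. Qed.

End RealContinuity.

(* Syntax-directed, because unification unfolds the topological structures. *)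
Ltac cts := lazymatch goal with
  | |- continuous (fun _ => ?c) => exact (@cont_cst _ c)
  | |- continuous (fun x => x) => exact (@cont_id _)
  | |- continuous (fun x => @?f x + - @?g x) =>
    refine (@contB _ f g _ _); [cts | cts]
  | |- continuous (fun x => @?f x + @?g x) =>
    refine (@contD _ f g _ _); [cts | cts]
  | |- continuous (fun x => @?f x * @?g x) =>
    refine (@contM _ f g _ _); [cts | cts]
  | H : continuous ?f |- continuous ?f => exact H
  | H : continuous ?f |- continuous (fun x => ?f x) => exact H
  | H : forall i, continuous (?f i) |- continuous (fun x => ?f ?i x) => exact (H i)
  end.

Section WeightedIntegral.
Variable R : realType.
Notation mu := (@lebesgue_measure R).
Variable a : R.
Hypothesis a0 : 0 < a.
Implicit Types u v du dv ddu ddv y dy : R -> R.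

(* The integral of [x `^ (a - 1) * u x] over [[0, 1]], after the change of
   variables [x = r `^ a^-1], which removes the singularity at [0]. *)
Definition J u : R := \int[mu]_(r in `[0, 1]) (u (rpow a^-1 r) / a).

Lemma J_integrable u : continuous u ->
  mu.-integrable `[0, 1] (EFin \o (fun r => u (rpow a^-1 r) / a)).
Proof.
move=> cu; apply: continuous_compact_integrable; first exact: segment_compact.
apply: continuous_subspaceT => x; apply: cvgM; last exact: cvg_cst.
apply: continuous_comp; last exact: cu.
by apply: continuous_rpow; rewrite invr_gt0.
Qed.

Lemma JD u v : continuous u -> continuous v -> J (fun x => u x + v x) = J u + J v.
Proof.
move=> cu cv; rewrite /J -RintegralD//; [|exact: J_integrable..].
by apply: eq_Rintegral => x _; rewrite mulrDl.
Qed.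

Lemma JZ k u : continuous u -> J (fun x => k * u x) = k * J u.
Proof.
move=> cu; rewrite /J -RintegralZl//; last exact: J_integrable.
by apply: eq_Rintegral => x _; rewrite mulrA.
Qed.

Lemma JB u v : continuous u -> continuous v -> J (fun x => u x - v x) = J u - J v.
Proof.
move=> cu cv; rewrite /J -RintegralB//; [|exact: J_integrable..].
by apply: eq_Rintegral => x _; rewrite mulrBl.
Qed.

Lemma rpow_itv01 r : r \in `[0, 1] -> 0 <= rpow a^-1 r <= 1.
Proof.
by rewrite in_itv/= => /andP[r0 r1]; rewrite rpow_ge0 rpow_le1// invr_gt0.
Qed.

Lemma eq_J u v : (forall x, 0 <= x <= 1 -> u x = v x) -> J u = J v.
Proof.
move=> uv; apply: eq_Rintegral => r; rewrite inE/= => r01.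
by rewrite uv// rpow_itv01.
Qed.

Lemma le_J u v : continuous u -> continuous v ->
  (forall x, 0 <= x <= 1 -> u x <= v x) -> J u <= J v.
Proof.
move=> cu cv uv; apply: le_Rintegral; rewrite //; [exact: J_integrable..|].
move=> r /= r01; rewrite ler_wpM2r ?invr_ge0 ?(ltW a0)//.
by rewrite uv// rpow_itv01.
Qed.

Lemma J_ge0 u : (forall x, 0 <= x <= 1 -> 0 <= u x) -> 0 <= J u.
Proof.
move=> u0; apply: Rintegral_ge0 => r /= r01.
by rewrite divr_ge0 ?(ltW a0)// u0// rpow_itv01.
Qed.

(** Times x^(a-1), the integrand is the derivative of x^a y, which vanishes at 0 because a > 0. All
    integrations by parts on [0, 1] go through this formula. *)
Lemma J_ftc y dy : continuous y -> continuous dy ->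
  (forall x : R, 0 < x < 1 -> is_derive x (1:R) y (dy x)) ->
  J (fun x => a * y x + x * dy x) = y 1.
Proof.
move=> cy cdy ydy.
pose Y r := r * y (rpow a^-1 r).
have ai : 0 < a^-1 by rewrite invr_gt0.
have cr := continuous_rpow ai.
have cY : continuous Y.
  move=> x; apply: cvgM; first exact: cvg_id.
  by apply: continuous_comp; [exact: cr|exact: cy].
have dY (r : R) : 0 < r < 1 -> is_derive r (1:R) Y
    ((a * y (rpow a^-1 r) + rpow a^-1 r * dy (rpow a^-1 r)) / a).
  move=> /andP[r0 r1].
  have s01 : 0 < rpow a^-1 r < 1.
    rewrite rpowE ?(ltW r0)// powR_gt0//=.
    by rewrite powR_lt1// (ltW r0).
  have Hy := ydy _ s01.
  have Hr := is_derive_rpow a^-1 r0.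
  have := is_deriveM (is_derive_id r (1:R)) (is_derive1_comp Hy Hr).
  move=> H; apply: (is_derive_eq H).
  have E : rpow a^-1 r = r * r `^ (a^-1 - 1).
    by rewrite mulr_powRB1 ?(ltW r0)// rpowE// ltW.
  rewrite /= /GRing.scale/= mulr1 [X in _ + X * dy _]E.
  by field; rewrite gt_eqF.
rewrite /J /Rintegral (@continuous_FTC2 _ _ Y)//=.
- by rewrite /Y rpow1 mul1r mul0r subr0.
- apply: continuous_subspaceT => x; apply: cvgM; last exact: cvg_cst.
  have crx := cr x.
  apply: cvgD; apply: cvgM; [exact: cvg_cst| |exact: crx|].
  + by apply: continuous_comp; [exact: cr|exact: cy].
  + by apply: continuous_comp; [exact: cr|exact: cdy].
- split.
  + by move=> x; rewrite in_itv/= => /dY H; apply: ex_derive.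
  + by apply: cvg_at_right_filter; exact: cY.
  + by apply: cvg_at_left_filter; exact: cY.
- by move=> x; rewrite in_itv/= => /dY H; rewrite derive1E derive_val.
Qed.

Lemma J1 : J (fun=> 1) = a^-1.
Proof.
have H : J (fun x => a * a^-1 + x * 0) = a^-1.
  apply: (@J_ftc (fun=> a^-1) (fun=> 0)) => [x|x]; exact: cvg_cst.
by rewrite -[RHS]H; apply: eq_J => x _; rewrite mulr0 addr0 mulfV ?gt_eqF.
Qed.

Lemma J_norm_le u b : continuous u -> (forall x, 0 <= x <= 1 -> `|u x| <= b) ->
  `|J u| <= b / a.
Proof.
move=> cu ub.
have H v : continuous v -> (forall x, 0 <= x <= 1 -> v x <= b) -> J v <= b / a.
  move=> cv vb; rewrite -J1 -JZ; last by move=> x; exact: cvg_cst.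
  apply: le_J => //; first by move=> x; exact: cvg_cst.
  by move=> x x01; rewrite mulr1 vb.
rewrite ler_norml; apply/andP; split; last first.
  by apply: H => // x x01; rewrite (le_trans (ler_norm _))// ub.
have E : J (fun x => -1 * u x) = - J u by rewrite JZ// mulN1r.
rewrite lerNl -E; apply: H; first by move=> x; apply: cvgM; [exact: cvg_cst|exact: cu].
by move=> x x01; rewrite mulN1r (le_trans (ler_norm _))// normrN ub.
Qed.

(** The primitive of the density lies between 0 and its total value 0, so the density, its
    derivative, vanishes inside the interval; the endpoints follow by continuity. *)
Lemma J_eq0 u : continuous u -> (forall x, 0 <= x <= 1 -> 0 <= u x) -> J u = 0 ->
  forall x, 0 <= x <= 1 -> u x = 0.
Proof.
move=> cu u0 Ju x x01.
pose h r := u (rpow a^-1 r) / a.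
have ai : 0 < a^-1 by rewrite invr_gt0.
have cr := continuous_rpow ai.
have ch : continuous h.
  move=> r; apply: cvgM; last exact: cvg_cst.
  by apply: continuous_comp; [exact: cr|exact: cu].
have ih := J_integrable cu.
have h0 r : r \in `[0, 1] -> 0 <= h r.
  by move=> r01; rewrite divr_ge0 ?(ltW a0)// u0// rpow_itv01.
have G0 r : 0 <= r <= 1 -> \int[mu]_(t in `[0, r]) h t = 0.
  move=> /andP[r0 r1]; apply/eqP; rewrite eq_le; apply/andP; split.
    rewrite -[leRHS]Ju /J -/h; apply: fine_le.
    - apply: integrable_fin_num => //; apply: integrableS ih => //.
      by apply: subset_itvl; rewrite bnd_simp.
    - exact: integrable_fin_num.
    - apply: ge0_subset_integral => //.
      + by apply/measurable_int: ih.
      + by apply: subset_itvl; rewrite bnd_simp.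
  apply: Rintegral_ge0 => t /= ; rewrite in_itv/= => /andP[t0 tr].
  by rewrite h0// in_itv/= t0 (le_trans tr).
have hz r : 0 < r < 1 -> h r = 0.
  move=> /andP[r0 r1].
  have [_ <-] := @continuous_FTC1_closed _ h 0 r 1 r1 ih r0 (ch r).
  rewrite derive1E (@near_eq_derive _ _ _ _ (fun=> 0)) ?derive_cst//.
  near=> t; rewrite G0//; apply/andP; split; apply: ltW; near: t.
    exact: lt_nbhsr.
  exact: lt_nbhsl.
have uz z : 0 < z < 1 -> u z = 0.
  move=> /andP[z0 z1].
  have := hz (z `^ a); rewrite /h rpowE ?powR_ge0// -powRrM mulfV ?gt_eqF//.
  rewrite powRr1 ?(ltW z0)// => H; apply/eqP.
  have za : 0 < z `^ a < 1 by rewrite powR_gt0//= powR_lt1// (ltW z0).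
  by move/eqP: (H za); rewrite mulf_eq0 invr_eq0 (gt_eqF a0) orbF.
case/andP: x01; rewrite le_eqVlt => /predU1P[<- _|x0].
  apply/eqP; apply/negP => /negP u0n.
  have cu0 : u z @[z --> 0^'+] --> u 0 by apply: cvg_at_right_filter; exact: cu.
  have cn := cvgr_neq0 _ cu0 u0n.
  near (0 : R)^'+ => t.
  have : u t != 0 by near: t; exact: cn.
  by rewrite uz ?eqxx//; apply/andP; split.
rewrite le_eqVlt => /predU1P[->|x1]; last by rewrite uz// x0.
apply/eqP; apply/negP => /negP u0n.
have cu1 : u z @[z --> 1^'-] --> u 1 by apply: cvg_at_left_filter; exact: cu.
have cn := cvgr_neq0 _ cu1 u0n.
near (1 : R)^'- => t.
have : u t != 0 by near: t; exact: cn.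
by rewrite uz ?eqxx//; apply/andP; split.
Unshelve. all: by end_near. Qed.

Definition ip u v := J (fun x => u x * v x).

Lemma ipC u v : ip u v = ip v u.
Proof. by apply: eq_J => x _; rewrite mulrC. Qed.

Lemma ipDr u v w : continuous u -> continuous v -> continuous w ->
  ip u (fun x => v x + w x) = ip u v + ip u w.
Proof.
move=> cu cv cw; rewrite /ip -JD; [|cts..].
by apply: eq_J => x _; rewrite mulrDr.
Qed.

Lemma ipBr u v w : continuous u -> continuous v -> continuous w ->
  ip u (fun x => v x - w x) = ip u v - ip u w.
Proof.
move=> cu cv cw; rewrite /ip -JB; [|cts..].
by apply: eq_J => x _; rewrite mulrBr.
Qed.

Lemma ipZr k u v : continuous u -> continuous v ->
  ip u (fun x => k * v x) = k * ip u v.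
Proof.
move=> cu cv; rewrite /ip -JZ; [|cts..].
by apply: eq_J => x _; rewrite mulrCA.
Qed.

Lemma ip_sum (I : Type) (s : seq I) u (v : I -> R -> R) : continuous u ->
  (forall i, continuous (v i)) ->
  continuous (fun x => \sum_(i <- s) v i x) /\
  ip u (fun x => \sum_(i <- s) v i x) = \sum_(i <- s) ip u (v i).
Proof.
move=> cu cv; elim: s => [|i s [c IH]].
  have E : (fun x => \sum_(i <- [::]) v i x) = (fun=> 0).
    by apply/funext => x; rewrite big_nil.
  rewrite E big_nil; split; first by cts.
  by rewrite (_ : (fun=> 0) = (fun x => 0 * u x)) ?ipZr ?mul0r//; apply/funext => x; rewrite mul0r.
have E : (fun x => \sum_(j <- i :: s) v j x) = (fun x => v i x + \sum_(j <- s) v j x).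
  by apply/funext => x; rewrite big_cons.
have cvi := cv i.
by rewrite E big_cons ipDr// IH; split => //; cts.
Qed.

Lemma ip_ge0 u : 0 <= ip u u.
Proof. by apply: J_ge0 => x _; rewrite -expr2 sqr_ge0. Qed.

Lemma disc_le (A B C : R) : (forall t, 0 <= A + 2 * t * B + t ^+ 2 * C) -> 0 <= C -> B ^+ 2 <= A * C.
Proof.
move=> H; rewrite le_eqVlt => /predU1P[C0|C0].
  rewrite -C0 mulr0; have [->|B0] := eqVneq B 0; first by rewrite expr0n.
  (* With C = 0 the expression is affine in t, and this t gives it the value -1. *)
  have := H (- (A + 1) / (2 * B)); rewrite -C0 mulr0 addr0.
  by rewrite (_ : 2 * _ * B = - (A + 1)); [lra|field].
have := H (- B / C).
rewrite (_ : A + _ + _ = (A * C - B ^+ 2) / C); last by field; rewrite gt_eqF.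
by rewrite pmulr_lge0 ?invr_gt0// subr_ge0.
Qed.

Lemma cauchy_schwarz u v : continuous u -> continuous v ->
  ip u v ^+ 2 <= ip u u * ip v v.
Proof.
move=> cu cv; apply: disc_le; last exact: ip_ge0.
move=> t; have <- : ip (fun x => u x + t * v x) (fun x => u x + t * v x) =
   ip u u + 2 * t * ip u v + t ^+ 2 * ip v v; last exact: ip_ge0.
have ctv : continuous (fun x => t * v x) by cts.
have cutv : continuous (fun x => u x + t * v x) by cts.
rewrite ipDr// ipZr// ipC ipDr// [ip _ v]ipC ipDr// !ipZr// (ipC v u).
by ring.
Qed.

Lemma cauchy_schwarzX u v : continuous u -> continuous v ->
  J (fun x => x * u x * v x) ^+ 2 <= J (fun x => x * u x * u x) * J (fun x => x * v x * v x).
Proof.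
move=> cu cv; apply: disc_le; last first.
  by apply: J_ge0 => x /andP[x0 _]; rewrite -mulrA mulr_ge0// -expr2 sqr_ge0.
move=> t.
have <- : J (fun x => x * (u x + t * v x) * (u x + t * v x)) =
   J (fun x => x * u x * u x) + 2 * t * J (fun x => x * u x * v x) + t ^+ 2 * J (fun x => x * v x * v x).
  rewrite -!JZ; [|cts..]; rewrite -!JD; [|cts..].
  by apply: eq_J => x _; ring.
by apply: J_ge0 => x /andP[x0 _]; rewrite -mulrA mulr_ge0// -expr2 sqr_ge0.
Qed.

(** The derivatives are explicit functions, so that integral identities can name them and closed
    formulas can be substituted for them. *)
Definition C2 u du ddu := [/\ forall x : R, is_derive x (1:R) u (du x),
  forall x : R, is_derive x (1:R) du (ddu x) & continuous ddu].

Lemma derive_continuous u du : (forall x : R, is_derive x (1:R) u (du x)) -> continuous u.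
Proof.
move=> d x; apply: differentiable_continuous; apply/derivable1_diffP.
exact: (@ex_derive _ _ _ _ _ _ _ (d x)).
Qed.

Lemma C2_continuous u du ddu : C2 u du ddu -> continuous u /\ continuous du.
Proof. by case=> d dd _; split; apply: derive_continuous; eauto. Qed.

(** Green's identity: [J_ftc] for the product u v'. *)
Lemma J_green u du ddu v dv ddv : C2 u du ddu -> C2 v dv ddv ->
  J (fun x => u x * (a * dv x + x * ddv x)) + J (fun x => x * du x * dv x) = u 1 * dv 1.
Proof.
move=> Cu Cv; have [cu cdu] := C2_continuous Cu; have [cv cdv] := C2_continuous Cv.
case: Cu => Du _ cddu; case: Cv => Dv Ddv cddv.
rewrite -(@J_ftc (fun x => u x * dv x) (fun x => u x * ddv x + dv x * du x)); [|cts|cts].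
  rewrite -JD; [|cts..].
  by apply: eq_J => x _; ring.
Qed.

(* Rellich's identity: multiply the equation by [2 x u' + (a - 1) u]. *)
Lemma J_rellich w u du ddu : C2 u du ddu -> u 1 = 0 ->
  w * ip u u + J (fun x => (2 * x * du x + (a - 1) * u x) * (a * du x + x * ddu x + w * u x))
  = du 1 * du 1.
Proof.
move=> Cu u1; have [cu cdu] := C2_continuous Cu.
case: Cu => Du Ddu cddu.
pose Y x := x * du x * du x + w * (u x * u x) + (a - 1) * (u x * du x).
pose dY x := (du x * du x + 2 * x * du x * ddu x) + w * (2 * u x * du x) + (a - 1) * (u x * ddu x + du x * du x).
have cY : continuous Y by rewrite /Y; cts.
have cdY : continuous dY by rewrite /dY; cts.
have Y1 : Y 1 = du 1 * du 1 by rewrite /Y u1; ring.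
have DY (x : R) : 0 < x < 1 -> is_derive x (1:R) Y (dY x).
  move=> _.
  have D1 := is_deriveM (is_deriveM (is_derive_id x (1:R)) (Ddu x)) (Ddu x).
  have D2 := is_deriveM (is_derive_cst w x (1:R)) (is_deriveM (Du x) (Du x)).
  have D3 := is_deriveM (is_derive_cst (a - 1) x (1:R)) (is_deriveM (Du x) (Ddu x)).
  have H := is_deriveD (is_deriveD D1 D2) D3.
  by apply: (is_derive_eq H); rewrite /dY /GRing.scale /= !fctE /=; ring.
rewrite -Y1 -(@J_ftc Y dY cY cdY DY).
rewrite /ip -JZ; [|cts..]; rewrite -JD; [|cts..].
by apply: eq_J => x _; rewrite /Y /dY; ring.
Qed.

End WeightedIntegral.

(** * A priori estimates for the Bessel operator with a zero boundary value *)

Section Stability.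
Variable R : realType.
Variable a : R.
Hypothesis a0 : 0 < a.
Implicit Types z dz ddz u e : R -> R.

Notation J := (J a).
Notation ip := (ip a).

(** This is x^(1-a) (x^a z')', which is symmetric for [ip] on functions vanishing at 1. *)
Definition L dz ddz := fun x : R => a * dz x + x * ddz x.
Definition resid w z dz ddz := fun x : R => L dz ddz x + w * z x.

(* Rellich's identity, the energy identity of [J_green] and AM-GM. *)
Lemma rellich_stability w : 0 < w -> exists2 C, 0 <= C &
  forall z dz ddz, C2 z dz ddz -> z 1 = 0 ->
  ip z z <= C * (dz 1 * dz 1 + ip (resid w z dz ddz) (resid w z dz ddz)).
Proof.
(* The choice of [s] makes k s = w / 4. Of the term w [ip z z], one quarter then goes to the energy,
   one quarter to the AM-GM terms, and one half is left. *)
move=> w0; pose k : R := `|a - 1| + 1; pose s : R := w / (4 * k).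
have k1 : 1 <= k by rewrite lerDr.
have k0 : 0 <= k := le_trans ler01 k1.
have s0 : 0 < s by rewrite divr_gt0//; lra.
pose C : R := (2 / w) * (5 + k / (4 * s)).
have k4 : 0 <= k / (4 * s) by rewrite divr_ge0// mulr_ge0// ltW.
have C0 : 0 <= C by rewrite /C mulr_ge0 ?divr_ge0 ?addr_ge0 ?(ltW w0).
exists C => // z dz ddz Cz z1; have [cz cdz] := C2_continuous Cz.
have [_ _ cddz] := Cz.
set eta := resid w z dz ddz.
have ceta : continuous eta by rewrite /eta /resid /L; cts.
have R1 := J_rellich a0 w Cz z1.
have G1 := J_green a0 Cz Cz; rewrite z1 mul0r in G1.
set Z := ip z z in R1 *; set N := ip eta eta; set D := dz 1 * dz 1 in R1 *.
set E := J (fun x => x * dz x * dz x) in G1.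
have N0 : 0 <= N by apply: ip_ge0.
have Z0 : 0 <= Z by apply: ip_ge0.
have D0 : 0 <= D by rewrite /D -expr2 sqr_ge0.
have GE : E = w * Z - ip z eta.
  have : ip z eta = J (fun x => z x * (a * dz x + x * ddz x)) + w * Z.
    rewrite /Z /ip -JZ//; last by cts.
    rewrite -JD//; [|cts..]. by apply: eq_J => // x _; rewrite /eta /resid /L; ring.
  by move: G1; lra.
have RE : w * Z + J (fun x => 2 * x * dz x * eta x) + (a - 1) * ip z eta = D.
  rewrite -R1 -addrA; congr (_ + _).
  rewrite /ip -JZ//; last by cts.
  rewrite -JD//; [|cts..]. by apply: eq_J => // x _; rewrite /eta /resid /L; ring.
have I1 : - J (fun x => 2 * x * dz x * eta x) <= 4^-1 * E + 4 * N.
  rewrite -subr_ge0 opprK /E /N /ip -!JZ//; [|cts..].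
  rewrite -!JD//; [|cts..].
  apply: J_ge0 => // x /andP[x0 x1].
  have := sqr_ge0 (4^-1 * dz x + eta x) => H1.
  have H2 : 0 <= x * (4^-1 * dz x + eta x) ^+ 2 by rewrite mulr_ge0.
  have H3 : 0 <= (1 - x) * (eta x) ^+ 2 by rewrite mulr_ge0 ?sqr_ge0// subr_ge0.
  have -> : 4^-1 * (x * dz x * dz x) + 4 * (eta x * eta x) + 2 * x * dz x * eta x
     = 4 * (x * (4^-1 * dz x + eta x) ^+ 2 + (1 - x) * eta x ^+ 2) by field.
  by rewrite mulr_ge0// addr_ge0.
have I2 : `|ip z eta| <= s * Z + N / (4 * s).
  have H t : 0 <= Z + 2 * t * ip z eta + t ^+ 2 * N.
    have <- : ip (fun x => z x + t * eta x) (fun x => z x + t * eta x) =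
       Z + 2 * t * ip z eta + t ^+ 2 * N; last exact: ip_ge0.
    rewrite /Z /N /ip -!JZ//; [|cts..].
    rewrite -!JD//; [|cts..]. by apply: eq_J => // x _; ring.
  rewrite ler_norml; apply/andP; split.
    have := mulr_ge0 (ltW s0) (H (2 * s)^-1).
    have -> : s * (Z + 2 * (2 * s)^-1 * ip z eta + (2 * s)^-1 ^+ 2 * N) =
      s * Z + ip z eta + N / (4 * s) by field; rewrite gt_eqF.
    by lra.
  have := mulr_ge0 (ltW s0) (H (- (2 * s)^-1)).
  have -> : s * (Z + 2 * - (2 * s)^-1 * ip z eta + (- (2 * s)^-1) ^+ 2 * N) =
    s * Z - ip z eta + N / (4 * s) by field; rewrite gt_eqF.
  by lra.
have I3 : - ((a - 1) * ip z eta) <= `|a - 1| * (s * Z + N / (4 * s)).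
  rewrite (le_trans (ler_norm _))// normrN normrM ler_wpM2l//.
have I4 : - ip z eta <= s * Z + N / (4 * s).
  by rewrite (le_trans (ler_norm _))// normrN.
have ks : k * s = w / 4 by rewrite /s; field; rewrite gt_eqF//; lra.
have X0 : 0 <= s * Z + N / (4 * s).
  exact: le_trans (normr_ge0 _) I2.
have I5 : `|a - 1| * (s * Z + N / (4 * s)) + (s * Z + N / (4 * s)) = k * s * Z + k / (4 * s) * N.
  by rewrite /k; ring.
have F : w * Z <= 2 * D + 2 * (4 + k / (4 * s)) * N.
  move: I5; rewrite ks => I5.
  have I6 : `|a - 1| * (s * Z + N / (4 * s)) >= 0 by rewrite mulr_ge0.
  move: (s * Z + N / (4 * s)) I3 I4 I5 I6 X0 => X.
  move: (k / (4 * s)) => T; rewrite mulrDr mulrDl.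
  move: (`|a - 1| * X) => Y; move: ((a - 1) * _) RE GE I1 => Q; move: (ip z eta) => P.
  by lra.
move: F k4; rewrite /C; set T := k / (4 * s) => F k4.
have -> : 2 / w * (5 + T) * (D + N) = 2 * (5 + T) * (D + N) / w by field; rewrite gt_eqF.
rewrite ler_pdivlMr// [Z * w]mulrC.
have TN : 0 <= T * N by rewrite mulr_ge0.
have TD : 0 <= T * D by rewrite mulr_ge0.
by lra.
Qed.

(** The solution of L u = - lam u that is regular at 0, with u(0) = 1. It satisfies the boundary
    condition at 1 exactly when [Phi a lam] vanishes. *)
Definition E lam (x : R) := Phi a (lam * x).
Definition dE lam (x : R) := lam * (- a^-1 * Phi (a + 1) (lam * x)).
Definition ddE lam (x : R) := lam * (- a^-1 * (lam * (- (a + 1)^-1 * Phi (a + 1 + 1) (lam * x)))).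

Lemma is_derive_scale f df lam x : (forall x : R, is_derive x (1:R) f (df x)) ->
  is_derive x (1:R) (fun x => f (lam * x)) (lam * df (lam * x)).
Proof.
move=> H.
have H1 := is_deriveM (is_derive_cst lam x (1:R)) (is_derive_id x (1:R)).
have H2 := is_derive1_comp (H (lam * x)) H1.
by apply: (is_derive_eq H2); rewrite /GRing.scale /=; ring.
Qed.

Lemma C2_E lam : C2 (E lam) (dE lam) (ddE lam).
Proof.
have a1 : 0 < a + 1 by rewrite addr_gt0.
split.
- move=> x.
  exact: (@is_derive_scale _ (fun y => - a^-1 * Phi (a + 1) y) lam x (fun y => is_derive_Phi y a0)).
- move=> x; have H := is_derive_scale lam x (fun y => is_derive_Phi y a1).
  have H1 := is_deriveM (is_derive_cst (lam * - a^-1) x (1:R)) H.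
  have -> : dE lam = cst (lam * - a^-1) * (fun x => Phi (a + 1) (lam * x)).
    by apply/funext => y; rewrite /dE !fctE /= mulrA.
  by apply: (is_derive_eq H1); rewrite /ddE /GRing.scale /= ; ring.
- have cP : continuous (Phi (a + 1 + 1)) by apply: continuous_Phi; rewrite addr_gt0.
  have cl : continuous (fun x : R => lam * x) by cts.
  have cc := cont_comp cP cl.
  by rewrite /ddE; cts.
Qed.

Lemma L_E lam x : L (dE lam) (ddE lam) x = - lam * E lam x.
Proof.
rewrite /L /E (Phi_contig _ a0) /dE /ddE.
have -> : a + 2 = a + 1 + 1 by lra.
by field; rewrite ?gt_eqF ?addr_gt0.
Qed.

Lemma E0 lam : E lam 0 = 1.
Proof. by rewrite /E mulr0 Phi0. Qed.

(** Green's identity in both orders: the energy terms cancel and one boundary term survives. It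
    bounds [dz 1] when [E w 1] is nonzero, and it gives orthogonality relations when [E w 1] is
    zero. *)
Lemma ip_E_resid w z dz ddz : C2 z dz ddz -> z 1 = 0 ->
  E w 1 * dz 1 = ip (E w) (resid w z dz ddz).
Proof.
move=> Cz z1; have CE := C2_E w.
have G1 := J_green a0 CE Cz; have G2 := J_green a0 Cz CE.
rewrite z1 mul0r in G2.
have [cz cdz] := C2_continuous Cz; have [_ _ cddz] := Cz.
have [cE cdE] := C2_continuous CE; have [_ _ cddE] := CE.
rewrite -G1 -[LHS]subr0 -[in LHS]G2 opprD addrACA.
have -> : J (fun x => x * dE w x * dz x) = J (fun x => x * dz x * dE w x).
  by apply: eq_J => // x _; ring.
rewrite subrr addr0 /ip -JB//; [|cts..].
apply: eq_J => // x _; have := L_E w x; rewrite /resid /L => ->.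
by ring.
Qed.

Lemma ip_E_E_rellich lam : E lam 1 = 0 -> lam * ip (E lam) (E lam) = dE lam 1 * dE lam 1.
Proof.
move=> E1; have CE := C2_E lam; rewrite -(J_rellich a0 lam CE E1) -[LHS]addr0; congr (_ + _).
rewrite -[LHS](mul0r (J (E lam))) -JZ//; last by have [] := C2_continuous CE.
by apply: eq_J => // x _; have := L_E lam x; rewrite /L => ->; ring.
Qed.

(** A vanishing boundary derivative would make the norm of the eigenfunction zero by
    [ip_E_E_rellich], against [E lam 0 = 1]. In particular the zeros of [Phi a] are simple. *)
Lemma dE_neq0 lam : E lam 1 = 0 -> dE lam 1 != 0.
Proof.
move=> E1; apply/negP => /eqP dE1; have := ip_E_E_rellich E1.
rewrite dE1 mulr0 => /eqP; rewrite mulf_eq0 => /orP[/eqP l0|/eqP ip0].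
  by move: E1; rewrite /E l0 mul0r Phi0// => /eqP; rewrite oner_eq0.
have [cE _] := C2_continuous (C2_E lam).
have EE (x : R) : 0 <= x <= 1 -> 0 <= E lam x * E lam x by rewrite -expr2 sqr_ge0.
have := J_eq0 a0 (contM cE cE) EE ip0 (x := 0).
by rewrite lexx ler01 E0 mulr1 => /(_ isT)/eqP; rewrite oner_eq0.
Qed.

(* If [E w 1] vanishes, a multiple of [E w] is subtracted from [z] to make the
   boundary derivative vanish; otherwise [ip_E_resid] controls it. *)
Lemma E_stability w : 0 < w -> exists2 C, 0 <= C &
  forall z dz ddz, C2 z dz ddz -> z 1 = 0 -> (E w 1 = 0 -> ip z (E w) = 0) ->
  ip z z <= C * ip (resid w z dz ddz) (resid w z dz ddz).
Proof.
move=> w0; have [C C0 H] := rellich_stability w0.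
have CE := C2_E w.
have [cE cdE] := C2_continuous CE; have [_ _ cddE] := CE.
have [Ew|Ew] := eqVneq (E w 1) 0.
  exists C => // z dz ddz Cz z1 /(_ Ew) zE.
  have [cz cdz] := C2_continuous Cz; have [dz1 dz2 cddz] := Cz.
  have [E1 E2 _] := CE.
  have dEw := dE_neq0 Ew.
  pose c := dz 1 / dE w 1.
  pose y x := z x - c * E w x; pose dy x := dz x - c * dE w x; pose ddy x := ddz x - c * ddE w x.
  have Cy : C2 y dy ddy.
    split; last by rewrite /ddy; cts.
    - move=> x; have H1 := is_deriveB (dz1 x) (is_deriveM (is_derive_cst c x (1:R)) (E1 x)).
      by apply: (is_derive_eq H1); rewrite /dy /GRing.scale /=; ring.
    - move=> x; have H1 := is_deriveB (dz2 x) (is_deriveM (is_derive_cst c x (1:R)) (E2 x)).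
      by apply: (is_derive_eq H1); rewrite /ddy /GRing.scale /=; ring.
  have y1 : y 1 = 0 by rewrite /y z1 Ew mulr0 subr0.
  have dy1 : dy 1 = 0 by rewrite /dy /c divfK// subrr.
  have := H _ _ _ Cy y1; rewrite dy1 mulr0 add0r => Hy.
  have -> : resid w z dz ddz = resid w y dy ddy.
    apply/funext => x; have := L_E w x; rewrite /resid /L /y /dy /ddy => LE.
    have -> : a * (dz x - c * dE w x) + x * (ddz x - c * ddE w x) =
      a * dz x + x * ddz x - c * (a * dE w x + x * ddE w x) by ring.
    by rewrite LE; ring.
  apply: le_trans Hy.
  have -> : ip y y = ip z z + c ^+ 2 * ip (E w) (E w) - 2 * c * ip z (E w).
    rewrite /ip -!JZ//; [|cts..].
    rewrite -!JD//; [|cts..].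
    rewrite -!JB//; [|cts..].
    by apply: eq_J => // x _; rewrite /y; ring.
  by rewrite zE mulr0 subr0 lerDl mulr_ge0 ?sqr_ge0 ?ip_ge0.
exists (C * (ip (E w) (E w) / (E w 1) ^+ 2 + 1)) => [|z dz ddz Cz z1 _].
  by rewrite mulr_ge0// addr_ge0// divr_ge0 ?sqr_ge0 ?ip_ge0.
have [cz cdz] := C2_continuous Cz; have [dz1 dz2 cddz] := Cz.
have ceta : continuous (resid w z dz ddz) by rewrite /resid /L; cts.
apply: le_trans (H _ _ _ Cz z1) _; rewrite -mulrA ler_wpM2l// mulrDl mul1r lerD2r.
have := cauchy_schwarz a0 cE ceta; rewrite -(ip_E_resid w Cz z1) exprMn.
rewrite [X in X <= _ -> _]mulrC -ler_pdivlMr ?exprn_even_gt0//.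
by rewrite -expr2 mulrAC.
Qed.

End Stability.

(** * Moments of the iterates of the inverse operator, and their growth rate *)

Section Rayleigh.
Variable R : realType.
Variable a : R.
Hypothesis a0 : 0 < a.
Notation J := (J a).
Notation ip := (ip a).

(** A Hardy-type inequality: [J_ftc] for z^2 expresses a [ip z z] as -2 times the integral of x z
    z', which Cauchy-Schwarz with the extra weight x <= 1 bounds by the energy. *)
Lemma poincare (z dz ddz : R -> R) : C2 z dz ddz -> z 1 = 0 ->
  a ^+ 2 * ip z z <= 4 * J (fun x => x * dz x * dz x).
Proof.
move=> Cz z1; have [cz cdz] := C2_continuous Cz; have [Dz _ _] := Cz.
have H : a * ip z z + 2 * J (fun x => x * z x * dz x) = 0.
  rewrite /ip -!JZ//; [|cts..]; rewrite -JD//; [|cts..].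
  transitivity (z 1 * z 1); last by rewrite z1 mulr0.
  have D (x : R) : 0 < x < 1 -> is_derive x (1:R) (fun x => z x * z x) (2 * z x * dz x).
    move=> _; have D := is_deriveM (Dz x) (Dz x).
    by apply: (is_derive_eq D); rewrite /GRing.scale/=; ring.
  have c1 : continuous (fun x => z x * z x) by cts.
  have c2 : continuous (fun x => 2 * z x * dz x) by cts.
  rewrite -(J_ftc a0 c1 c2 D).
  by apply: eq_J => // x _; ring.
have CS := cauchy_schwarzX a0 cz cdz.
have Z0 := ip_ge0 a0 z.
have ZX : J (fun x => x * z x * z x) <= ip z z.
  apply: le_J => //; [cts..|] => x /andP[x0 x1].
  by rewrite -mulrA ler_piMl// -expr2 sqr_ge0.
set Z := ip z z in H Z0 ZX *; set D := J (fun x => x * dz x * dz x) in CS *.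
set X := J (fun x => x * z x * dz x) in H CS.
have D0 : 0 <= D.
  by apply: J_ge0 => // x /andP[x0 _]; rewrite -mulrA mulr_ge0// -expr2 sqr_ge0.
have CS' : X ^+ 2 <= Z * D by apply: le_trans CS _; rewrite ler_wpM2r.
have [->|Zn0] := eqVneq Z 0; first by rewrite mulr0 mulr_ge0.
have Zp : 0 < Z by rewrite lt_def Zn0.
rewrite -(ler_pM2r Zp).
have -> : a ^+ 2 * Z * Z = 4 * X ^+ 2.
  have -> : a ^+ 2 * Z * Z = (a * Z) ^+ 2 by ring.
  have -> : a * Z = - (2 * X) by lra.
  by ring.
by rewrite -mulrA ler_pM2l// mulrC.
Qed.

Variables (u du ddu : nat -> R -> R).
Hypothesis uC2 : forall k, C2 (u k) (du k) (ddu k).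
Hypothesis Lu : forall k x, L a (du k.+1) (ddu k.+1) x = - u k x.
Hypothesis u1 : forall k, u k.+1 1 = 0.

Let cu k : continuous (u k). Proof. by have [] := C2_continuous (uC2 k). Qed.
Let cdu k : continuous (du k). Proof. by have [] := C2_continuous (uC2 k). Qed.

(** With T the inverse of - L under the condition at 1, [u k] is T^k (u 0). This is the k-th moment
    of the spectral measure of T at [u 0], and by [ip_moment] it is also the product of [u i] and
    [u l] whenever i + l = k. *)
Definition moment k := ip (u 0%N) (u k).
Notation b := moment.

Lemma ip_energy k l : ip (u k.+1) (u l) = J (fun x => x * du k.+1 x * du l.+1 x).
Proof.
have := J_green a0 (uC2 k.+1) (uC2 l.+1); rewrite u1 mul0r.
have -> : J (fun x => u k.+1 x * (a * du l.+1 x + x * ddu l.+1 x)) = - ip (u k.+1) (u l).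
  have c1 := @cu k.+1; have c2 := @cu l.
  rewrite /ip -mulN1r -JZ//; last by cts.
  by apply: eq_J => // x _; have := Lu l x; rewrite /L => ->; ring.
by lra.
Qed.

Lemma ip_shift k l : ip (u k.+1) (u l) = ip (u k) (u l.+1).
Proof.
rewrite ip_energy [RHS](ipC a0) ip_energy.
by apply: eq_J => // x _; ring.
Qed.

Lemma ip_moment k l : ip (u k) (u l) = b (k + l).
Proof. by elim: k l => [//|k IH] l; rewrite ip_shift IH addnS. Qed.

Lemma moment_even j : b (j + j) = ip (u j) (u j).
Proof. by rewrite ip_moment. Qed.

Lemma moment_odd j l : b (j + l).+1 = J (fun x => x * du j.+1 x * du l.+1 x).
Proof. by rewrite -ip_energy ip_moment. Qed.

Lemma moment_ge0 k : 0 <= b k.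
Proof.
rewrite -(odd_double_half k) -addnn; case: odd; rewrite ?add0n ?add1n.
  rewrite moment_odd; apply: J_ge0 => // x /andP[x0 _].
  by rewrite -mulrA mulr_ge0// -expr2 sqr_ge0.
by rewrite moment_even ip_ge0.
Qed.

(** Cauchy-Schwarz, in the norm of [ip] for even k and in the energy norm for odd k. *)
Lemma moment_logconvex k : b k.+1 ^+ 2 <= b k * b k.+2.
Proof.
rewrite -(odd_double_half k) -addnn; case: odd; rewrite ?add0n ?add1n; set j := k./2.
  have e1 : b (j + j).+2 = J (fun x => x * du j.+1 x * du j.+2 x).
    by rewrite -moment_odd addnS.
  have e2 : b (j + j).+3 = J (fun x => x * du j.+2 x * du j.+2 x).
    by rewrite -moment_odd addSn addnS.
  rewrite e1 e2 moment_odd.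
  by apply: cauchy_schwarzX; [exact: a0|exact: cdu|exact: cdu].
have e1 : b (j + j).+1 = ip (u j) (u j.+1) by rewrite ip_moment addnS.
have e2 : b (j + j).+2 = ip (u j.+1) (u j.+1) by rewrite ip_moment addSn addnS.
rewrite e1 e2 moment_even.
by apply: cauchy_schwarz; [exact: a0|exact: cu|exact: cu].
Qed.

(** It bounds the ratios of consecutive moments, so that [moment_gap] can take their supremum. *)
Lemma moment_ratio_bound j : a ^+ 2 * b (j + j).+2 <= 4 * b (j + j).+1.
Proof.
rewrite moment_odd -addSn -addnS moment_even.
exact: (poincare (uC2 j.+1) (u1 j)).
Qed.

Lemma ip_resid w j : ip (resid a w (u j.+1) (du j.+1) (ddu j.+1))
    (resid a w (u j.+1) (du j.+1) (ddu j.+1))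
  = b (j + j) - 2 * w * b (j + j).+1 + w ^+ 2 * b (j + j).+2.
Proof.
have -> : resid a w (u j.+1) (du j.+1) (ddu j.+1) = fun x => - u j x + w * u j.+1 x.
  by apply/funext => x; rewrite /resid Lu.
have c1 := @cu j; have c2 := @cu j.+1.
have e1 : b (j + j).+1 = ip (u j) (u j.+1) by rewrite ip_moment addnS.
have e2 : b (j + j).+2 = ip (u j.+1) (u j.+1) by rewrite ip_moment addSn addnS.
rewrite e1 e2 moment_even /ip.
rewrite -!JZ//; [|cts..]; rewrite -JB//; [|cts..]; rewrite -JD//; [|cts..].
by apply: eq_J => // x _; ring.
Qed.

(* If the inequality failed for some [k], log-convexity would make the ratios of
   consecutive moments increase to some [rho > theta], and the [u j.+1] would be
   almost solutions of the equation with parameter [rho^-1]. *)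
Lemma moment_gap theta : 0 < theta ->
  (forall w, 0 < w -> w < theta^-1 -> exists2 C, 0 <= C & forall j,
    ip (u j.+1) (u j.+1) <= C * ip (resid a w (u j.+1) (du j.+1) (ddu j.+1))
      (resid a w (u j.+1) (du j.+1) (ddu j.+1))) ->
  forall k, b k.+1 <= theta * b k.
Proof.
move=> th0 stab k0; rewrite leNgt; apply/negP => gap.
have pos0 : 0 < b k0.
  rewrite lt_def moment_ge0 andbT; apply/negP => /eqP bk0.
  have := moment_logconvex k0; rewrite bk0 mul0r => H.
  have : b k0.+1 ^+ 2 == 0 by rewrite eq_le H sqr_ge0.
  by rewrite expf_eq0 /= => /eqP E; move: gap; rewrite E bk0 mulr0 ltxx.
have main i : 0 < b (k0 + i) /\ theta * b (k0 + i) < b (k0 + i).+1.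
  elim: i => [|i [p q]]; first by rewrite addn0.
  have p1 : 0 < b (k0 + i).+1 by apply: lt_trans q; rewrite mulr_gt0.
  rewrite addnS; split => //.
  have lc := moment_logconvex (k0 + i).
  rewrite -(ltr_pM2l p); apply: lt_le_trans lc.
  by rewrite expr2 mulrCA mulrA ltr_pM2r.
have pos k : (k0 <= k)%N -> 0 < b k by move=> /subnKC <-; have [] := main (k - k0)%N.
pose s k := b k.+1 / b k.
have s_gt k : (k0 <= k)%N -> theta < s k.
  by move=> kk; rewrite /s ltr_pdivlMr ?pos//; move: kk => /subnKC <-; have [] := main (k - k0)%N.
have s_mono k : (k0 <= k)%N -> s k <= s k.+1.
  move=> kk; rewrite /s ler_pdivrMr ?pos// mulrAC ler_pdivlMr ?pos ?leqW//.
  by rewrite -expr2 [leRHS]mulrC moment_logconvex.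
have s_mono2 k i : (k0 <= k)%N -> s k <= s (k + i)%N.
  move=> kk; elim: i => [|i IH]; first by rewrite addn0.
  by rewrite addnS (le_trans IH)// s_mono// (leq_trans kk)// leq_addr.
have s_bound k : (k0 <= k)%N -> s k <= 4 / a ^+ 2.
  (* The Poincare inequality only bounds the ratios of odd index, and k + (k + 1) is odd;
     monotonicity carries the bound back to k. *)
  move=> kk; apply: (@le_trans _ _ (s (k + (k.+1))%N)); first exact: s_mono2.
  rewrite /s addnS ler_pdivrMr; last by rewrite pos// (leq_trans kk)// leqW// leq_addr.
  rewrite mulrAC ler_pdivlMr ?exprn_gt0// mulrC; exact: moment_ratio_bound.
pose S := [set s k | k in [set k | (k0 <= k)%N]].
have supS : has_sup S.
  split; first by exists (s k0), k0 => /=.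
  by exists (4 / a ^+ 2) => _ [k kk <-]; exact: s_bound.
pose rho := sup S.
have s_le k : (k0 <= k)%N -> s k <= rho.
  by move=> kk; apply: ub_le_sup; [case: supS|exists k].
have rho_gt : theta < rho by apply: lt_le_trans (s_le k0 (leqnn _)); exact: s_gt.
have rho0 : 0 < rho by exact: lt_trans rho_gt.
have [||C C0 HC] := stab rho^-1; first by rewrite invr_gt0.
  by rewrite ltf_pV2.
(* For two consecutive ratios t <= t' with rho - e < t, stability at the parameter 1 / rho gives t'
   t <= C (1 - t / rho) <= (C / rho) e. This [e] makes the last term at most theta^2, which t' t
   exceeds. *)
pose e := theta ^+ 2 / (C / rho + 1).
have Cr0 : 0 <= C / rho by rewrite divr_ge0 ?(ltW rho0).
have e0 : 0 < e by rewrite divr_gt0 ?exprn_gt0//; lra.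
have [_ [k kk <-] sk] := sup_adherent e0 supS.
have kk0 : (k0 <= k + k)%N by rewrite (leq_trans kk)// leq_addr.
have sk2 : rho - e < s (k + k)%N by apply: lt_le_trans sk _; exact: s_mono2.
have := HC k; rewrite ip_resid ip_moment.
have bp := pos _ kk0.
have E1 : b (k + k).+1 = s (k + k)%N * b (k + k) by rewrite /s divfK// gt_eqF.
have E2 : b (k + k).+2 = s (k + k).+1 * (s (k + k)%N * b (k + k)).
  by rewrite -E1 /s divfK// gt_eqF// pos// leqW.
rewrite addSn addnS E2 E1.
move: sk2; set t := s (k + k)%N => sk2; set t' := s (k + k).+1; set N := b (k + k) in bp * => H.
have tt : t <= t' by exact: s_mono.
have t't : t' <= rho by apply: s_le; rewrite leqW.
have tth : theta < t by exact: s_gt.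
clearbody t t' N.
have {H} : t' * t <= C * (1 - 2 * rho^-1 * t + rho^-1 ^+ 2 * (t' * t)).
  rewrite -(ler_pM2r bp).
  have -> : t' * t * N = t' * (t * N) by ring.
  by apply: le_trans H _; rewrite le_eqVlt; apply/orP; left; apply/eqP; ring.
have w1 : rho^-1 ^+ 2 * (t' * t) <= rho^-1 * t.
  have -> : rho^-1 ^+ 2 * (t' * t) = (t' / rho) * (rho^-1 * t) by ring.
  rewrite ger_pMl ?ler_pdivrMr ?mul1r//.
  by rewrite mulr_gt0 ?invr_gt0// (lt_trans th0).
have w2 : theta ^+ 2 < t' * t.
  rewrite expr2 ltr_pM ?(ltW th0)//; exact: lt_le_trans tt.
have w3 : C * (1 - 2 * rho^-1 * t + rho^-1 ^+ 2 * (t' * t)) <= C * (1 - rho^-1 * t).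
  by rewrite ler_wpM2l//; lra.
have w4 : C * (1 - rho^-1 * t) <= C / rho * e.
  rewrite -mulrA ler_wpM2l// -(ler_pM2l rho0) mulrA mulfV ?gt_eqF// mul1r.
  rewrite mulrBr mulrA mulfV ?gt_eqF// mulr1 mul1r; lra.
have w5 : C / rho * e <= theta ^+ 2.
  by rewrite /e mulrCA ger_pMr ?exprn_gt0// ler_pdivrMr ?mul1r; lra.
lra.
Qed.

End Rayleigh.

(** * Fourier-Bessel remainders *)

Section EntireSums.
Variable R : realType.
Implicit Types (c : nat -> R) (x : R).

Lemma entire_geo c l : entire c -> entire (fun i => c i * l ^+ i).
Proof.
move=> ec r r0; have l1 : 0 < `|l| + 1 by rewrite ltr_wpDl.
have [|C C0 H] := ec (r / (`|l| + 1)); first by rewrite divr_gt0.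
exists C => // i; rewrite normrM normrX.
apply: le_trans (ler_wpM2r _ (H i)) _; first by rewrite exprn_ge0.
rewrite -mulrA ler_wpM2l// -exprMn lerXn2r ?nnegrE//.
- by rewrite mulr_ge0// divr_ge0// ltW.
- exact: ltW.
- by rewrite -mulrA ger_pMr// ler_pdivrMl// mulr1 lerDl.
Qed.

Lemma ps_geo c l x : ps (fun i => c i * l ^+ i) x = ps c (l * x).
Proof.
rewrite /ps; congr (limn _); apply/funext => n; rewrite /pseries /series/=.
by apply: eq_bigr => i _; rewrite exprMn mulrA.
Qed.

Lemma entire_fin c k : entire (fun i => if (i <= k)%N then c i else 0).
Proof.
move=> r r0; exists (\sum_(i < k.+1) `|c i| / r ^+ i) => [|i].
  by rewrite sumr_ge0// => i _; rewrite divr_ge0// exprn_ge0// ltW.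
have S0 : 0 <= \sum_(i < k.+1) `|c i| / r ^+ i.
  by rewrite sumr_ge0// => j _; rewrite divr_ge0// exprn_ge0// ltW.
case: leqP => ik; last by rewrite normr0 mulr_ge0// exprn_ge0// ltW.
rewrite -ler_pdivrMr ?exprn_gt0//.
rewrite (bigD1 (Ordinal (ik : (i < k.+1)%N)))//= lerDl sumr_ge0// => j _.
by rewrite divr_ge0// exprn_ge0// ltW.
Qed.

Lemma ps_fin c k x : ps (fun i => if (i <= k)%N then c i else 0) x = \sum_(i < k.+1) c i * x ^+ i.
Proof.
symmetry; apply: ps_unique; first exact: entire_fin.
rewrite -(cvg_shiftn k.+1).
have -> : (fun n => \sum_(i < n + k.+1) (if (i <= k)%N then c i else 0) * x ^+ i) =
  (fun=> \sum_(i < k.+1) c i * x ^+ i); last exact: cvg_cst.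
apply/funext => n; rewrite addnC big_split_ord/= [X in _ + X]big1 ?addr0 => [|i _].
  by apply: eq_bigr => i _; rewrite -ltnS ltn_ord.
by rewrite leqNgt ltnS leq_addr/= mul0r.
Qed.

Lemma ps_sum (I : Type) (s : seq I) (c : I -> nat -> R) x : (forall i, entire (c i)) ->
  entire (fun n => \sum_(i <- s) c i n) /\
  ps (fun n => \sum_(i <- s) c i n) x = \sum_(i <- s) ps (c i) x.
Proof.
move=> ec; elim: s => [|i s [e IH]].
  have -> : (fun n => \sum_(i <- [::]) c i n) = (fun n => if (n <= 0)%N then 0 else 0).
    by apply/funext => n; rewrite big_nil; case: ifP.
  split; first exact: entire_fin.
  by rewrite ps_fin big_nil big_ord1 mul0r.
have -> : (fun n => \sum_(j <- i :: s) c j n) = (fun n => c i n + \sum_(j <- s) c j n).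
  by apply/funext => n; rewrite big_cons.
split; first exact: entireD.
by rewrite big_cons psD// IH.
Qed.

Lemma C2_ps c : entire c ->
  C2 (ps c) (ps (pseries_diffs c)) (ps (pseries_diffs (pseries_diffs c))).
Proof.
move=> ec; have e1 := entire_diffs ec; have e2 := entire_diffs e1.
by split; [move=> x; exact: is_derive_ps|move=> x; exact: is_derive_ps|exact: continuous_ps].
Qed.

Lemma L_ps a c x : entire c ->
  L a (ps (pseries_diffs c)) (ps (pseries_diffs (pseries_diffs c))) x =
  ps (fun i => i.+1%:R * (a + i%:R) * c i.+1) x.
Proof.
move=> ec; have e1 := entire_diffs ec; have e2 := entire_diffs e1.
rewrite /L -psZ// -ps_shiftX// -psD; [|exact: entireZ|exact: entire_shiftX].
congr (ps _ x); apply/funext => -[|i]/=; rewrite /pseries_diffs.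
  by ring.
by rewrite -!(natr1 i.+1) -!(natr1 i); ring.
Qed.

End EntireSums.

Section FourierBessel.
Variable R : realType.
Variable a : R.
Hypothesis a0 : 0 < a.
Variables (lam r : nat -> R).
Hypothesis lam_gt0 : forall m, 0 < lam m.
Hypothesis lam_incr : forall m n, (m < n)%N -> lam m < lam n.
Hypothesis lam_zero : forall m, Phi a (lam m) = 0.
Hypothesis lam_all : forall y, 0 < y -> Phi a y = 0 -> exists m, y = lam m.
Hypothesis rE : forall k, \sum_(i < k.+1) phi a i * r (k - i)%N = (k == 0)%:R.

Notation ip := (ip a).
Notation E := (E a).
Notation dE := (dE a).
Notation ddE := (ddE a).

(** The Fourier-Bessel coefficient of the constant function 1 along [E (lam m)], by [ip_E_1] and
    [ip_E_E]. Since [dE (lam m) 1] is lam_m Phi'(lam_m), the fraction g_m / (1 - w / lam_m) is also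
    the polar part of 1 / Phi at lam_m. *)
Definition gcoef m := - (dE (lam m) 1)^-1.

Definition rho M k i : R := (if (i <= k)%N then r (k - i) else 0) -
  \sum_(m < M) gcoef m * lam m ^+ i / lam m ^+ k.

(* [r] is the inverse series of [phi a], so the first part of [rho] gives the
   coefficient of [w ^+ k] in [Phi kap (x * w) / Phi a w]; the second part
   removes its poles at the first [M] zeros. *)
Definition remainder kap M k := ps (fun i => phi kap i * rho M k i).

Lemma remainder_expand kap M k x : 0 < kap ->
  entire (fun i => phi kap i * rho M k i) /\
  remainder kap M k x = \sum_(i < k.+1) phi kap i * r (k - i)%N * x ^+ i -
    \sum_(m < M) gcoef m / lam m ^+ k * Phi kap (lam m * x).
Proof.
move=> k0; have ep := entire_phi k0.
have e1 := @entire_fin _ (fun i => phi kap i * r (k - i)%N) k.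
have e2 m : entire (fun i => gcoef m / lam m ^+ k * (phi kap i * lam m ^+ i)).
  by apply: entireZ; apply: entire_geo.
have [e3 s3] := ps_sum (index_enum 'I_M) x (fun m : 'I_M => e2 m).
have -> : (fun i => phi kap i * rho M k i) = (fun i =>
   (if (i <= k)%N then phi kap i * r (k - i)%N else 0) +
   -1 * \sum_(m < M) gcoef m / lam m ^+ k * (phi kap i * lam m ^+ i)).
  apply/funext => i; rewrite /rho mulrBr mulN1r; congr (_ - _).
    by case: ifP; rewrite ?mulr0.
  by rewrite mulr_sumr; apply: eq_bigr => m _; ring.
split; first by apply: entireD => //; apply: entireZ.
have -> : remainder kap M k x = ps (fun i =>
   (if (i <= k)%N then phi kap i * r (k - i)%N else 0) +
   -1 * \sum_(m < M) gcoef m / lam m ^+ k * (phi kap i * lam m ^+ i)) x.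
  rewrite /remainder; congr (ps _ x).
  apply/funext => i; rewrite /rho mulrBr mulN1r; congr (_ - _).
    by case: ifP; rewrite ?mulr0.
  by rewrite mulr_sumr; apply: eq_bigr => m _; ring.
rewrite psD//; last by apply: entireZ.
rewrite psZ// s3 ps_fin mulN1r; congr (_ - _).
by apply: eq_bigr => m _; rewrite psZ ?ps_geo//; apply: entire_geo.
Qed.

Lemma r0 : r 0%N = 1.
Proof. by have := rE 0; rewrite big_ord1 phi0 mul1r. Qed.

Lemma E_lam1 m : E (lam m) 1 = 0.
Proof. by rewrite /E mulr1. Qed.

Lemma lam_inj m n : lam m = lam n -> m = n.
Proof.
case: (ltngtP m n) => // mn e; [have := lam_incr mn|have := lam_incr mn]; rewrite e ltxx//.
Qed.

(** [rho M k i] depends on k - i only. This is why L lowers k by one in [remainder_L], and why a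
    shift of the series becomes a change of k in [remainder_shift]. *)
Lemma rho_SS M k i : rho M k.+1 i.+1 = rho M k i.
Proof.
rewrite /rho subSS ltnS; congr (_ - _); apply: eq_bigr => m _.
by rewrite !exprS; field; rewrite expf_neq0 gt_eqF.
Qed.

Lemma phi_rec i : i.+1%:R * (a + i%:R) * phi a i.+1 = - phi a i.
Proof.
rewrite /phi factS natrM pochhammerS exprS.
have p0 := pochhammer_gt0 i a0.
field; rewrite ?gt_eqF//= ?ltr0n ?fact_gt0//.
by rewrite ltr_wpDr.
Qed.

Notation u M k := (remainder a M k).
Definition d_remainder M k := ps (pseries_diffs (fun i => phi a i * rho M k i)).
Definition dd_remainder M k := ps (pseries_diffs (pseries_diffs (fun i => phi a i * rho M k i))).

Lemma remainder_C2 M k : C2 (u M k) (d_remainder M k) (dd_remainder M k).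
Proof. by apply: C2_ps; have [] := remainder_expand M k 0 a0. Qed.

Lemma remainder_L M k x : L a (d_remainder M k.+1) (dd_remainder M k.+1) x = - u M k x.
Proof.
have [e _] := remainder_expand M k x a0; have [e1 _] := remainder_expand M k.+1 x a0.
rewrite L_ps// -[RHS]mulN1r /remainder -psZ//; congr (ps _ x); apply/funext => i.
by rewrite rho_SS mulrA phi_rec; ring.
Qed.

(** At x = 1 the first part is the coefficient of w^(k+1) in Phi / Phi = 1, and each subtracted
    eigenfunction vanishes. *)
Lemma remainder_1 M k : u M k.+1 1 = 0.
Proof.
have [_ ->] := remainder_expand M k.+1 1 a0.
rewrite [X in _ - X]big1 => [|m _]; last by rewrite mulr1 lam_zero mulr0.
rewrite subr0 -[RHS](rE k.+1); apply: eq_bigr => i _; by rewrite expr1n mulr1.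
Qed.

Lemma remainder_0 M x : u M 0 x = 1 - \sum_(m < M) gcoef m * E (lam m) x.
Proof.
have [_ ->] := remainder_expand M 0 x a0.
rewrite big_ord1 phi0 r0 !mulr1; congr (_ - _).
by apply: eq_bigr => m _; rewrite expr0 divr1.
Qed.

Let cE l : continuous (E l). Proof. by have [] := C2_continuous (C2_E a0 l). Qed.

Lemma ip_E_1 m : ip (E (lam m)) (fun=> 1) = - dE (lam m) 1 / lam m.
Proof.
have C1 : C2 (fun _ : R => (1 : R)) (fun=> 0) (fun=> 0).
  by split; [move=> x; exact: is_derive_cst|move=> x; exact: is_derive_cst|cts].
have := J_green a0 C1 (C2_E a0 (lam m)).
have -> : J a (fun x => 1 * (a * dE (lam m) x + x * ddE (lam m) x)) = - lam m * ip (E (lam m)) (fun=> 1).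
  have cc := @cE (lam m).
  rewrite /ip -JZ//; last by cts.
  by apply: eq_J => // x _; have := L_E a0 (lam m) x; rewrite /L => ->; ring.
have -> : J a (fun x => x * 0 * dE (lam m) x) = 0.
  rewrite -[RHS](mul0r (J a (E (lam m)))) -JZ//.
  by apply: eq_J => // x _; ring.
rewrite addr0 mul1r => <-; field; by rewrite gt_eqF.
Qed.

Lemma ip_E_neq m l : m != l -> ip (E (lam m)) (E (lam l)) = 0.
Proof.
move=> ml; have := ip_E_resid a0 (lam m) (C2_E a0 (lam l)) (E_lam1 l).
have -> : resid a (lam m) (E (lam l)) (dE (lam l)) (ddE (lam l)) =
  (fun x => (lam m - lam l) * E (lam l) x).
  by apply/funext => x; rewrite /resid L_E//; ring.
rewrite E_lam1 mul0r ipZr// => /esym/eqP; rewrite mulf_eq0 => /orP[|/eqP//].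
by rewrite subr_eq0 => /eqP/lam_inj/eqP; rewrite (negPf ml).
Qed.

Lemma ip_E_E m : ip (E (lam m)) (E (lam m)) = dE (lam m) 1 ^+ 2 / lam m.
Proof.
rewrite expr2 -(ip_E_E_rellich a0 (E_lam1 m)); field; by rewrite gt_eqF.
Qed.

Lemma dE1_neq0 m : dE (lam m) 1 != 0.
Proof. exact: (dE_neq0 a0 (E_lam1 m)). Qed.

Let cu M k : continuous (u M k). Proof. by have [] := C2_continuous (remainder_C2 M k). Qed.

Lemma ip_u0 M (v : R -> R) : continuous v ->
  ip v (u M 0) = ip v (fun=> 1) - \sum_(m < M) gcoef m * ip v (E (lam m)).
Proof.
move=> cv.
have cg (m : 'I_M) : continuous (fun x => gcoef m * E (lam m) x).
  by have cc := @cE (lam m); cts.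
have [cs s] := ip_sum a0 (index_enum 'I_M) cv cg.
have -> : u M 0 = (fun x => 1 - \sum_(m < M) gcoef m * E (lam m) x).
  by apply/funext => x; exact: remainder_0.
have c1 : continuous (fun _ : R => (1 : R)) by cts.
rewrite ipBr// s; congr (_ - _); apply: eq_bigr => m _.
by rewrite ipZr.
Qed.

(** For k = 0 this is the orthogonality of 1 minus its Fourier-Bessel partial sum to the functions
    of that sum; the symmetry of L carries it from k to k + 1. *)
Lemma ip_E_u M k m : (m < M)%N -> ip (E (lam m)) (u M k) = 0.
Proof.
move=> mM; elim: k => [|k IH].
  rewrite ip_u0; last exact: (@cE (lam m)).
  rewrite (bigD1 (Ordinal mM))//= big1 => [|l lm]; last first.
    by rewrite ip_E_neq ?mulr0//; apply: contraNN lm => /eqP ml; apply/eqP/val_inj.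
  rewrite ip_E_1 ip_E_E /gcoef addr0; field.
  by rewrite dE1_neq0 gt_eqF.
have := ip_E_resid a0 (lam m) (remainder_C2 M k.+1) (remainder_1 M k).
rewrite E_lam1 mul0r.
have -> : resid a (lam m) (u M k.+1) (d_remainder M k.+1) (dd_remainder M k.+1) =
   (fun x => lam m * u M k.+1 x - u M k x).
  by apply/funext => x; rewrite /resid remainder_L addrC.
have c1 := @cu M k; have c2 := @cu M k.+1; have c3 := @cE (lam m).
have c4 : continuous (fun x => lam m * u M k.+1 x) by cts.
rewrite (ipBr a0 c3 c4 c1) IH subr0 (ipZr a0 _ c3 c2) => /esym/eqP.
by rewrite mulf_eq0 (gt_eqF (lam_gt0 m)) => /eqP.
Qed.

(** The norm form of Bessel's inequality for the constant function 1, each eigenfunction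
    contributing 1 / lam_m. The resulting bound on the sum of 1 / lam_m gives the growth of lam_m
    and the convergence of all tails. *)
Lemma ip_u0_u0 M : ip (u M 0) (u M 0) = a^-1 - \sum_(m < M) (lam m)^-1.
Proof.
rewrite ip_u0; last exact: (@cu M 0).
rewrite [X in _ - X]big1 => [|m _]; last by rewrite (ipC a0) ip_E_u ?mulr0.
rewrite subr0 (ipC a0) ip_u0; last by cts.
congr (_ - _).
  by rewrite -(J1 a0); apply: eq_J => // x _; rewrite mulr1.
apply: eq_bigr => m _; rewrite (ipC a0) ip_E_1 /gcoef.
by field; rewrite dE1_neq0 gt_eqF.
Qed.

Lemma sum_inv_lam M : \sum_(m < M) (lam m)^-1 <= a^-1.
Proof. by rewrite -subr_ge0 -ip_u0_u0 ip_ge0. Qed.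

Lemma remainder_norm M k : ip (u M k) (u M k) <= a^-1 / lam M ^+ (k + k).
Proof.
pose b := moment a (fun k => u M k).
have gap : forall k, b k.+1 <= (lam M)^-1 * b k.
  apply: (moment_gap a0 (remainder_C2 M) (remainder_L M) (remainder_1 M)); first by rewrite invr_gt0.
  rewrite invrK => w w0 wM; have [C C0 HC] := E_stability a0 w0.
  exists C => // j; apply: HC; [exact: remainder_C2|exact: remainder_1|].
  (* A zero w below lam_M is some lam_m with m < M, and the remainder is orthogonal to its
     eigenfunction. Hence stability holds for every w < lam_M. *)
  rewrite /E mulr1 => /(lam_all w0)[m wm]; rewrite (ipC a0) wm ip_E_u//.
  rewrite ltnNge; apply/negP => Mm; move: wM; rewrite wm ltNge.
  by move: Mm; rewrite leq_eqVlt => /predU1P[->|/lam_incr/ltW->]; rewrite ?lexx.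
rewrite (ip_moment a0 (remainder_C2 M) (remainder_L M) (remainder_1 M)) -/b.
elim: (k + k)%N => [|n IH].
  rewrite expr0 divr1 /b /moment ip_u0_u0 gerBl sumr_ge0// => m _.
  by rewrite invr_ge0 ltW.
apply: le_trans (gap n) _; rewrite exprS invfM mulrCA ler_wpM2l//.
by rewrite invr_ge0 ltW.
Qed.

End FourierBessel.

(** * Polynomial bounds for Bessel functions on the positive axis *)

Section Energy.
Variable R : realType.
Implicit Types c x y : R.

Lemma derive_ge0_le (f df : R -> R) x y : x <= y ->
  (forall z : R, x <= z <= y -> is_derive z (1:R) f (df z)) ->
  (forall z, x <= z <= y -> 0 <= df z) -> f x <= f y.
Proof.
rewrite le_eqVlt => /predU1P[->//|xy] D df0.
have D' (z : R) : z \in `]x, y[ -> is_derive z (1:R) f (df z).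
  by rewrite in_itv/= => /andP[/ltW xz /ltW zy]; apply: D; rewrite xz.
have cf : {within `[x, y], continuous f}.
  apply: derivable_within_continuous => z; rewrite in_itv/= => /D H.
  exact: ex_derive.
have [z zxy E] := MVT xy D' cf.
rewrite -subr_ge0 E mulr_ge0//; last by rewrite subr_ge0 ltW.
by apply: df0; move: zxy; rewrite in_itv/= => /andP[/ltW -> /ltW ->].
Qed.

Definition dPhi c y := - c^-1 * Phi (c + 1) y.
(** A Lyapunov function of the Bessel equation: its derivative is a multiple of Phi'^2. At a zero of
    Phi it reduces to y Phi'^2, so a lower bound for it is an upper bound for [gcoef]. *)
Definition energy c y := Phi c y * Phi c y + y * dPhi c y * dPhi c y.

(** Bessel's equation y Phi'' = - c Phi' - Phi, where Phi'' is written with [dPhi (c + 1)]. *)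
Lemma Phi_ode c y : 0 < c -> y * dPhi (c + 1) y * - c^-1 = - c * dPhi c y - Phi c y.
Proof.
move=> c0; rewrite (Phi_contig y c0) /dPhi -addrA.
have -> : (1 : R) + 1 = 2 by lra.
by field; rewrite ?gt_eqF ?addr_gt0.
Qed.

Lemma is_derive_energy c y : 0 < c ->
  is_derive y (1:R) (energy c) ((1 - 2 * c) * dPhi c y * dPhi c y).
Proof.
move=> c0; have c1 : 0 < c + 1 by rewrite addr_gt0.
have D1 := is_derive_Phi y c0.
have D2 := is_deriveM (is_derive_cst (- c^-1) y (1:R)) (is_derive_Phi y c1).
have D := is_deriveD (is_deriveM D1 D1) (is_deriveM (is_deriveM (is_derive_id y (1:R)) D2) D2).
apply: (is_derive_eq D); rewrite /GRing.scale /= !fctE /=.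
rewrite -/(dPhi c y) -/(dPhi (c + 1) y).
have O := Phi_ode y c0.
have -> : dPhi c y * (y * (- c^-1 * dPhi (c + 1) y + Phi (c + 1) y * 0) + dPhi c y * 1) =
  dPhi c y * (y * dPhi (c + 1) y * - c^-1) + dPhi c y * dPhi c y by ring.
rewrite O.
have -> : y * dPhi c y * (- c^-1 * dPhi (c + 1) y + Phi (c + 1) y * 0) =
   dPhi c y * (y * dPhi (c + 1) y * - c^-1) by ring.
by rewrite O; ring.
Qed.

Lemma energy_ge0 c y : 0 <= y -> 0 <= energy c y.
Proof.
move=> y0; rewrite /energy addr_ge0//; first by rewrite -expr2 sqr_ge0.
by rewrite -mulrA mulr_ge0// -expr2 sqr_ge0.
Qed.

(** The quotient energy / y decreases: its derivative is - (Phi^2 + 2 c y Phi'^2) / y^2. *)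
Lemma energy_le c y : 0 < c -> 1 <= y -> energy c y <= energy c 1 * y.
Proof.
move=> c0 y1.
have y0 : 0 < y by lra.
pose f z := - (energy c z / z).
pose df z := - ((1 - 2 * c) * dPhi c z * dPhi c z / z - energy c z / z ^+ 2).
have := @derive_ge0_le f df 1 y y1.
rewrite /f invr1 mulr1 lerN2 ler_pdivrMr//; apply.
  move=> z /andP[z1 _]; have z0 : z != 0 by rewrite gt_eqF//; lra.
  have DV := is_deriveV z0 (is_derive_id z (1:R)).
  have H := is_deriveN (is_deriveM (is_derive_energy z c0) DV).
  by apply: (is_derive_eq H); rewrite /df /GRing.scale /=; field.
move=> z /andP[z1 _].
have z0 : 0 < z by lra.
have -> : df z = (Phi c z ^+ 2 + z * dPhi c z ^+ 2 * (2 * c)) / z ^+ 2.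
  by rewrite /df /energy; field; rewrite gt_eqF.
apply: divr_ge0; last exact: sqr_ge0.
apply: addr_ge0; first exact: sqr_ge0.
apply: mulr_ge0; last by rewrite mulr_ge0// ltW.
by apply: mulr_ge0; [exact: ltW|exact: sqr_ge0].
Qed.

Lemma Phi_sqr_le c : 0 < c -> exists2 C, 0 <= C &
  forall y, 0 <= y -> Phi c y ^+ 2 <= C * (1 + y).
Proof.
move=> c0; have [C C0 HC] := ps_tail (entire_phi c0) ler01.
have e0 := energy_ge0 c ler01.
exists (C ^+ 2 + energy c 1); first by rewrite addr_ge0 ?sqr_ge0.
move=> y y0; case: (leP y 1) => y1.
  have := HC 0%N y; rewrite big_ord0 subr0 expr0 mulr1 ger0_norm// => /(_ y1) H.
  apply: (@le_trans _ _ (C ^+ 2)).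
    by rewrite -real_normK ?num_real// lerXn2r ?nnegrE.
  have := sqr_ge0 C; have : 0 <= (C ^+ 2 + energy c 1) * y.
    by rewrite mulr_ge0// addr_ge0// sqr_ge0.
  lra.
apply: (@le_trans _ _ (energy c y)).
  by rewrite /energy expr2 lerDl -mulrA mulr_ge0// -expr2 sqr_ge0.
apply: le_trans (energy_le c0 (ltW y1)) _.
have := sqr_ge0 C; have : 0 <= C ^+ 2 * y by rewrite mulr_ge0 ?sqr_ge0.
by lra.
Qed.

(** The product y^q energy increases as soon as the integer q is at least |1 - 2 c|. *)
Lemma energy_lower c y0 : 0 < c -> 0 < y0 -> Phi c y0 != 0 ->
  exists2 p : nat, True & exists2 k, 0 < k & forall y, y0 <= y -> k <= y ^+ p * energy c y.
Proof.
move=> c0 y00 P0.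
have [p pc] : exists p : nat, `|1 - 2 * c| <= p.+1%:R.
  by exists (Num.trunc `|1 - 2 * c|); rewrite ltW// truncnS_gt.
exists p.+1 => //; exists (y0 ^+ p.+1 * energy c y0).
  rewrite mulr_gt0 ?exprn_gt0// /energy ltr_pwDl//.
    by rewrite -expr2 exprn_even_gt0.
  by rewrite -mulrA mulr_ge0 ?(ltW y00)// -expr2 sqr_ge0.
move=> y y0y.
pose f z := z ^+ p.+1 * energy c z.
pose df z := z ^+ p.+1 * ((1 - 2 * c) * dPhi c z * dPhi c z) + p.+1%:R * z ^+ p * energy c z.
have D (z : R) : is_derive z (1:R) f (df z).
  have H := is_deriveM (is_deriveX p.+1 (is_derive_id z (1:R))) (is_derive_energy z c0).
  have -> : f = id ^+ p.+1 * energy c by rewrite exprfctE.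
  by apply: (is_derive_eq H); rewrite /df /GRing.scale /= !exprfctE /=; ring.
apply: (@derive_ge0_le f df) => // z /andP[z0 _].
have zp : 0 < z by apply: lt_le_trans z0.
have -> : df z = z ^+ p * (z * (dPhi c z ^+ 2) * ((1 - 2 * c) + p.+1%:R) + p.+1%:R * Phi c z ^+ 2).
  by rewrite /df /energy exprS; ring.
have cp : 0 <= 1 - 2 * c + p.+1%:R.
  by have := ler_norm (- (1 - 2 * c)); rewrite normrN; lra.
apply: mulr_ge0; first by rewrite exprn_ge0// ltW.
apply: addr_ge0; apply: mulr_ge0 => //; rewrite ?sqr_ge0//.
by apply: mulr_ge0; [exact: ltW|exact: sqr_ge0].
Qed.

End Energy.

Lemma geo_eq0 (R : realType) (x K : R) : (forall n, `|x| <= K * 4^-1 ^+ n) -> x = 0.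
Proof.
move=> H; apply/eqP; rewrite -normr_le0.
have q1 : `|4^-1 : R| < 1 by rewrite ger0_norm; lra.
apply: (cvg_lbound (cvg_geometric K q1)); exists 0%N => n _; exact: H.
Qed.

(** * Change of order and uniform decay *)

Section Sonine.
Variable R : realType.
Variables a b : R.
Hypothesis a0 : 0 < a.
Hypothesis b1 : 1 < b.

(** The weight of the Beta integral; b > 1 makes it continuous at 1. *)
Definition sonine_weight (s : R) := rpow (b - 1) (1 - s).
Notation om := sonine_weight.

Lemma continuous_rpowB p : 0 < p -> continuous (fun s : R => rpow p (1 - s)).
Proof.
move=> p0; apply: (@cont_comp _ (rpow p) (fun s => 1 - s)); first exact: continuous_rpow.
by cts.
Qed.

Lemma cont_om : continuous om.
Proof. by apply: continuous_rpowB; rewrite subr_gt0. Qed.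

Definition sonine_moment i := J a (fun s => s ^+ i * om s).

Lemma contX i : continuous (fun s : R => s ^+ i).
Proof. by move=> s; exact: exprn_continuous. Qed.

(** The moments are the Beta values B(a + i, b). Their recursion comes from [J_ftc] for s^i (1 -
    s)^b, whose value at 1 is zero. *)
Lemma sonine_momentS i : (a + b + i%:R) * sonine_moment i.+1 = (a + i%:R) * sonine_moment i.
Proof.
pose y s := s ^+ i * rpow b (1 - s).
pose dy s := i%:R * s ^+ i.-1 * rpow b (1 - s) - b * (s ^+ i * om s).
have b0 : 0 < b by apply: lt_trans b1.
have cb := continuous_rpowB b0.
have co := cont_om.
have cX := @contX i; have cX1 := @contX i.-1; have cX2 := @contX i.+1.
have cy : continuous y by rewrite /y; cts.
have cdy : continuous dy by rewrite /dy; cts.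
have D (s : R) : 0 < s < 1 -> is_derive s (1:R) y (dy s).
  move=> /andP[s0 s1].
  have s1' : 0 < 1 - s by rewrite subr_gt0.
  have D0 := is_deriveB (is_derive_cst (1 : R) s (1:R)) (is_derive_id s (1:R)).
  have DR : is_derive ((cst 1 - id) s) (1:R) (rpow b) (b * (1 - s) `^ (b - 1)).
    exact: is_derive_rpow.
  have D1 := is_derive1_comp DR D0.
  have D2 := is_deriveM (is_deriveX i (is_derive_id s (1:R))) D1.
  have -> : y = id ^+ i * (rpow b \o (cst 1 - id)) by rewrite exprfctE.
  apply: (is_derive_eq D2); rewrite /dy /om /GRing.scale /= !exprfctE /=.
  rewrite (rpowE (b - 1)) ?(ltW s1')// (rpowE b) ?(ltW s1')//.
  by ring.
have y1 : y 1 = 0 by rewrite /y subrr rpow0 ?mulr0// gt_eqF.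
have := J_ftc a0 cy cdy D; rewrite y1 => H.
have E1 : (a + i%:R) * J a (fun s => s ^+ i * rpow b (1 - s)) = b * sonine_moment i.+1.
  apply/eqP; rewrite -subr_eq0 -H /sonine_moment -!JZ//; [|cts..].
  rewrite -JB//; [|cts..].
  apply/eqP/eq_J => // s _; rewrite /y /dy exprS.
  case: (i) => [|j] /=; first by ring.
  by rewrite !exprS; ring.
have E2 : J a (fun s => s ^+ i * rpow b (1 - s)) = sonine_moment i - sonine_moment i.+1.
  have c1 : continuous (fun s : R => s ^+ i * om s) by cts.
  have c2 : continuous (fun s : R => s ^+ i.+1 * om s) by cts.
  rewrite /sonine_moment -(@JB _ a a0 _ _ c1 c2).
  apply: (eq_J a0) => s /andP[s0 s1].
  have s1' : 0 <= 1 - s by rewrite subr_ge0.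
  have -> : om s = (1 - s) `^ (b - 1) by apply: rpowE.
  have -> : rpow b (1 - s) = (1 - s) * (1 - s) `^ (b - 1).
    by rewrite mulr_powRB1//; apply: rpowE.
  by rewrite exprS; ring.
move: E1; rewrite E2; lra.
Qed.

Lemma sonine_momentE i : sonine_moment i * pochhammer (a + b) i = pochhammer a i * sonine_moment 0.
Proof.
have b0 : 0 < b by apply: lt_trans b1.
elim: i => [|i IH]; first by rewrite !pochhammer0 mulr1 mul1r.
rewrite !pochhammerS.
transitivity ((a + b + i%:R) * sonine_moment i.+1 * pochhammer (a + b) i); first by ring.
rewrite sonine_momentS -mulrA IH; ring.
Qed.

Lemma sonine_moment0_gt0 : 0 < sonine_moment 0.
Proof.
have o0 s : 0 <= s ^+ 0 * om s by rewrite expr0 mul1r rpow_ge0.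
rewrite lt_def J_ge0 ?andbT//; apply/negP => /eqP m0.
have c0 := @contX 0; have co := cont_om.
have cc : continuous (fun s : R => s ^+ 0 * om s) by cts.
have := J_eq0 a0 cc (fun s _ => o0 s) m0 (x := 0).
by rewrite lexx ler01 expr0 mul1r /om subr0 rpow1 => /(_ isT)/eqP; rewrite oner_eq0.
Qed.

(** Term by term, the Beta moment of s^i turns [phi a i] into [phi (a + b) i] up to a constant
    independent of i. The arbitrary multiplier [d] makes the formula apply to the remainders and not
    only to Bessel functions. *)
Lemma sonine (d : nat -> R) x :
  entire (fun i => phi a i * d i) -> entire (fun i => phi (a + b) i * d i) ->
  J a (fun s => ps (fun i => phi a i * d i) (x * s) * om s) =
  sonine_moment 0 * ps (fun i => phi (a + b) i * d i) x.
Proof.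
move=> e1 e2; have co := cont_om.
have b0 : 0 < b by apply: lt_trans b1.
set c := fun i => phi a i * d i.
pose S n s := \sum_(i < n) c i * (x * s) ^+ i * om s.
have cS1 i : continuous (fun s => c i * (x * s) ^+ i * om s).
  have -> : (fun s => c i * (x * s) ^+ i * om s) = (fun s => (c i * x ^+ i) * (s ^+ i * om s)).
    by apply/funext => s; rewrite exprMn; ring.
  by have cX := @contX i; cts.
have SE n : continuous (S n) /\ J a (S n) = sonine_moment 0 * \sum_(i < n) phi (a + b) i * d i * x ^+ i.
  elim: n => [|n [cn IH]].
    have -> : S 0%N = (fun s => 0 * om s).
      by apply/funext => s; rewrite /S big_ord0 mul0r.
    by split; [cts|rewrite JZ// mul0r big_ord0 mulr0].
  have -> : S n.+1 = (fun s => S n s + c n * (x * s) ^+ n * om s).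
    by apply/funext => s; rewrite /S big_ord_recr.
  have c1 := cS1 n.
  split; first by apply: contD.
  rewrite JD// IH big_ord_recr/= mulrDr; congr (_ + _).
  have -> : J a (fun s => c n * (x * s) ^+ n * om s) = c n * x ^+ n * sonine_moment n.
    have cX := @contX n; rewrite /sonine_moment -JZ//; last by cts.
    by apply: eq_J => // s _; rewrite exprMn; ring.
  have pa := pochhammer_gt0 n a0; have pab := pochhammer_gt0 n (addr_gt0 a0 b0).
  have -> : sonine_moment n = pochhammer a n * sonine_moment 0 / pochhammer (a + b) n.
    by rewrite -sonine_momentE mulfK// gt_eqF.
  rewrite /c /phi; field.
  by rewrite !gt_eqF// ltr0n fact_gt0.
have cxs : continuous (fun s : R => x * s) by cts.
have cps := cont_comp (continuous_ps e1) cxs.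
have cF : continuous (fun s => ps c (x * s) * om s) by cts.
have [C C0 HC] := ps_tail e1 (normr_ge0 x).
have [D D0 HD] := ps_tail e2 (normr_ge0 x).
have om1 s : 0 <= s <= 1 -> `|om s| <= 1.
  by move=> /andP[s0 _]; rewrite ger0_norm ?rpow_ge0// rpow_le1 ?subr_gt0// gerBl.
apply/eqP; rewrite -subr_eq0; apply/eqP.
apply: (@geo_eq0 _ _ (C / a + sonine_moment 0 * D)) => n.
have [cSn JSn] := SE n.
rewrite -(subrKA (J a (S n))) mulrDl (le_trans (ler_normD _ _))// lerD//.
  rewrite -JB// mulrAC; apply: J_norm_le => //; first by cts.
  move=> s s01; rewrite /S -mulr_suml -mulrBl normrM -[leRHS]mulr1.
  apply: ler_pM => //; last exact: om1.
  apply: HC; case/andP: s01 => s0 s1.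
  by rewrite normrM ler_piMr// ger0_norm.
rewrite JSn -mulrBr normrM ger0_norm ?(ltW sonine_moment0_gt0)//.
by rewrite -mulrA ler_wpM2l ?(ltW sonine_moment0_gt0)// distrC HD.
Qed.

(** Up to normalization the left side of [sonine] is an average with a nonnegative weight, so
    raising the order does not increase the sup norm. *)
Lemma sonine_sup (d : nat -> R) e :
  entire (fun i => phi a i * d i) -> entire (fun i => phi (a + b) i * d i) ->
  (forall x, 0 <= x <= 1 -> `|ps (fun i => phi a i * d i) x| <= e) ->
  forall x, 0 <= x <= 1 -> `|ps (fun i => phi (a + b) i * d i) x| <= e.
Proof.
move=> e1 e2 H x /andP[x0 x1]; have m0 := sonine_moment0_gt0.
have co := cont_om.
have cxs : continuous (fun s : R => x * s) by cts.
have cps := cont_comp (continuous_ps e1) cxs.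
have Jom : sonine_moment 0 = J a om.
  by apply: eq_J => // s _; rewrite expr0 mul1r.
have xs s : 0 <= s <= 1 -> 0 <= x * s <= 1.
  by move=> /andP[s0 s1]; rewrite mulr_ge0//= mulr_ile1.
rewrite -(ler_pM2l m0) -{1}(gtr0_norm m0) -normrM -sonine// Jom mulrC -JZ//.
have cv : continuous (fun s => e * om s) by cts.
rewrite ler_norml (_ : - J a (fun s => e * om s) = J a (fun s => -1 * (e * om s))); last first.
  by rewrite (@JZ _ a a0 (-1) _ cv) mulN1r.
apply/andP; split; apply: le_J => //; [cts|cts| |cts|] => s s01.
  rewrite mulN1r -mulNr.
  rewrite ler_wpM2r ?rpow_ge0//; have := H _ (xs _ s01).
  by rewrite ler_norml => /andP[].
rewrite ler_wpM2r ?rpow_ge0//; have := H _ (xs _ s01).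
by rewrite ler_norml => /andP[].
Qed.

End Sonine.

Lemma bounded_tail (R : realType) (v : nat -> R) T : (forall m, 0 <= v m) ->
  (forall M, \sum_(m < M) v m <= T) -> forall e, 0 < e -> exists M0, forall M M', (M0 <= M)%N -> (M <= M')%N ->
  \sum_(M <= m < M') v m <= e.
Proof.
move=> v0 vT e e0.
pose s M := \sum_(m < M) v m.
have smono : {homo s : m n / (m <= n)%N >-> m <= n}.
  move=> m n /subnK <-; rewrite addnC /s big_split_ord /= lerDl sumr_ge0//.
have supS : has_sup (range s).
  by split; [exists (s 0%N), 0%N|exists T => _ [M _ <-]; exact: vT].
have [_ [M0 _ <-] sM0] := sup_adherent e0 supS.
exists M0 => M M' M0M MM'.
have -> : \sum_(M <= m < M') v m = s M' - s M.
  rewrite /s -!(big_mkord xpredT v) (@big_cat_nat _ _ _ M 0%N M')//=.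
  by rewrite [RHS]addrAC subrr add0r.
have H1 : s M' <= sup (range s) by apply: ub_le_sup; [case: supS|exists M'].
have := smono _ _ M0M; lra.
Qed.

Section UniformConvergence.
Variable R : realType.
Variable a : R.
Hypothesis a0 : 0 < a.
Variables (lam r : nat -> R).
Hypothesis lam_gt0 : forall m, 0 < lam m.
Hypothesis lam_incr : forall m n, (m < n)%N -> lam m < lam n.
Hypothesis lam_zero : forall m, Phi a (lam m) = 0.
Hypothesis lam_all : forall y, 0 < y -> Phi a y = 0 -> exists m, y = lam m.
Hypothesis rE : forall k, \sum_(i < k.+1) phi a i * r (k - i)%N = (k == 0)%:R.

Notation g := (gcoef a lam).
Notation U := (remainder a lam r).

Lemma lam_le m n : (m <= n)%N -> lam m <= lam n.
Proof. by rewrite leq_eqVlt => /predU1P[->//|/lam_incr/ltW]. Qed.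

Let sum_inv M : \sum_(m < M) (lam m)^-1 <= a^-1.
Proof. exact: (sum_inv_lam a0 lam_gt0 lam_incr lam_zero rE M). Qed.

(** Each of the first M terms of the sum of the inverses is at least 1 / lam_M, and the sum is at
    most 1 / a. *)
Lemma lam_ge M : a * M%:R <= lam M.
Proof.
have H : M%:R / lam M <= a^-1.
  apply: le_trans (sum_inv M).
  rewrite mulr_natl -[X in _ *+ X]card_ord -sumr_const.
  by apply: ler_sum => m _; rewrite lef_pV2 ?posrE// lam_le// ltnW.
by rewrite mulrC -ler_pdivlMr// mulrC -ler_pdivrMr// mulrC.
Qed.

Lemma lam_unbounded T : exists N, forall M, (N <= M)%N -> T <= lam M.
Proof.
exists (Num.trunc (T / a)).+1 => M NM; apply: le_trans (lam_ge M).
rewrite mulrC -ler_pdivrMr//; apply/ltW/(lt_le_trans (truncnS_gt _)).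
by rewrite ler_nat.
Qed.

Lemma dE_dPhi m : dE a (lam m) 1 = lam m * dPhi a (lam m).
Proof. by rewrite /dE mulr1. Qed.

(** [energy_lower] read at the zeros, starting from lam_0 / 2, which lies below the first zero. *)
Lemma g_bound : exists p, exists2 C, 0 <= C & forall m, g m ^+ 2 <= C * lam m ^+ p / lam m.
Proof.
have y0 : 0 < lam 0 / 2 by rewrite divr_gt0.
have yl : lam 0 / 2 < lam 0 by have := lam_gt0 0; lra.
have P0 : Phi a (lam 0 / 2) != 0.
  apply/negP => /eqP/(lam_all y0)[m ym]; move: yl; rewrite ym ltNge lam_le//.
have [p _ [k k0 H]] := energy_lower a0 y0 P0.
exists p, k^-1 => [|m]; first by rewrite invr_ge0 ltW.
have := H (lam m) (le_trans (ltW yl) (lam_le (leq0n m))).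
rewrite /energy lam_zero mul0r add0r /gcoef dE_dPhi sqrrN => {}H.
have l0 := lam_gt0 m.
have d0 : dPhi a (lam m) != 0.
  by apply/negP => /eqP E; move: H; rewrite E !mulr0 leNgt k0.
set d := dPhi a (lam m) in H d0 *.
have -> : (lam m * d)^-1 ^+ 2 = (lam m * d ^+ 2 * lam m)^-1.
  by field; rewrite d0 gt_eqF.
have d2 : 0 < d ^+ 2 by rewrite exprn_even_gt0.
rewrite ler_pdivlMr// ler_pdivlMl//.
have -> : k * ((lam m * d ^+ 2 * lam m)^-1 * lam m) = k / (lam m * d ^+ 2).
  by field; rewrite d0 gt_eqF.
rewrite ler_pdivrMr; last by apply: mulr_gt0.
have -> // : lam m * d ^+ 2 = lam m * d * d by rewrite expr2 mulrA.
Qed.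

(** The coefficient [g m] grows at most like a power of lam_m, and Phi^2 at most linearly. For k >=
    p + 2 the division by lam_m^k leaves a multiple of 1 / lam_m, whose sum converges. *)
Lemma term_bound kap : 0 < kap -> exists p, forall k, (p <= k)%N ->
  exists2 A, 0 <= A & forall m x, 0 <= x <= 1 ->
    `|g m / lam m ^+ k * Phi kap (lam m * x)| <= A / lam m.
Proof.
move=> kap0; have [p [C C0 HC]] := g_bound; have [B B0 HB] := Phi_sqr_le kap0.
exists p.+2 => k pk.
pose l := lam 0; have l0 : 0 < l by exact: lam_gt0.
pose A2 := C * B * (l^-1 + 1) / l ^+ (k + k - p.+2).
have li : 0 <= l^-1 + 1 by rewrite addr_ge0// invr_ge0 ltW.
have A20 : 0 <= A2 by rewrite /A2 divr_ge0 ?exprn_ge0 ?(ltW l0)// !mulr_ge0.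
exists (Num.sqrt A2) => [|m x /andP[x0 x1]]; first exact: sqrtr_ge0.
have lm := lam_gt0 m.
have ll : l <= lam m by exact: lam_le.
rewrite -(@ler_sqr _ _ (_ / _)) ?nnegrE ?divr_ge0 ?sqrtr_ge0 ?(ltW lm)//.
rewrite real_normK ?num_real// exprMn [X in _ <= X]exprMn sqr_sqrtr//.
have E1 : (g m / lam m ^+ k) ^+ 2 <= C * lam m ^+ p / lam m / lam m ^+ (k + k).
  rewrite exprMn exprVn -exprM muln2 -addnn.
  by rewrite ler_wpM2r ?invr_ge0 ?exprn_ge0 ?(ltW lm).
have E2 : Phi kap (lam m * x) ^+ 2 <= B * (l^-1 + 1) * lam m.
  apply: le_trans (HB _ _) _; first by rewrite mulr_ge0// ltW.
  rewrite -mulrA ler_wpM2l// mulrDl mul1r lerD//; last by rewrite ger_pMr.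
  by rewrite mulrC ler_pdivlMr// mul1r.
apply: le_trans (ler_pM _ _ E1 E2) _; rewrite ?sqr_ge0//.
have -> : C * lam m ^+ p / lam m / lam m ^+ (k + k) * (B * (l^-1 + 1) * lam m)
  = C * B * (l^-1 + 1) * (lam m ^+ p / lam m ^+ (k + k)).
  by field; rewrite ?expf_neq0 ?gt_eqF.
rewrite /A2 -[leRHS]mulrA ler_wpM2l ?mulr_ge0//.
have kk : (k + k = p + (k + k - p.+2) + 2)%N by clear -pk; lia.
set q := (k + k - p.+2)%N in kk *.
have -> : lam m ^+ (k + k) = lam m ^+ p * lam m ^+ q * lam m ^+ 2 by rewrite -!exprD -kk.
have -> : lam m ^+ p / (lam m ^+ p * lam m ^+ q * lam m ^+ 2) = lam m ^- q * (lam m)^-1 ^+ 2.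
  by field; rewrite !expf_neq0 ?gt_eqF.
rewrite ler_wpM2r ?exprn_ge0 ?invr_ge0 ?(ltW lm)//.
by rewrite lef_pV2 ?posrE ?exprn_gt0// lerXn2r ?nnegrE ?(ltW lm) ?(ltW l0).
Qed.

Lemma tail_cvg A : 0 <= A -> forall e, 0 < e -> exists M0, forall M M', (M0 <= M)%N -> (M <= M')%N ->
  \sum_(M <= m < M') A / lam m <= e.
Proof.
move=> A0; apply: (@bounded_tail _ (fun m => A / lam m) (A / a)) => [m|M].
  by rewrite divr_ge0 ?(ltW (lam_gt0 m)).
by rewrite -mulr_sumr ler_wpM2l.
Qed.

Lemma remainder_diff kap M M' k x : 0 < kap -> (M <= M')%N ->
  U kap M k x - U kap M' k x = \sum_(M <= m < M') g m / lam m ^+ k * Phi kap (lam m * x).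
Proof.
move=> k0 MM'.
have [_ ->] := remainder_expand a lam r M k x k0.
have [_ ->] := remainder_expand a lam r M' k x k0.
rewrite -!(big_mkord xpredT (fun m => g m / lam m ^+ k * Phi kap (lam m * x))).
by rewrite (@big_cat_nat _ _ _ M 0%N M')//=; ring.
Qed.

(** Once the tails are below e, the positive part of |U_M| - e is at most |U_M'| for every M' >= M.
    The norms of the U_M' tend to 0, so this continuous positive part has norm zero and vanishes
    everywhere. *)
Lemma remainder_sup_diag : exists p, forall k, (p <= k)%N -> forall e, 0 < e -> exists M0,
  forall M, (M0 <= M)%N -> forall x, 0 <= x <= 1 -> `|U a M k x| <= e.
Proof.
have [p Hp] := term_bound a0; exists p.+1 => k pk e e0.
have [A A0 HA] := Hp k (ltnW pk).
have [M0 HM0] := tail_cvg A0 e0; exists M0 => M M0M.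
have diff M' x : (M <= M')%N -> 0 <= x <= 1 -> `|U a M k x| - e <= `|U a M' k x|.
  move=> MM' x01; rewrite lerBlDr.
  have -> : U a M k x = U a M' k x + (U a M k x - U a M' k x) by rewrite addrC subrK.
  apply: le_trans (ler_normD _ _) _; rewrite lerD2l remainder_diff//.
  apply: le_trans (ler_norm_sum _ _ _) _.
  apply: le_trans (HM0 _ _ M0M MM'); apply: ler_sum => m _; exact: HA.
pose v x := Num.max 0 (`|U a M k x| - e).
pose h x := v x * v x.
have cU M' : continuous (U a M' k).
  have [] := C2_continuous (remainder_C2 a0 lam r M' k) => //.
have cv : continuous v.
  move=> x; apply: (@continuous_max _ _ (fun=> 0) (fun x => `|U a M k x| - e)).
    exact: cvg_cst.
  by apply: cvgB; [apply: cvg_norm; exact: cU|exact: cvg_cst].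
have ch : continuous h by rewrite /h; cts.
have h0 x : 0 <= x <= 1 -> 0 <= h x by rewrite /h -expr2 sqr_ge0.
have hle M' : (M <= M')%N -> J a h <= a^-1 / lam M' ^+ (k + k).
  move=> MM'; have H := remainder_norm a0 lam_gt0 lam_incr lam_zero lam_all rE M' k.
  apply: le_trans H; have c1 := cU M'; apply: le_J => //; first by cts.
  move=> x x01; rewrite /h -!expr2 -[leRHS]real_normK ?num_real//.
  rewrite ler_sqr ?nnegrE ?le_max ?lexx// /v ge_max normr_ge0 /=.
  exact: diff.
have J0 : J a h = 0.
  apply/eqP; rewrite eq_le J_ge0// andbT; apply/ler_addgt0Pl => d d0; rewrite addr0.
  have [N HN] := lam_unbounded (1 + (a * d)^-1).
  apply: le_trans (hle (maxn M N) (leq_maxl _ _)) _.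
  have := HN (maxn M N) (leq_maxr _ _); set l := lam _ => Hl.
  have ad : 0 < (a * d)^-1 by rewrite invr_gt0 mulr_gt0.
  have l1 : 1 <= l by lra.
  have l0 : 0 < l by lra.
  have ll : l <= l ^+ (k + k).
    by rewrite -{1}[l]expr1; apply: ler_weXn2l => //; clear -pk; lia.
  rewrite ler_pdivrMr ?exprn_gt0// mulrC -ler_pdivrMr//.
  by apply: le_trans ll; rewrite -invfM; lra.
move=> x x01; have := J_eq0 a0 ch h0 J0 x01.
move=> /eqP; rewrite /h mulf_eq0 orbb /v => /eqP E.
by rewrite -subr_le0 -E le_max lexx orbT.
Qed.

(** The contiguous relation on coefficients. In the term of order kap + 2 the shift of the series
    lowers k by one. *)
Lemma remainder_shift kap M k x : 0 < kap ->
  U kap M k.+1 x = U (kap + 1) M k.+1 x - x / (kap * (kap + 1)) * U (kap + 2) M k x.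
Proof.
move=> k0; have k1 : 0 < kap + 1 by rewrite addr_gt0.
have k2 : 0 < kap + 2 by rewrite addr_gt0.
have [e1 _] := remainder_expand a lam r M k.+1 x k1.
have [e2 _] := remainder_expand a lam r M k x k2.
rewrite /remainder (_ : (fun i => phi kap i * rho a lam r M k.+1 i) = (fun i =>
  phi (kap + 1) i * rho a lam r M k.+1 i +
  (- (kap * (kap + 1))^-1) * shiftX (fun i => phi (kap + 2) i * rho a lam r M k i) i)).
  rewrite psD//; last exact/entireZ/entire_shiftX.
  by rewrite psZ ?ps_shiftX//; [ring|exact: entire_shiftX].
apply/funext => i; rewrite {1}(phi_contig k0) mulrDl; congr (_ + _).
case: i => [|i] /=; first by rewrite !mulr0 mul0r.
by rewrite -mulrA; congr (_ * (_ * _)); exact: rho_SS.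
Qed.

(** Sonine's integral covers kap >= a + 2, where the difference of the orders exceeds 1. Smaller
    values are reached by descending with the contiguous relation, and each descent may raise the
    threshold p on k. *)
Lemma remainder_sup kap : 0 < kap -> exists p, forall k, (p <= k)%N -> forall e, 0 < e -> exists M0,
  forall M, (M0 <= M)%N -> forall x, 0 <= x <= 1 -> `|U kap M k x| <= e.
Proof.
have [p0 Hp0] := remainder_sup_diag.
have big kap' : a + 2 <= kap' -> forall k, (p0 <= k)%N -> forall e, 0 < e -> exists M0,
  forall M, (M0 <= M)%N -> forall x, 0 <= x <= 1 -> `|U kap' M k x| <= e.
  move=> ak k pk e e0; have [M0 HM0] := Hp0 k pk e e0; exists M0 => M M0M.
  have b1 : 1 < kap' - a by lra.
  have kE : kap' = a + (kap' - a) by lra.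
  have k0 : 0 < kap' by apply: lt_le_trans ak; rewrite addr_gt0.
  have [e1 _] := remainder_expand a lam r M k 0 a0.
  have [e2 _] := remainder_expand a lam r M k 0 k0.
  move=> x; rewrite /remainder kE; apply: sonine_sup => //; first by rewrite -kE.
  exact: HM0.
suff H n : forall kap', 0 < kap' -> a + 2 <= kap' + n%:R ->
  exists p, forall k, (p <= k)%N -> forall e, 0 < e -> exists M0,
  forall M, (M0 <= M)%N -> forall x, 0 <= x <= 1 -> `|U kap' M k x| <= e.
  move=> k0; apply: (H (Num.trunc (a + 2)).+1) => //.
  by apply: ltW; rewrite ltr_wpDl ?(ltW k0)// truncnS_gt.
elim: n => [|n IH] kap' k0 ak; first by exists p0; apply: big; rewrite addr0 in ak.
have [|| p1 H1] := IH (kap' + 1); first by rewrite addr_gt0.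
  by move: ak; rewrite -natr1; lra.
have [|| p2 H2] := IH (kap' + 2); first by rewrite addr_gt0.
  by move: ak; rewrite -natr1; lra.
exists (maxn p1 p2).+1 => -[//|k]; rewrite ltnS geq_max => /andP[pk1 pk2] e e0.
pose c := (kap' * (kap' + 1))^-1.
have c0 : 0 < c by rewrite invr_gt0 mulr_gt0// addr_gt0.
have [|M1 HM1] := H1 k.+1 (leqW pk1) (e / 2); first by rewrite divr_gt0.
have [|M2 HM2] := H2 k pk2 (e / 2 / c); first by rewrite !divr_gt0.
exists (maxn M1 M2) => M; rewrite geq_max => /andP[M1M M2M] x x01.
rewrite remainder_shift//; apply: le_trans (ler_normB _ _) _.
have -> : e = e / 2 + e / 2 by lra.
apply: lerD; first exact: HM1.
have := HM2 M M2M x x01; rewrite ler_pdivlMr// => H.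
rewrite !normrM -/c (gtr0_norm c0) -mulrA [c * _]mulrC.
have /andP[x0 x1] := x01.
by apply: le_trans H; rewrite ger0_norm// ler_piMl// mulr_ge0// ltW.
Qed.

End UniformConvergence.

(** * Complex values and partial fractions *)

Section ComplexNorm.
Variable R : realType.
Implicit Types (z w : CC R) (x y : R).

(** The norm of [CC R] has values in [CC R]; this one is real, so that estimates stay in the order
    of R. *)
Definition cnorm z : R := Normc.normc z.

Lemma cnormE z : `|z| = toCC (cnorm z).
Proof. by case: z. Qed.

Lemma cnorm_ge0 z : 0 <= cnorm z.
Proof. by case: z => x y; exact: sqrtr_ge0. Qed.

Lemma cnormM z w : cnorm (z * w) = cnorm z * cnorm w.
Proof. exact: Normc.normcM. Qed.

Lemma cnormD z w : cnorm (z + w) <= cnorm z + cnorm w.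
Proof. exact: le_normcD. Qed.

Lemma cnormN z : cnorm (- z) = cnorm z.
Proof. exact: normcN. Qed.

Lemma cnormB z w : cnorm (z - w) <= cnorm z + cnorm w.
Proof. by rewrite (le_trans (cnormD _ _))// cnormN. Qed.

Lemma cnorm0 : cnorm 0 = 0.
Proof. exact: Normc.normc0. Qed.

Lemma cnorm1 : cnorm 1 = 1.
Proof. exact: Normc.normc1. Qed.

Lemma cnorm_eq0 z : cnorm z = 0 -> z = 0.
Proof. exact: Normc.eq0_normc. Qed.

Lemma cnorm_gt0 z : z != 0 -> 0 < cnorm z.
Proof. by move=> z0; rewrite lt_def cnorm_ge0 andbT; apply: contraNN z0 => /eqP/cnorm_eq0 ->. Qed.

Lemma cnormX z n : cnorm (z ^+ n) = cnorm z ^+ n.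
Proof. by elim: n => [|n IH]; [exact: cnorm1|rewrite !exprS cnormM IH]. Qed.

Lemma cnormV z : cnorm z^-1 = (cnorm z)^-1.
Proof. exact: Normc.normcV. Qed.

Lemma cnorm_sum (I : Type) (s : seq I) (P : pred I) (F : I -> CC R) :
  cnorm (\sum_(i <- s | P i) F i) <= \sum_(i <- s | P i) cnorm (F i).
Proof.
elim/big_rec2: _ => [|i y1 y2 _ H]; first by rewrite cnorm0.
by apply: le_trans (cnormD _ _) _; rewrite lerD2l.
Qed.

Lemma toCCD x y : toCC (x + y) = toCC x + toCC y.
Proof. exact: (rmorphD (real_complex R)). Qed.

Lemma toCCN x : toCC (- x) = - toCC x.
Proof. exact: (rmorphN (real_complex R)). Qed.

Lemma toCCB x y : toCC (x - y) = toCC x - toCC y.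
Proof. exact: (rmorphB (real_complex R)). Qed.

Lemma toCCM x y : toCC (x * y) = toCC x * toCC y.
Proof. exact: (rmorphM (real_complex R)). Qed.

Lemma toCC0 : toCC (0 : R) = 0. Proof. by []. Qed.
Lemma toCC1 : toCC (1 : R) = 1. Proof. by []. Qed.

Lemma toCCX x n : toCC (x ^+ n) = toCC x ^+ n.
Proof. exact: (rmorphXn (real_complex R)). Qed.

Lemma toCCV x : toCC x^-1 = (toCC x)^-1.
Proof. exact: (fmorphV (real_complex R)). Qed.

Lemma toCC_nat n : toCC n%:R = n%:R :> CC R.
Proof. exact: (rmorph_nat (real_complex R)). Qed.

Lemma toCC_sum (I : Type) (s : seq I) (P : pred I) (F : I -> R) :
  toCC (\sum_(i <- s | P i) F i) = \sum_(i <- s | P i) toCC (F i).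
Proof. exact: (rmorph_sum (real_complex R)). Qed.

Lemma toCC_inj x y : toCC x = toCC y -> x = y.
Proof. exact: complexI. Qed.

Lemma toCC_eq0 x : (toCC x == 0) = (x == 0).
Proof. by apply/eqP/eqP => [/toCC_inj|->]. Qed.

Lemma cnorm_toCC x : cnorm (toCC x) = `|x|.
Proof. by rewrite /cnorm /= expr0n addr0 sqrtr_sqr. Qed.

Lemma Re_le_cnorm z : `|complex.Re z| <= cnorm z.
Proof.
case: z => x y /=; rewrite -(sqrtr_sqr x) ler_wsqrtr// lerDl sqr_ge0//.
Qed.

Lemma Im_le_cnorm z : `|complex.Im z| <= cnorm z.
Proof.
case: z => x y /=; rewrite -(sqrtr_sqr y) ler_wsqrtr// lerDr sqr_ge0//.
Qed.

Lemma cnorm_le_ReIm z : cnorm z <= `|complex.Re z| + `|complex.Im z|.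
Proof.
case: z => x y.
have -> : (Complex x y : CC R) = toCC x + (Complex 0 y : CC R).
  by apply/eqP; rewrite eq_complex /= addr0 add0r !eqxx.
apply: le_trans (cnormD _ _) _; rewrite cnorm_toCC /= addr0 add0r lerD2l.
by rewrite /cnorm /= expr0n add0r sqrtr_sqr.
Qed.

Lemma ReD z w : complex.Re (z + w) = complex.Re z + complex.Re w.
Proof. by case: z w => [? ?] [? ?]. Qed.
Lemma ImD z w : complex.Im (z + w) = complex.Im z + complex.Im w.
Proof. by case: z w => [? ?] [? ?]. Qed.
Lemma ReB z w : complex.Re (z - w) = complex.Re z - complex.Re w.
Proof. by case: z w => [? ?] [? ?]. Qed.
Lemma ImB z w : complex.Im (z - w) = complex.Im z - complex.Im w.
Proof. by case: z w => [? ?] [? ?]. Qed.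
Lemma Re_sum n (F : nat -> CC R) : complex.Re (\sum_(i < n) F i) = \sum_(i < n) complex.Re (F i).
Proof. by elim: n => [|n IH]; rewrite ?big_ord0// !big_ord_recr/= ReD IH. Qed.
Lemma Im_sum n (F : nat -> CC R) : complex.Im (\sum_(i < n) F i) = \sum_(i < n) complex.Im (F i).
Proof. by elim: n => [|n IH]; rewrite ?big_ord0// !big_ord_recr/= ImD IH. Qed.
Lemma Re_toCCM x z : complex.Re (toCC x * z) = x * complex.Re z.
Proof. by case: z => u v /=; rewrite mul0r subr0. Qed.
Lemma Im_toCCM x z : complex.Im (toCC x * z) = x * complex.Im z.
Proof. by case: z => u v /=; rewrite mul0r addr0. Qed.

End ComplexNorm.

Section FastSums.
Variable R : realType.
Implicit Types (a b : nat -> CC R) (l : CC R).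

(* Geometric convergence makes Cauchy products and uniqueness elementary. *)
Definition fsum a l := exists2 C : R, 0 <= C &
  forall n, cnorm (l - \sum_(i < n) a i) <= C * 2^-1 ^+ n.

Lemma half_eq0 (x K : R) : (forall n, `|x| <= K * 2^-1 ^+ n) -> x = 0.
Proof.
move=> H; apply/eqP; rewrite -normr_le0.
have q1 : `|2^-1 : R| < 1 by rewrite ger0_norm; lra.
apply: (cvg_lbound (cvg_geometric K q1)); exists 0%N => n _; exact: H.
Qed.

Lemma fsum_unique a l l' : fsum a l -> fsum a l' -> l = l'.
Proof.
move=> [C C0 H] [D D0 H']; apply/eqP; rewrite -subr_eq0; apply/eqP/cnorm_eq0.
apply: (@half_eq0 _ (C + D)) => n; rewrite ger0_norm ?cnorm_ge0//.
have -> : l - l' = (l - \sum_(i < n) a i) - (l' - \sum_(i < n) a i) by rewrite opprB addrA subrK.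
by rewrite (le_trans (cnormB _ _))// mulrDl lerD.
Qed.

Lemma fsumD a b l m : fsum a l -> fsum b m -> fsum (fun i => a i + b i) (l + m).
Proof.
move=> [C C0 H] [D D0 H']; exists (C + D) => [|n]; first by rewrite addr_ge0.
rewrite big_split/= opprD addrACA mulrDl.
by apply: le_trans (cnormD _ _) _; exact: lerD (H n) (H' n).
Qed.

Lemma fsumZ k a l : fsum a l -> fsum (fun i => k * a i) (k * l).
Proof.
move=> [C C0 H]; exists (cnorm k * C) => [|n]; first by rewrite mulr_ge0// cnorm_ge0.
by rewrite -mulr_sumr -mulrBr cnormM -mulrA ler_wpM2l// cnorm_ge0.
Qed.

Lemma fsum0 : fsum (fun=> 0) 0.
Proof. by exists 0 => // n; rewrite big1// subrr cnorm0 mul0r. Qed.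

Lemma fsum_sum n (a : nat -> nat -> CC R) (l : nat -> CC R) : (forall m, (m < n)%N -> fsum (a m) (l m)) ->
  fsum (fun i => \sum_(m < n) a m i) (\sum_(m < n) l m).
Proof.
elim: n => [|n IH] H.
  rewrite big_ord0 (_ : (fun i => _) = fun=> 0); first exact: fsum0.
  by apply/funext => i; rewrite big_ord0.
rewrite big_ord_recr/= (_ : (fun i => _) = fun i => \sum_(m < n) a m i + a n i).
  by apply: fsumD; [apply: IH => m mn; exact/H/leqW|exact: H].
by apply/funext => i; rewrite big_ord_recr.
Qed.

Lemma geo_fsum_err a C : 0 <= C -> (forall i, cnorm (a i) <= C * 4^-1 ^+ i) ->
  exists2 l, fsum a l & forall n, cnorm (l - \sum_(i < n) a i) <= 4 * C * 4^-1 ^+ n.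
Proof.
move=> C0 H.
have q0 : 0 <= (4^-1 : R) by lra.
have q1 : (4^-1 : R) <= 2^-1 by lra.
have HR i : `|complex.Re (a i)| <= C * 4^-1 ^+ i := le_trans (Re_le_cnorm _) (H i).
have HI i : `|complex.Im (a i)| <= C * 4^-1 ^+ i := le_trans (Im_le_cnorm _) (H i).
have := is_cvg_geo q0 q1 HR; rewrite seriesEord => cR.
have := is_cvg_geo q0 q1 HI; rewrite seriesEord => cI.
have tR := cvg_geo_tail q0 q1 C0 HR cR.
have tI := cvg_geo_tail q0 q1 C0 HI cI.
pose l : CC R := Complex (limn (fun n => \sum_(i < n) complex.Re (a i))) (limn (fun n => \sum_(i < n) complex.Im (a i))).
have E n : cnorm (l - \sum_(i < n) a i) <= 4 * C * 4^-1 ^+ n.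
  apply: le_trans (cnorm_le_ReIm _) _; rewrite ReB ImB Re_sum Im_sum.
  by have := tR n; have := tI n; rewrite /l /=; lra.
exists l => //; exists (4 * C) => [|n]; first by rewrite mulr_ge0.
apply: le_trans (E n) _; rewrite ler_wpM2l ?mulr_ge0//.
by rewrite lerXn2r ?nnegrE; lra.
Qed.

(** The partial sums of the product run over a triangle. The defect consists of n terms of size
    4^(-n), and n 4^(-n) <= 2^(-n). *)
Lemma fsum_conv a b C A B : 0 <= C -> (forall i, cnorm (a i) <= C * 4^-1 ^+ i) ->
  (forall i, cnorm (b i) <= C * 4^-1 ^+ i) -> fsum a A -> fsum b B ->
  fsum (fun n => \sum_(i < n.+1) a i * b (n - i)%N) (A * B).
Proof.
move=> C0 Ha Hb sA sB.
have [A' sA' EA] := geo_fsum_err C0 Ha; have [B' sB' EB] := geo_fsum_err C0 Hb.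
rewrite (fsum_unique sA sA') (fsum_unique sB sB') {A B sA sB sA' sB'}.
pose P m := \sum_(j < m) b j.
have tri n : \sum_(k < n) \sum_(i < k.+1) a i * b (k - i)%N = \sum_(i < n) a i * P (n - i)%N.
  elim: n => [|n IH]; first by rewrite !big_ord0.
  rewrite big_ord_recr IH [RHS]big_ord_recr/= subSn// subnn /P big_ord1.
  rewrite [X in _ + X]big_ord_recr/= subnn addrA -big_split/=; congr (_ + _).
  apply: eq_bigr => i _; rewrite subSn; last exact/ltnW/ltn_ord.
  by rewrite big_ord_recr/= mulrDr.
exists (4 * C * cnorm B' + 4 * C * C) => [|n].
  by rewrite addr_ge0 ?mulr_ge0 ?cnorm_ge0.
rewrite tri.
have -> : A' * B' - \sum_(i < n) a i * P (n - i)%N =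
   (A' - \sum_(i < n) a i) * B' + \sum_(i < n) a i * (B' - P (n - i)%N).
  have -> : \sum_(i < n) a i * (B' - P (n - i)%N) = (\sum_(i < n) a i) * B' - \sum_(i < n) a i * P (n - i)%N.
    by rewrite mulr_suml -sumrB; apply: eq_bigr => i _; rewrite mulrBr.
  by rewrite mulrBl addrA subrK.
apply: le_trans (cnormD _ _) _; rewrite [leRHS]mulrDl; apply: lerD.
  rewrite cnormM mulrAC ler_wpM2r ?cnorm_ge0//.
  apply: le_trans (EA n) _; rewrite ler_wpM2l ?mulr_ge0//.
  by rewrite lerXn2r ?nnegrE; lra.
apply: le_trans (cnorm_sum _ _ _) _.
apply: (@le_trans _ _ (\sum_(i < n) (4 * C * C) * 4^-1 ^+ n)).
  apply: ler_sum => i _; rewrite cnormM.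
  apply: le_trans (ler_pM (cnorm_ge0 _) (cnorm_ge0 _) (Ha i) (EB _)) _.
  rewrite mulrACA [C * _]mulrC -exprD subnKC//; exact/ltnW/ltn_ord.
rewrite sumr_const card_ord -[_ *+ n]mulr_natr -mulrA ler_wpM2l ?mulr_ge0//.
have -> : (4^-1 : R) = 2^-1 * 2^-1 by field.
rewrite exprMn -mulrA ler_piMr ?exprn_ge0//.
by rewrite exprVn ler_pdivrMl ?exprn_gt0// mulr1 -natrX ler_nat ltnW// ltn_expl.
Qed.

End FastSums.

Section ComplexPowerSeries.
Variable R : realType.
Implicit Types (c : nat -> R) (w : CC R) (x : R).

(** Real and imaginary parts are limits in R. The comparison with a limit in [CC R] is made once, in
    [fsum_lim], for the sake of [bessel_JJ]. *)
Definition cps c w : CC R := Complex (limn (fun n => \sum_(i < n) complex.Re (toCC (c i) * w ^+ i)))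
  (limn (fun n => \sum_(i < n) complex.Im (toCC (c i) * w ^+ i))).

Lemma entire_cbound c B : entire c -> 0 <= B -> exists2 C, 0 <= C &
  forall i w, cnorm w <= B -> cnorm (toCC (c i) * w ^+ i) <= C * 4^-1 ^+ i.
Proof.
move=> ec B0; have [C C0 H] := entire_bound ec B0.
have nw w : `|cnorm w| = cnorm w by rewrite ger0_norm ?cnorm_ge0.
exists C => // i w wB; have := H i (cnorm w).
by rewrite normrM normrX nw cnormM cnorm_toCC cnormX => ->.
Qed.

Lemma cps_fsum c w : entire c -> fsum (fun i => toCC (c i) * w ^+ i) (cps c w).
Proof.
move=> ec; have [C C0 H] := entire_cbound ec (cnorm_ge0 w).
pose a i := toCC (c i) * w ^+ i.
have {}H i : cnorm (a i) <= C * 4^-1 ^+ i by apply: H.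
have q0 : 0 <= (4^-1 : R) by lra.
have q1 : (4^-1 : R) <= 2^-1 by lra.
have HR i : `|complex.Re (a i)| <= C * 4^-1 ^+ i := le_trans (Re_le_cnorm _) (H i).
have HI i : `|complex.Im (a i)| <= C * 4^-1 ^+ i := le_trans (Im_le_cnorm _) (H i).
have := is_cvg_geo q0 q1 HR; rewrite seriesEord => cR.
have := is_cvg_geo q0 q1 HI; rewrite seriesEord => cI.
have tR := cvg_geo_tail q0 q1 C0 HR cR.
have tI := cvg_geo_tail q0 q1 C0 HI cI.
exists (4 * C) => [|n]; first by rewrite mulr_ge0.
apply: (@le_trans _ _ (4 * C * 4^-1 ^+ n)).
  apply: le_trans (cnorm_le_ReIm _) _.
  rewrite ReB ImB (Re_sum n a) (Im_sum n a).
  by have := tR n; have := tI n; rewrite /cps /a /=; lra.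
rewrite ler_wpM2l ?mulr_ge0//.
by rewrite lerXn2r ?nnegrE; lra.
Qed.

Lemma cps_toCC c x : entire c -> cps c (toCC x) = toCC (ps c x).
Proof.
move=> ec; apply: (fsum_unique (cps_fsum _ ec)).
have [C C0 H] := ps_tail ec (normr_ge0 x).
exists C => // n.
have -> : toCC (ps c x) - \sum_(i < n) toCC (c i) * toCC x ^+ i =
  toCC (ps c x - \sum_(i < n) c i * x ^+ i).
  rewrite toCCB toCC_sum; congr (_ - _); apply: eq_bigr => i _.
  by rewrite toCCM toCCX.
rewrite cnorm_toCC (le_trans (H n x (lexx _)))// ler_wpM2l//.
by rewrite lerXn2r ?nnegrE; lra.
Qed.

(* Since [c] vanishes at [l], dividing by [1 - w / l] keeps the series entire. *)
Lemma fsum_geo_conv c l w : entire c -> 0 < l -> ps c l = 0 -> w != toCC l ->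
  fsum (fun n => (\sum_(i < n.+1) toCC (c i) * (toCC l)^-1 ^+ (n - i)) * w ^+ n)
    (cps c w / (1 - w / toCC l)).
Proof.
move=> ec l0 pl wl.
have ln0 : toCC l != 0 by rewrite toCC_eq0 gt_eqF.
have d0 : 1 - w / toCC l != 0.
  rewrite subr_eq0; apply: contraNN wl => /eqP E.
  by rewrite -[w](divfK ln0) -E mul1r.
pose P n := \sum_(i < n) c i * l ^+ i.
(* Multiplication by 1 - w / l telescopes the sum and leaves (w / l)^N times a partial sum of the
   series at l, which tends to 0. *)
have key N : (1 - w / toCC l) * (\sum_(n < N) (\sum_(i < n.+1) toCC (c i) * (toCC l)^-1 ^+ (n - i)) * w ^+ n)
   = \sum_(n < N) toCC (c n) * w ^+ n - (w / toCC l) ^+ N * toCC (P N).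
  elim: N => [|N IH]; first by rewrite /P !big_ord0 toCC0 !mulr0 subr0.
  rewrite big_ord_recr/= mulrDr IH [in RHS]big_ord_recr/=.
  have -> : \sum_(i < N.+1) toCC (c i) * (toCC l)^-1 ^+ (N - i) = (toCC l)^-1 ^+ N * toCC (P N.+1).
    rewrite /P toCC_sum mulr_sumr; apply: eq_bigr => i _.
    have iN : (i <= N)%N by rewrite -ltnS.
    have -> : (toCC l)^-1 ^+ N = (toCC l)^-1 ^+ (N - i) / toCC l ^+ i by rewrite -exprVn -exprD subnK.
    by rewrite toCCM toCCX; field; rewrite ?expf_neq0.
  have -> : P N.+1 = P N + c N * l ^+ N by rewrite /P big_ord_recr.
  rewrite toCCD toCCM toCCX exprS exprMn exprVn; field.
  by rewrite ?expf_neq0 ?ln0.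
have [C C0 HC] := cps_fsum w ec.
pose B := cnorm w + l + 1.
have w0 := cnorm_ge0 w.
have B0 : 0 < B by rewrite /B; lra.
(* At this radius the partial sums at l are of size (l / (2 B))^N. The factor (w / l)^N turns this
   into (|w| / (2 B))^N, which is at most 2^(-N). *)
have [|D D0 HD] := ec (2 * B)^-1; first by rewrite invr_gt0 mulr_gt0.
have q0 : 0 <= l / (2 * B) by rewrite divr_ge0 ?mulr_ge0 ?(ltW l0) ?(ltW B0).
have q1 : l / (2 * B) <= 2^-1.
  rewrite ler_pdivrMr ?mulr_gt0// /B; lra.
have HPl i : `|c i * l ^+ i| <= D * (l / (2 * B)) ^+ i.
  rewrite normrM normrX (gtr0_norm l0) exprMn [l ^+ i * _]mulrC mulrA ler_wpM2r//.
  by rewrite exprn_ge0// ltW.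
have tP := cvg_geo_tail q0 q1 D0 HPl (@ps_cvg _ c l ec).
exists ((C + 2 * D) / cnorm (1 - w / toCC l)) => [|N].
  by rewrite divr_ge0 ?cnorm_ge0// addr_ge0 ?mulr_ge0.
have dn := cnorm_gt0 d0.
rewrite mulrAC ler_pdivlMr// mulrC -cnormM mulrBr key mulrCA mulfV// mulr1 opprB addrA addrAC.
rewrite [X in cnorm (X + _)]addrC.
rewrite [cnorm _](_ : _ = cnorm (cps c w - \sum_(n < N) toCC (c n) * w ^+ n + (w / toCC l) ^+ N * toCC (P N))); last first.
  by rewrite [- _ + _]addrC.
apply: le_trans (cnormD _ _) _; rewrite mulrDl lerD//.
have := tP N; rewrite pl sub0r normrN => tPN.
rewrite cnormM cnorm_toCC cnormX cnormM cnormV cnorm_toCC (gtr0_norm l0).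
apply: le_trans (ler_wpM2l _ tPN) _; first by rewrite exprn_ge0// divr_ge0// ltW.
rewrite mulrCA ler_wpM2l ?mulr_ge0// -exprMn lerXn2r ?nnegrE//.
  by rewrite mulr_ge0// divr_ge0// ltW.
have -> : cnorm w / l * (l / (2 * B)) = cnorm w / (2 * B) by field; rewrite !gt_eqF.
by rewrite ler_pdivrMr ?mulr_gt0// /B; lra.
Qed.

End ComplexPowerSeries.

(** * Partial fractions from residue sums *)

Section Meromorphic.
Variable R : realType.
Implicit Types (w : CC R).

Lemma fsum_fin (a : nat -> CC R) k :
  fsum (fun i => if (i < k)%N then a i else 0) (\sum_(i < k) a i) /\
  exists2 C, 0 <= C & forall i, cnorm (if (i < k)%N then a i else 0) <= C * 4^-1 ^+ i.
Proof.
have S0 : 0 <= \sum_(i < k) cnorm (a i) * 4 ^+ i.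
  by rewrite sumr_ge0// => i _; rewrite mulr_ge0 ?cnorm_ge0 ?exprn_ge0.
have H : forall i, cnorm (if (i < k)%N then a i else 0) <= (\sum_(i < k) cnorm (a i) * 4 ^+ i) * 4^-1 ^+ i.
  move=> i; case: ifP => [ik|_]; last by rewrite cnorm0 mulr_ge0// exprn_ge0.
  rewrite (bigD1 (Ordinal ik))//= mulrDl -mulrA -exprMn mulfV// expr1n mulr1 lerDl.
  rewrite mulr_ge0 ?exprn_ge0// sumr_ge0// => j _; by rewrite mulr_ge0 ?cnorm_ge0 ?exprn_ge0.
split; last by exists (\sum_(i < k) cnorm (a i) * 4 ^+ i).
have [l sl E] := geo_fsum_err S0 H.
suff -> : \sum_(i < k) a i = l by [].
have -> : \sum_(i < k) a i = \sum_(i < k) (if (i < k)%N then a i else 0).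
  by apply: eq_bigr => i _; rewrite ltn_ord.
case: sl => C C0 HC.
apply/esym/eqP; rewrite -subr_eq0; apply/eqP/cnorm_eq0.
apply: (@half_eq0 _ _ C) => n; rewrite ger0_norm ?cnorm_ge0//.
have := HC (k + n)%N; rewrite big_split_ord/= [X in _ - (_ + X)]big1 ?addr0 => [H1|i _]; last first.
  by rewrite ltnNge leq_addr.
apply: le_trans H1 _; rewrite exprD ler_wpM2l// ler_piMl ?exprn_ge0//.
by rewrite exprn_ile1//; lra.
Qed.

(** Removing the first M poles from the formal quotient c leaves a series whose coefficients of
    index k >= k0 are tails of residue sums. It therefore converges geometrically for |w| <= lam_M /
    4 and tends to 0 with M; multiplying back by p recovers F. *)
Lemma mittag_leffler (F p c lam D : nat -> R) T k0 : entire F -> entire p ->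
  (forall k, F k = \sum_(i < k.+1) p i * c (k - i)%N) ->
  (forall m, 0 < lam m) -> {homo lam : m n / (m <= n)%N >-> m <= n} ->
  (forall x, exists N, forall M, (N <= M)%N -> x <= lam M) ->
  (forall m, ps p (lam m) = 0) ->
  (forall k, (k0 <= k)%N -> forall e : R, 0 < e -> exists M0, forall M, (M0 <= M)%N ->
    `|c k - \sum_(m < M) D m / lam m ^+ k| <= e) ->
  (forall M, \sum_(m < M) `|D m| / lam m ^+ k0 <= T) ->
  forall w, (forall m, w != toCC (lam m)) ->
  forall e : R, 0 < e -> exists M0, forall M, (M0 <= M)%N ->
  cnorm (cps F w - cps p w * (\sum_(k < k0) toCC (c k) * w ^+ k +
     w ^+ k0 * \sum_(m < M) toCC (D m / lam m ^+ k0) / (1 - w / toCC (lam m)))) <= e.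
Proof.
move=> eF ep FE lam0 lam_le lam_inf plam cD DT w wlam e e0.
pose W := cnorm w; have W0 : 0 <= W by exact: cnorm_ge0.
pose Q := 4 * (cnorm (cps p w) * (W ^+ k0 * 4 ^+ k0)) + 1.
have Q0 : 0 < Q by rewrite /Q ltr_wpDl// !mulr_ge0 ?exprn_ge0 ?cnorm_ge0.
have v0 m : 0 <= `|D m| / lam m ^+ k0 by rewrite divr_ge0// exprn_ge0// ltW.
have eQ : 0 < e / Q by rewrite divr_gt0.
have [M1 HM1] := bounded_tail v0 DT eQ.
have [M2 HM2] := lam_inf (4 * W).
exists (maxn M1 M2) => M; rewrite geq_max => /andP[M1M M2M].
have lM := lam0 M; have WM := HM2 M M2M.
pose d k := c k - \sum_(m < M) D m / lam m ^+ k.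
(* Up to an arbitrarily small e', [d k] is the sum over M <= m < M'. The exponent beyond k0 yields
   the power of 1 / lam_M, and the absolute sum of order k0 the factor e / Q. *)
have dbound k : (k0 <= k)%N -> `|d k| <= e / Q * (lam M)^-1 ^+ (k - k0).
  move=> kk; apply/ler_addgt0Pl => e' e'0.
  have [M3 HM3] := cD k kk e' e'0.
  have := HM3 _ (leq_maxr M M3); set M' := maxn M M3 => H.
  have MM' : (M <= M')%N by exact: leq_maxl.
  have -> : d k = (c k - \sum_(m < M') D m / lam m ^+ k) + \sum_(M <= m < M') D m / lam m ^+ k.
    rewrite /d -!(big_mkord xpredT (fun m => D m / lam m ^+ k)).
    by rewrite (@big_cat_nat _ _ _ M 0%N M')//=; ring.
  apply: le_trans (ler_normD _ _) _; apply: lerD => //.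
  apply: le_trans (ler_norm_sum _ _ _) _.
  apply: le_trans (ler_wpM2r _ (HM1 M M' M1M MM')); last by rewrite exprn_ge0// invr_ge0 ltW.
  rewrite mulr_suml; apply: ler_sum_nat => m /andP[Mm _].
  have lm := lam0 m.
  rewrite normrM normfV [`|lam m ^+ k|]ger0_norm ?exprn_ge0 ?(ltW lm)//.
  rewrite -{1}(subnKC kk) exprD invfM mulrA ler_wpM2l//.
  by rewrite exprVn lef_pV2 ?posrE ?exprn_gt0// lerXn2r ?nnegrE ?(ltW lm) ?(ltW lM)// lam_le.
pose q k := toCC (d k) * w ^+ k.
pose q1 k := if (k < k0)%N then q k else 0.
pose q2 k := if (k < k0)%N then 0 else q k.
have [s1 [C1 C10 HC1]] := fsum_fin q k0.
pose C2 := e / Q * (W ^+ k0 * 4 ^+ k0).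
have C20 : 0 <= C2 by rewrite /C2 !mulr_ge0 ?invr_ge0 ?exprn_ge0 ?(ltW e0) ?(ltW Q0).
have HC2 k : cnorm (q2 k) <= C2 * 4^-1 ^+ k.
  rewrite /q2; case: ltnP => kk; first by rewrite cnorm0 mulr_ge0// exprn_ge0.
  rewrite /q cnormM cnorm_toCC cnormX -/W.
  apply: le_trans (ler_wpM2r _ (dbound k kk)) _; first by rewrite exprn_ge0.
  have kE := subnKC kk; set j := (k - k0)%N in kE *.
  rewrite /C2 -[leLHS]mulrA -[leRHS]mulrA; apply: ler_wpM2l; first exact: ltW.
  rewrite -kE !exprD mulrCA -[leRHS]mulrA; apply: ler_wpM2l; first exact: exprn_ge0.
  rewrite mulrA -!exprMn mulfV// expr1n mul1r.
  apply: lerXn2r; rewrite ?nnegrE ?mulr_ge0 ?invr_ge0 ?(ltW lM)//.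
  by rewrite ler_pdivrMl//; lra.
have [E2 s2 HE2] := geo_fsum_err C20 HC2.
have [C3 C30 HC3] := entire_cbound ep W0.
pose C := C1 + C2 + C3.
have CC0 : 0 <= C by rewrite /C !addr_ge0.
have sq : fsum q (\sum_(k < k0) q k + E2).
  have qE : (fun k => q1 k + q2 k) = q.
    by apply/funext => k; rewrite /q1 /q2; case: ifP; rewrite ?addr0 ?add0r.
  by rewrite -[X in fsum X _]qE; apply: fsumD.
have sF := cps_fsum w eF; have sp := cps_fsum w ep.
have sconv : fsum (fun n => \sum_(i < n.+1) (toCC (p i) * w ^+ i) * q (n - i)%N)
   (cps p w * (\sum_(k < k0) q k + E2)).
  apply: (@fsum_conv _ (fun i => toCC (p i) * w ^+ i) q C) => // i.
    apply: le_trans (HC3 i w (lexx _)) _; rewrite ler_wpM2r ?exprn_ge0//.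
    by rewrite /C lerDr addr_ge0.
  apply: (@le_trans _ _ (C1 * 4^-1 ^+ i + C2 * 4^-1 ^+ i)).
    have := HC1 i; have := HC2 i; rewrite /q2; case: ifP => _ H1 H2.
      by apply: ler_wpDr => //; rewrite mulr_ge0// exprn_ge0.
    by apply: ler_wpDl => //; rewrite mulr_ge0// exprn_ge0.
  by rewrite -mulrDl ler_wpM2r ?exprn_ge0// /C lerDl.
have sgeo := fsum_sum (fun m (_ : (m < M)%N) => fsumZ (toCC (D m))
   (fsum_geo_conv ep (lam0 m) (plam m) (wlam m))).
have := fsumD sconv sgeo.
rewrite (_ : (fun i => _ + _) = (fun i => toCC (F i) * w ^+ i)); last first.
  apply/funext => n; rewrite FE.
  under [X in _ + X]eq_bigr do rewrite mulrA mulr_sumr mulr_suml.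
  rewrite exchange_big/= -big_split/= toCC_sum mulr_suml; apply: eq_bigr => i _.
  have iN : (i <= n)%N by rewrite -ltnS.
  have -> : c (n - i)%N = d (n - i)%N + \sum_(m < M) D m / lam m ^+ (n - i) by rewrite /d subrK.
  rewrite toCCM toCCD mulrDr mulrDl /q; congr (_ + _).
    by have -> : w ^+ n = w ^+ i * w ^+ (n - i); [rewrite -exprD subnKC|ring].
  rewrite toCC_sum mulr_sumr mulr_suml; apply: eq_bigr => m _.
  by rewrite toCCM toCCV toCCX exprVn; ring.
move=> /(fsum_unique sF) ->.
(* The first k0 terms of each geometric series are split off; together with the first k0 terms of
   [d] they form the polynomial with coefficients [c k]. *)
have -> : \sum_(m < M) toCC (D m) * (cps p w / (1 - w / toCC (lam m))) =
   cps p w * (\sum_(m < M) \sum_(k < k0) toCC (D m) * (w / toCC (lam m)) ^+ k +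
     w ^+ k0 * \sum_(m < M) toCC (D m / lam m ^+ k0) / (1 - w / toCC (lam m))).
  rewrite [w ^+ k0 * _]mulr_sumr -big_split/= mulr_sumr; apply: eq_bigr => m _.
  rewrite -mulr_sumr.
  have ln0 : toCC (lam m) != 0 by rewrite toCC_eq0 gt_eqF.
  have wl : 1 - w / toCC (lam m) != 0.
    rewrite subr_eq0; apply: contraNN (wlam m) => /eqP E.
    by rewrite -[w](divfK ln0) -E mul1r.
  have G : (1 - w / toCC (lam m)) * (\sum_(k < k0) (w / toCC (lam m)) ^+ k) = 1 - (w / toCC (lam m)) ^+ k0.
    by rewrite -[1 - _]opprB mulNr -subrX1 opprB.
  have -> : \sum_(k < k0) (w / toCC (lam m)) ^+ k = (1 - (w / toCC (lam m)) ^+ k0) / (1 - w / toCC (lam m)).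
    by rewrite -G mulrAC mulfV// mul1r.
  move: (1 - w / toCC (lam m)) wl {G} => t t0.
  rewrite toCCM toCCV toCCX exprMn exprVn; field.
  by rewrite t0 expf_neq0.
have -> : \sum_(m < M) \sum_(k < k0) toCC (D m) * (w / toCC (lam m)) ^+ k =
   \sum_(k < k0) toCC (c k) * w ^+ k - \sum_(k < k0) q k.
  rewrite exchange_big/= -sumrB; apply: eq_bigr => k _.
  rewrite /q /d toCCB mulrBl opprB addrC subrK toCC_sum mulr_suml; apply: eq_bigr => m _.
  by rewrite exprMn exprVn toCCM toCCV toCCX; ring.
rewrite -mulrDr -mulrBr cnormM.
rewrite (_ : (_ + _) - _ = E2); last by ring.
have := HE2 0%N; rewrite big_ord0 subr0 expr0 mulr1 => H.
apply: le_trans (ler_wpM2l (cnorm_ge0 _) H) _.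
have -> : cnorm (cps p w) * (4 * C2) = e / Q * (Q - 1) by rewrite /C2 /Q; ring.
rewrite mulrAC ler_pdivrMr// ler_wpM2l ?(ltW e0)//; lra.
Qed.

End Meromorphic.

(** * Residue sums of all orders *)

Section Inverse.
Variable R : realType.
Variable p : nat -> R.
Hypothesis p0 : p 0%N = 1.

(** Course-of-values recursion in structural form: stage n is a function that holds the coefficients
    0, ..., n of the reciprocal series. *)
Fixpoint inv_upto n : nat -> R := if n is n'.+1 then
  fun k => if k == n then - \sum_(i < n) p i.+1 * inv_upto n' (n - i.+1)%N else inv_upto n' k
  else fun k => (k == 0%N)%:R.

Lemma inv_upto_stable n k : (k <= n)%N -> inv_upto n k = inv_upto k k.
Proof.
elim: n => [|n IH]; first by rewrite leqn0 => /eqP ->.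
by rewrite leq_eqVlt => /predU1P[->//|]; rewrite ltnS => kn /=; rewrite ltn_eqF ?ltnS// IH.
Qed.

Lemma series_inverse : exists r : nat -> R,
  forall k, \sum_(i < k.+1) p i * r (k - i)%N = (k == 0)%:R.
Proof.
exists (fun k => inv_upto k k) => -[|k]; first by rewrite big_ord1 p0 mul1r.
rewrite big_ord_recl subn0 p0 mul1r /= eqxx.
apply/eqP; rewrite addrC subr_eq0; apply/eqP; apply: eq_bigr => i _.
by rewrite /bump/= !add1n subSS (@inv_upto_stable k (k - i)%N)// leq_subr.
Qed.

(** Associativity of the Cauchy product: F = p (r F). *)
Lemma inverse_conv (r F : nat -> R) k : (forall k, \sum_(i < k.+1) p i * r (k - i)%N = (k == 0)%:R) ->
  F k = \sum_(i < k.+1) p i * \sum_(j < (k - i).+1) F j * r (k - i - j)%N.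
Proof.
move=> rE.
transitivity (\sum_(i < k.+1) \sum_(j < k.+1 | (j < (k - i).+1)%N) p i * (F j * r (k - i - j)%N)); last first.
  apply: eq_bigr => i _; rewrite mulr_sumr.
  by rewrite (big_ord_widen k.+1 (fun j => p i * (F j * r (k - i - j)%N)))// ltnS leq_subr.
rewrite (exchange_big_dep xpredT)//=.
transitivity (\sum_(j < k.+1) F j * (k - j == 0)%N%:R).
  rewrite big_ord_recr/= subnn eqxx mulr1 big1 ?add0r// => i _.
  by rewrite subn_eq0 leqNgt ltn_ord mulr0.
apply: eq_bigr => j _; rewrite -rE mulr_sumr.
rewrite (big_ord_widen k.+1 (fun i => F j * (p i * r (k - j - i)%N))) ?ltnS ?leq_subr//.
apply: eq_big => [i|i _]; last by rewrite mulrCA subnAC.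
have := ltn_ord i; have := ltn_ord j; rewrite !ltnS => jk ik.
by rewrite leq_subRL// [RHS]leq_subRL// addnC.
Qed.

End Inverse.

(** * Growth along the negative axis *)

Section Growth.
Variable R : realType.
Implicit Types (q F : nat -> R) (a b x y : R).

Lemma entire_le F q K : entire q -> 0 <= K -> (forall i, `|F i| <= K * `|q i|) -> entire F.
Proof.
move=> eq K0 H r r0; have [C C0 HC] := eq r r0; exists (K * C) => [|i]; first exact: mulr_ge0.
by apply: le_trans (H i) _; rewrite -mulrA ler_wpM2l.
Qed.

Lemma ps_norm_le F q x y : entire F -> entire q -> (forall i, `|F i * x ^+ i| <= q i * y ^+ i) ->
  `|ps F x| <= ps q y.
Proof.
move=> eF eq H.
have c1 : `|\sum_(i < n) F i * x ^+ i| @[n --> \oo] --> `|ps F x|.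
  by apply: cvg_norm; exact: ps_cvg.
have c2 := @ps_cvg _ q y eq.
apply: (ler_cvg_to c1 c2); apply: nearW => n.
by apply: le_trans (ler_norm_sum _ _ _) _; apply: ler_sum.
Qed.

Lemma Phi_neg a y : 0 < a -> entire (fun i => `|phi a i|) /\ Phi a (- y) = ps (fun i => `|phi a i|) y.
Proof.
move=> a0; have e : entire (fun i => `|phi a i|).
  apply: (@entire_le _ _ 1 (entire_phi a0)) => // i; by rewrite normr_id mul1r.
split => //; rewrite /Phi /ps; congr (limn _); apply/funext => n; rewrite /pseries /series/=.
apply: eq_bigr => i _; rewrite exprNn mulrA; congr (_ * _).
by rewrite norm_phi// /phi mulrAC -exprMn mulrNN mulr1 expr1n mul1r.
Qed.

Lemma Phi_neg_ge a y N : 0 < a -> 0 <= y -> `|phi a N| * y ^+ N <= Phi a (- y).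
Proof.
move=> a0 y0; have [e ->] := Phi_neg y a0.
apply: (cvg_lbound (@ps_cvg _ _ y e)); exists N.+1 => // n /= Nn.
rewrite (bigD1 (Ordinal Nn))//= lerDl sumr_ge0// => i _.
by rewrite mulr_ge0// exprn_ge0.
Qed.

Lemma phi_neq0 a i : 0 < a -> 0 < `|phi a i|.
Proof.
move=> a0; rewrite norm_phi// invr_gt0 mulr_gt0 ?pochhammer_gt0// ltr0n fact_gt0//.
Qed.

Lemma phi_norm_rec a i : 0 < a -> `|phi a i| = i.+1%:R * (a + i%:R) * `|phi a i.+1|.
Proof.
move=> a0; rewrite -normrN -phi_rec// !normrM [`|_ + _|]gtr0_norm ?normr_nat//.
by rewrite ltr_wpDr.
Qed.

Lemma harmonic_unbounded (T : R) : exists N, forall n, (N <= n)%N -> T <= \sum_(i < n) i.+1%:R^-1.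
Proof.
pose s n : R := \sum_(i < n) i.+1%:R^-1.
have smono : {homo s : m n / (m <= n)%N >-> m <= n}.
  move=> m n /subnK <-; rewrite addnC /s big_split_ord /= lerDl sumr_ge0//.
have [//|H] := pselect (exists N, forall n, (N <= n)%N -> T <= s n).
exfalso; apply: (@dvg_harmonic R); rewrite seriesEord.
apply: nondecreasing_is_cvgn => //; exists T => _ [n _ <-].
rewrite leNgt; apply/negP => /ltW Ts; apply: H; exists n => m nm.
exact: le_trans Ts (smono _ _ nm).
Qed.

(** The quotient v_i of [|phi a i|] by [|phi b i.+1|] satisfies v_(i+1) >= (1 + (b + 2 - a) / (a +
    i)) v_i. With b + 2 - a > 0 it diverges by comparison with the harmonic series. *)
Lemma phi_ratio a b e : 0 < a -> 0 < b -> a < b + 2 -> 0 < e ->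
  exists N, forall i, (N <= i)%N -> `|phi b i.+1| <= e * `|phi a i|.
Proof.
move=> a0 b0 ab e0.
pose v i := `|phi a i| / `|phi b i.+1|.
have v0 i : 0 < v i by rewrite divr_gt0// phi_neq0.
have vS i : v i + (b + 2 - a) / (a + i%:R) * v i <= v i.+1.
  have ai : 0 < a + i%:R by rewrite ltr_wpDr.
  have bi : 0 < b + i.+1%:R by rewrite ltr_wpDr.
  have i1 : 0 < i.+1%:R :> R by rewrite ltr0n.
  have i2 : 0 < i.+2%:R :> R by rewrite ltr0n.
  have -> : v i.+1 = v i + (b + 2 - a + b / i.+1%:R) / (a + i%:R) * v i.
    rewrite /v (phi_norm_rec i a0) (phi_norm_rec i.+1 b0).
    have p2 := phi_neq0 i.+2 b0; rewrite -(natr1 i.+1) -(natr1 i) in bi i1 i2 *.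
    by field; rewrite !gt_eqF.
  rewrite lerD2l ler_wpM2r ?(ltW (v0 i))// ler_wpM2r ?invr_ge0 ?(ltW ai)//.
  by rewrite lerDl divr_ge0 ?(ltW b0).
have d0 : 0 < b + 2 - a by lra.
have vmono i : v 0%N <= v i.
  elim: i => [//|i IH]; apply: le_trans IH (le_trans _ (vS i)).
  by rewrite lerDl mulr_ge0 ?(ltW (v0 i))// divr_ge0 ?(ltW d0)// addr_ge0 ?(ltW a0).
pose K := (b + 2 - a) / (a + 1) * v 0%N.
have K0 : 0 < K by rewrite mulr_gt0// divr_gt0// addr_gt0.
have vsum n : K * \sum_(i < n) i.+1%:R^-1 <= v n.
  elim: n => [|n IH]; first by rewrite big_ord0 mulr0 ltW.
  rewrite big_ord_recr/= mulrDr; apply: le_trans (vS n); apply: lerD => //.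
  have -> : K / n.+1%:R = (b + 2 - a) / ((a + 1) * n.+1%:R) * v 0%N by rewrite /K invfM; ring.
  have an : 0 < a + n%:R by rewrite ltr_wpDr.
  have an1 : 0 < (a + 1) * n.+1%:R by rewrite mulr_gt0 ?addr_gt0.
  apply: ler_pM; [by rewrite divr_ge0 ?(ltW d0) ?(ltW an1)|exact: ltW| |exact: vmono].
  rewrite ler_wpM2l ?(ltW d0)// lef_pV2 ?posrE// mulrDl mul1r -natr1 lerD ?lerDl//.
  by rewrite ler_peMr ?(ltW a0)// lerDr.
have [N HN] := harmonic_unbounded ((e * K)^-1).
exists N => i Ni; rewrite -ler_pdivrMl// mulrC -[leRHS]divr1.
have pb := phi_neq0 i.+1 b0.
have : e^-1 <= v i.
  apply: le_trans (vsum i); rewrite -ler_pdivrMl//.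
  by rewrite [_ / e]mulrC -invfM; exact: HN.
by rewrite /v ler_pdivlMr// divr1 mulrC.
Qed.

(** By [phi_ratio] the coefficients of index above N are below e / 2 times those of y Phi a (- y).
    The others form a polynomial of degree N, which for large y is below e / 2 times y times the
    N-th term of Phi a (- y). *)
Lemma growth a b F K : 0 < a -> 0 < b -> a < b + 2 -> 0 <= K -> (forall i, `|F i| <= K * `|phi b i|) ->
  forall e, 0 < e -> exists2 Y, 0 < Y & forall y, Y <= y -> `|ps F (- y)| <= e * y * Phi a (- y).
Proof.
move=> a0 b0 ab K0 HF e e0.
have eF := entire_le (entire_phi b0) K0 HF.
have e1 : 0 < e / 2 / (K + 1) by rewrite !divr_gt0// ltr_wpDl.
have [N HN] := phi_ratio a0 b0 ab e1.
pose q0 i := if (i <= N)%N then K * `|phi b i| else 0.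
pose C := \sum_(i < N.+1) K * `|phi b i|.
have C0 : 0 <= C by rewrite sumr_ge0// => i _; rewrite mulr_ge0.
have pN := phi_neq0 N a0.
pose Y := 1 + C / `|phi a N| / (e / 2).
exists Y => [|y yY]; first by rewrite /Y ltr_pwDl// !divr_ge0// ltW.
have y1 : 1 <= y by apply: le_trans yY; rewrite /Y lerDl !divr_ge0// ltW.
have y0 : 0 < y by apply: lt_le_trans y1.
have [ep pE] := Phi_neg y a0.
have eq0 : entire q0 by exact: entire_fin.
have es : entire (fun i => e / 2 * shiftX (fun i => `|phi a i|) i).
  by apply: entireZ; apply: entire_shiftX.
have eq := entireD eq0 es.
apply: le_trans (ps_norm_le (x := - y) (y := y) eF eq _) _ => [i|].
  rewrite normrM normrX normrN (gtr0_norm y0) ler_wpM2r ?exprn_ge0 ?(ltW y0)//.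
  apply: le_trans (HF i) _; rewrite /q0; case: leqP => iN.
    by rewrite lerDl mulr_ge0 ?(ltW (divr_gt0 e0 _))//; case: i {iN} => [|i] /=.
  case: i iN => [//|i]; rewrite ltnS add0r /= => iN.
  apply: (@le_trans _ _ ((K + 1) * `|phi b i.+1|)); first by rewrite ler_wpM2r// lerDl.
  have := HN i iN; rewrite mulrAC ler_pdivlMr ?ltr_wpDl// mulrC; exact.
rewrite psD// psZ//; last exact: entire_shiftX.
rewrite ps_shiftX// -pE (_ : e * y * _ = e / 2 * y * Phi a (- y) + e / 2 * (y * Phi a (- y))); last by field.
rewrite lerD2r ps_fin.
apply: (@le_trans _ _ (C * y ^+ N)).
  rewrite /C mulr_suml; apply: ler_sum => i _; rewrite ler_wpM2l ?mulr_ge0//.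
  by rewrite ler_weXn2l// -ltnS.
have H := Phi_neg_ge N a0 (ltW y0).
apply: (@le_trans _ _ (e / 2 * y * (`|phi a N| * y ^+ N))); last first.
  by rewrite ler_wpM2l ?mulr_ge0 ?(ltW y0) ?invr_ge0 ?(ltW e0).
rewrite mulrA ler_wpM2r ?exprn_ge0 ?(ltW y0)//.
rewrite -ler_pdivrMr// -ler_pdivrMl ?divr_gt0//.
by apply: le_trans yY; rewrite /Y mulrC; lra.
Qed.

End Growth.

(** * Descent in the exponent of the residue sums *)

Section LowerExponent.
Variable R : realType.
Variables (F p c lam D : nat -> R).
Hypothesis eF : entire F.
Hypothesis ep : entire p.
Hypothesis FE : forall k, F k = \sum_(i < k.+1) p i * c (k - i)%N.
Hypothesis lam_gt0 : forall m, 0 < lam m.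
Hypothesis lam_mono : {homo lam : m n / (m <= n)%N >-> m <= n}.
Hypothesis lam_inf : forall x, exists N, forall M, (N <= M)%N -> x <= lam M.
Hypothesis plam : forall m, ps p (lam m) = 0.
Hypothesis p_gt0 : forall y, 0 <= y -> 0 < ps p (- y).
Hypothesis Fsmall : forall e, 0 < e -> exists2 Y, 0 < Y &
  forall y, Y <= y -> `|ps F (- y)| <= e * y * ps p (- y).
Hypothesis D_ge0 : forall m, 0 <= D m.

Definition residue_sum k := forall e : R, 0 < e -> exists M0, forall M, (M0 <= M)%N ->
  `|c k - \sum_(m < M) D m / lam m ^+ k| <= e.

Let t k m := D m / lam m ^+ k.

Let t_ge0 k m : 0 <= t k m.
Proof. by rewrite divr_ge0// exprn_ge0// ltW. Qed.

Let sum_mono (v : nat -> R) M M' : (forall m, 0 <= v m) -> (M <= M')%N ->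
  \sum_(m < M) v m <= \sum_(m < M') v m.
Proof.
move=> v0 /subnK <-; rewrite addnC big_split_ord/= lerDl sumr_ge0//.
Qed.

Lemma residue_sum_le k M : residue_sum k -> \sum_(m < M) D m / lam m ^+ k <= c k.
Proof.
move=> H; apply/ler_addgt0Pl => e e0; have [M0 HM0] := H e e0.
have := HM0 _ (leq_maxl M0 M); have := sum_mono (t_ge0 k) (leq_maxr M0 M).
rewrite /t ler_norml; lra.
Qed.

(* At [w = - y] and divided by [y ^+ k0], the expansion leaves only
   [c k0 - y * S M y], and [y * S M y] tends to the residue sum of order [k0]. *)
Lemma residue_sum_lower k0 : (0 < k0)%N -> (forall k, (k0 < k)%N -> residue_sum k) -> residue_sum k0.
Proof.
move=> k00 H.
have DT M : \sum_(m < M) `|D m| / lam m ^+ k0.+1 <= c k0.+1.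
  under eq_bigr do rewrite ger0_norm//.
  by apply: residue_sum_le; apply: H.
pose S M y := \sum_(m < M) t k0 m / (lam m + y).
have S_mono y : 0 <= y -> forall M M', (M <= M')%N -> S M y <= S M' y.
  move=> y0 M M'; apply: (@sum_mono (fun m => t k0 m / (lam m + y))) => m.
  by rewrite divr_ge0// addr_ge0// ltW.
have A e : 0 < e -> exists2 Y, 0 < Y & forall y, Y <= y -> exists M0, forall M, (M0 <= M)%N ->
    `|c k0 - y * S M y| <= e.
  move=> e0; have e3 : 0 < e / 3 by rewrite divr_gt0.
  have [Y1 Y10 HY1] := Fsmall e3.
  pose Q := \sum_(k < k0) `|c k|.
  have Q0 : 0 <= Q by rewrite sumr_ge0.
  (* Beyond [Y], three quantities each cost at most e / 3 relative to y^k0: F / Phi, the error of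
     the expansion, and the polynomial of degree below k0. *)
  pose Y := Num.max Y1 (1 + Q / (e / 3)).
  exists Y => [|y]; first by rewrite lt_max Y10.
  rewrite ge_max => /andP[yY1 yQ].
  have y1 : 1 <= y by apply: le_trans yQ; rewrite lerDl divr_ge0// ltW.
  have y0 : 0 < y by apply: lt_le_trans y1.
  have p0 := p_gt0 (ltW y0).
  have yk : 0 < y ^+ k0 by rewrite exprn_gt0.
  have wl m : toCC (- y) != toCC (lam m).
    apply/negP => /eqP/toCC_inj E; have := lam_gt0 m; rewrite -E; lra.
  have e' : 0 < e / 3 * ps p (- y) * y ^+ k0 by rewrite !mulr_gt0.
  have [M0 HM0] := mittag_leffler eF ep FE lam_gt0 lam_mono lam_inf plam H DT wl e'.
  exists M0 => M /HM0.
  rewrite !cps_toCC//.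
  pose B := \sum_(k < k0) c k * (- y) ^+ k + (- y) ^+ k0 * (c k0 - y * S M y).
  rewrite (_ : _ - _ = toCC (ps F (- y) - ps p (- y) * B)); last first.
    rewrite toCCB toCCM; congr (_ - _ * _).
    rewrite /B toCCD big_ord_recr/= -addrA toCC_sum; congr (_ + _).
      by apply: eq_bigr => k _; rewrite toCCM toCCX.
    rewrite toCCM toCCX toCCB mulrBr [toCC (c k0) * _]mulrC; congr (_ + _).
    rewrite exprS -mulrA mulrCA -mulrN; congr (_ * _).
    rewrite toCCM toCCN mulNr; congr (- (_ * _)).
    rewrite /S toCC_sum; apply: eq_bigr => m _.
    have lm := lam_gt0 m.
    have ly : lam m + y != 0 by rewrite gt_eqF// addr_gt0.
    have -> : 1 - - toCC y / toCC (lam m) = toCC ((lam m + y) / lam m).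
      rewrite toCCM toCCD toCCV; field; by rewrite toCC_eq0 gt_eqF.
    rewrite -toCCV -toCCM /t; congr toCC; rewrite exprS; field.
    by rewrite ly expf_neq0 ?gt_eqF.
  rewrite cnorm_toCC => HB.
  have {}HB : `|ps p (- y) * B| <= (e / 3 + e / 3) * (ps p (- y) * y ^+ k0).
    have yy : y <= y ^+ k0 by rewrite -{1}[y]expr1 ler_weXn2l.
    have F1 : `|ps F (- y)| <= e / 3 * (ps p (- y) * y ^+ k0).
      apply: le_trans (HY1 y yY1) _; rewrite -[leLHS]mulrA; apply: ler_wpM2l; first exact: ltW.
      by rewrite mulrC; apply: ler_wpM2l => //; exact: ltW.
    rewrite (_ : ps p (- y) * B = ps F (- y) - (ps F (- y) - ps p (- y) * B)); last by ring.
    apply: le_trans (ler_normB _ _) _; rewrite mulrDl; apply: lerD => //.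
    by rewrite mulrA.
  have {}HB : `|B| <= (e / 3 + e / 3) * y ^+ k0.
    by move: HB; rewrite normrM (gtr0_norm p0) [leRHS]mulrCA ler_pM2l.
  have HQ : `|\sum_(k < k0) c k * (- y) ^+ k| <= e / 3 * y ^+ k0.
    apply: le_trans (ler_norm_sum _ _ _) _.
    apply: (@le_trans _ _ (Q * y ^+ k0.-1)).
      rewrite mulr_suml; apply: ler_sum => k _; rewrite normrM ler_wpM2l//.
      rewrite normrX normrN (gtr0_norm y0) ler_weXn2l// -ltnS prednK// ltn_ord//.
    rewrite -{2}(prednK k00) exprS mulrA ler_wpM2r ?exprn_ge0 ?(ltW y0)//.
    by rewrite mulrC -ler_pdivrMr//; lra.
  have : `|(- y) ^+ k0 * (c k0 - y * S M y)| <= e * y ^+ k0.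
    rewrite (_ : _ * _ = B - \sum_(k < k0) c k * (- y) ^+ k); last by rewrite /B; ring.
    apply: le_trans (ler_normB _ _) _.
    have -> : e * y ^+ k0 = (e / 3 + e / 3) * y ^+ k0 + e / 3 * y ^+ k0 by field.
    exact: lerD.
  by rewrite normrM normrX normrN (gtr0_norm y0) mulrC ler_pM2r.
(* Since y / (lam_m + y) < 1, [y * S M y] never exceeds the residue sum. Here the converse up to e
   is needed: y is taken large in terms of M, and then M is enlarged, which only increases [S]. *)
have Tle M : \sum_(m < M) t k0 m <= c k0.
  apply/ler_addgt0Pl => e e0; have e2 : 0 < e / 2 by rewrite divr_gt0.
  have [Y Y0 HY] := A _ e2.
  pose T' := \sum_(m < M) t k0 m * lam m.
  have T'0 : 0 <= T' by rewrite sumr_ge0// => m _; rewrite mulr_ge0// ltW.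
  pose y := Num.max Y (1 + T' / (e / 2)).
  have yY : Y <= y by rewrite le_max lexx.
  have y0 : 0 < y by apply: lt_le_trans yY.
  have [M0 HM0] := HY y yY.
  have := HM0 _ (leq_maxl M0 M); rewrite ler_norml => /andP[H1 _].
  have H2 : y * S M y <= y * S (maxn M0 M) y.
    by rewrite ler_wpM2l ?(ltW y0)// S_mono ?(ltW y0)// leq_maxr.
  suff : \sum_(m < M) t k0 m - y * S M y <= e / 2 by lra.
  rewrite /S mulr_sumr -sumrB; apply: (@le_trans _ _ (T' / y)).
    rewrite mulr_suml; apply: ler_sum => m _.
    have lm := lam_gt0 m.
    have -> : t k0 m - y * (t k0 m / (lam m + y)) = t k0 m * lam m / (lam m + y).
      by field; rewrite gt_eqF// addr_gt0.
    apply: ler_wpM2l; first by apply: mulr_ge0 => //; exact: ltW.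
    rewrite lef_pV2 ?posrE ?addr_gt0//.
    by rewrite lerDr ltW.
  rewrite ler_pdivrMr// mulrC -ler_pdivrMr//.
  by rewrite /y le_max; apply/orP; right; rewrite lerDr.
move=> e e0; have [Y Y0 HY] := A _ e0.
have [M0 HM0] := HY Y (lexx _); exists M0 => M M0M.
have := HM0 M M0M; have := Tle M; rewrite !ler_norml /t.
suff : Y * S M Y <= \sum_(m < M) t k0 m by rewrite /t; lra.
rewrite /S mulr_sumr; apply: ler_sum => m _; have lm := lam_gt0 m.
rewrite mulrCA ler_piMr// ler_pdivrMr ?addr_gt0// mul1r.
by rewrite lerDr ltW.
Qed.

(** Each application of [residue_sum_lower] gains one exponent. The descent stops at 1, because F /
    Phi is only known to be o(y). *)
Lemma residue_sum_all K : (forall k, (K <= k)%N -> residue_sum k) ->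
  forall k, (0 < k)%N -> residue_sum k.
Proof.
elim: K => [|K IH] H k k0; first exact: H.
case: (posnP K) => [K0|K0]; first by apply: H; rewrite K0.
apply: IH => // l; rewrite leq_eqVlt => /predU1P[<-|]; last exact: H.
by apply: residue_sum_lower.
Qed.

End LowerExponent.

(** * Zeros of the transform *)

Section Taylor.
Variable R : realType.
Implicit Types (c : nat -> R) (w z : CC R).

Lemma fsum_shift (u : nat -> CC R) l : fsum u l -> fsum (fun n => if n is n'.+1 then u n' else 0) l.
Proof.
move=> [C C0 H]; exists (2 * C) => [|[|n]]; first by rewrite mulr_ge0.
  by have := H 0%N; rewrite !big_ord0 !expr0 !mulr1 => /le_trans; apply; lra.
rewrite big_ord_recl add0r; apply: le_trans (H n) _.
by rewrite exprS mulrACA mulfV// mul1r.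
Qed.

(** From n to n + 1 the remainder is multiplied by z and gains n (z - w)^2 w^(n-1); the factor 2^n
    absorbs n. *)
Lemma expr_taylor w z B n : 1 <= B -> cnorm w <= B -> cnorm z <= B ->
  cnorm (z ^+ n - w ^+ n - (z - w) * (n%:R * w ^+ n.-1)) <= (2 * B) ^+ n * cnorm (z - w) ^+ 2.
Proof.
move=> B1 wB zB; have B0 : 0 <= B by lra.
have d0 := cnorm_ge0 (z - w).
elim: n => [|n IH].
  by rewrite !expr0 subrr mul0r mulr0 subrr cnorm0 mul1r sqr_ge0.
have -> : z ^+ n.+1 - w ^+ n.+1 - (z - w) * (n.+1%:R * w ^+ n) =
   z * (z ^+ n - w ^+ n - (z - w) * (n%:R * w ^+ n.-1)) + n%:R * ((z - w) ^+ 2 * w ^+ n.-1).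
  case: n {IH} => [|n]; first by rewrite expr0 !expr1; ring.
  by rewrite /= !exprS -natr1; ring.
apply: le_trans (cnormD _ _) _; rewrite cnormM.
have -> : cnorm (n%:R * ((z - w) ^+ 2 * w ^+ n.-1)) = n%:R * (cnorm (z - w) ^+ 2 * cnorm w ^+ n.-1).
  by rewrite !cnormM -toCC_nat cnorm_toCC normr_nat cnormX.
have -> : (2 * B) ^+ n.+1 * cnorm (z - w) ^+ 2 =
  B * ((2 * B) ^+ n * cnorm (z - w) ^+ 2) + 2 ^+ n * (cnorm (z - w) ^+ 2 * B ^+ n.+1).
  by rewrite !exprMn !exprS; ring.
apply: lerD; first by apply: ler_pM => //; exact: cnorm_ge0.
apply: ler_pM => //; first by rewrite mulr_ge0 ?sqr_ge0// exprn_ge0// cnorm_ge0.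
  by rewrite -natrX ler_nat ltnW// ltn_expl.
rewrite ler_wpM2l ?sqr_ge0//; apply: (@le_trans _ _ (B ^+ n.-1)).
  by rewrite lerXn2r ?nnegrE ?cnorm_ge0.
by rewrite ler_weXn2l//; case: n {IH} => [|n] //=; rewrite leqW.
Qed.

Lemma cps_taylor c B : entire c -> exists2 C, 0 <= C & forall w z, cnorm w <= B -> cnorm z <= B ->
  cnorm (cps c z - cps c w - (z - w) * cps (pseries_diffs c) w) <= C * cnorm (z - w) ^+ 2.
Proof.
move=> ec; pose B' := 2 * Num.max 1 B.
have B'0 : 0 <= B' by rewrite mulr_ge0// le_max ler01.
have [C C0 HC] := entire_bound ec B'0.
exists (4 * C) => [|w z wB zB]; first by rewrite mulr_ge0.
pose u i := toCC (c i) * (z ^+ i - w ^+ i - (z - w) * (i%:R * w ^+ i.-1)).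
have su : fsum u (cps c z - cps c w - (z - w) * cps (pseries_diffs c) w).
  have s1 := cps_fsum z ec; have s2 := fsumZ (-1) (cps_fsum w ec).
  have s3 := fsumZ (- (z - w)) (fsum_shift (cps_fsum w (entire_diffs ec))).
  have := fsumD (fsumD s1 s2) s3; rewrite mulN1r mulNr; congr fsum; apply/funext => i.
  rewrite /u; case: i => [|i]; first by rewrite !expr0; ring.
  by rewrite /= /pseries_diffs toCCM toCC_nat; ring.
have bu i : cnorm (u i) <= C * cnorm (z - w) ^+ 2 * 4^-1 ^+ i.
  rewrite /u cnormM cnorm_toCC.
  have M1 : 1 <= Num.max 1 B by rewrite le_max lexx.
  have MB x : x <= B -> x <= Num.max 1 B by move=> xB; rewrite le_max xB orbT.
  apply: le_trans (ler_wpM2l _ (expr_taylor i M1 (MB _ wB) (MB _ zB))) _ => //.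
  have := HC i B'; rewrite ger0_norm// lexx => /(_ isT) H.
  rewrite mulrA [leRHS]mulrAC ler_wpM2r ?sqr_ge0//; apply: le_trans H.
  by rewrite normrM [`|_ ^+ _|]ger0_norm ?exprn_ge0.
have [|l sl Hl] := geo_fsum_err _ bu; first by rewrite mulr_ge0 ?sqr_ge0.
rewrite (fsum_unique su sl); have := Hl 0%N.
by rewrite big_ord0 subr0 expr0 mulr1 mulrA.
Qed.

Lemma ps_taylor c B : entire c -> exists2 C, 0 <= C & forall x y, `|x| <= B -> `|y| <= B ->
  `|ps c y - ps c x - (y - x) * ps (pseries_diffs c) x| <= C * (y - x) ^+ 2.
Proof.
move=> ec; have [C C0 H] := cps_taylor B ec; exists C => // x y xB yB.
have := H (toCC x) (toCC y); rewrite !cnorm_toCC => /(_ xB yB).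
rewrite !cps_toCC//; last exact: entire_diffs.
by rewrite -!toCCB -toCCM -toCCB !cnorm_toCC real_normK ?num_real.
Qed.

Lemma sign_near c (x e : R) : entire c -> ps c x = 0 -> ps (pseries_diffs c) x != 0 -> 0 < e -> exists h,
  [/\ 0 < h, h < e, 0 < ps (pseries_diffs c) x * ps c (x + h) & ps (pseries_diffs c) x * ps c (x - h) < 0].
Proof.
move=> ec cx d0 e0; set d := ps (pseries_diffs c) x in d0 *.
have [C C0 HC] := ps_taylor (`|x| + 1) ec.
have dn : 0 < `|d| by rewrite normr_gt0.
(* Small enough for the quadratic error C h^2 to stay below the linear term |d| h. *)
pose h := Num.min (e / 2) (Num.min 1 (`|d| / (2 * (C + 1)))).
have e2 : 0 < e / 2 by rewrite divr_gt0.
have C10 : 0 < 2 * (C + 1) by rewrite mulr_gt0// ltr_wpDl.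
have h0 : 0 < h by rewrite !lt_min e2 ltr01 divr_gt0.
have h1 : h <= 1 by rewrite !ge_min lexx /= orbT.
have he : h < e.
  by apply: (@le_lt_trans _ _ (e / 2)); [rewrite ge_min lexx|lra].
have hC : C * h < `|d|.
  have : h <= `|d| / (2 * (C + 1)) by rewrite !ge_min lexx !orbT.
  rewrite ler_pdivlMr// => H; apply: lt_le_trans H; rewrite mulrC ltr_pM2l//; lra.
have dd : d * d = `|d| * `|d| by rewrite -!expr2 real_normK ?num_real.
have P y : `|y - x| = h -> `|d * ps c y - (y - x) * (d * d)| < h * (d * d).
  move=> yx; have yB : `|y| <= `|x| + 1.
    by rewrite -[y](subrK x) addrC (le_trans (ler_normD _ _))// lerD2l yx.
  have xB : `|x| <= `|x| + 1 by rewrite lerDl.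
  have := HC x y xB yB; rewrite cx subr0 -/d => H.
  rewrite (_ : d * ps c y - _ = d * (ps c y - (y - x) * d)); last by ring.
  rewrite normrM; apply: le_lt_trans (ler_wpM2l _ H) _ => //.
  rewrite dd -(@real_normK _ (y - x)) ?num_real// yx.
  have -> : `|d| * (C * h ^+ 2) = h * `|d| * (C * h) by ring.
  by rewrite [ltRHS]mulrA ltr_pM2l// mulr_gt0.
exists h; split => //.
  have := P (x + h); rewrite [x + h]addrC addrK gtr0_norm// => /(_ erefl).
  by rewrite ltr_norml => /andP[]; lra.
have := P (x - h); rewrite addrAC subrr add0r normrN gtr0_norm// => /(_ erefl).
by rewrite ltr_norml => /andP[]; lra.
Qed.

End Taylor.

Lemma min_max_le0 (R : realType) (u v : R) : u * v <= 0 -> Num.min u v <= 0 <= Num.max u v.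
Proof.
rewrite ge_min le_max; case: (ltrgt0P u) => pu; case: (ltrgt0P v) => pv //=.
  by rewrite leNgt mulr_gt0.
by rewrite leNgt nmulr_rgt0// pv.
Qed.

Lemma phi_sign (R : realType) (a : R) i : 0 < a -> phi a i * (-1) ^+ i = `|phi a i|.
Proof. by move=> a0; rewrite norm_phi// /phi mulrAC -exprMn mulrNN mulr1 expr1n mul1r. Qed.

(** * The expansion of the transform and the position of its zeros *)

Section Interlacing.
Variable R : realType.
Variable a : R.
Hypothesis a0 : 0 < a.
Variables (lam r : nat -> R).
Hypothesis lam_gt0 : forall m, 0 < lam m.
Hypothesis lam_incr : forall m n, (m < n)%N -> lam m < lam n.
Hypothesis lam_zero : forall m, Phi a (lam m) = 0.
Hypothesis lam_all : forall y, 0 < y -> Phi a y = 0 -> exists m, y = lam m.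
Hypothesis rE : forall k, \sum_(i < k.+1) phi a i * r (k - i)%N = (k == 0)%:R.

Notation g := (gcoef a lam).

Let lam_mono : {homo lam : m n / (m <= n)%N >-> m <= n}.
Proof. by move=> m n; exact: lam_le. Qed.

Let lam_inf : forall x, exists N, forall M, (N <= M)%N -> x <= lam M.
Proof. exact: (lam_unbounded a0 lam_gt0 lam_incr lam_zero rE). Qed.

(** [lam_all] only knows positive real zeros. The other complex ones are excluded by the expansion
    of 1 / Phi, that is [mittag_leffler] with F = 1: at a zero of Phi it would bound 1 by 1/2. *)
Lemma Phi_complex_neq0 (w : CC R) : (forall m, w != toCC (lam m)) -> cps (phi a) w != 0.
Proof.
move=> wl; apply/negP => /eqP P0.
have [p1 Hp1] := remainder_sup a0 lam_gt0 lam_incr lam_zero lam_all rE a0.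
have [p2 Hp2] := term_bound a0 lam_gt0 lam_incr lam_zero lam_all a0.
pose k0 := maxn p1 p2.
have [A A0 HA] := Hp2 k0 (leq_maxr _ _).
have e1 : entire (fun k => (k == 0)%:R : R).
  have := @entire_fin R (fun=> 1) 0; congr entire; apply/funext => -[|i]//.
have DT M : \sum_(m < M) `|g m| / lam m ^+ k0 <= A / a.
  apply: (@le_trans _ _ (\sum_(m < M) A / lam m)).
    apply: ler_sum => m _; have := HA m 0; rewrite mulr0 (Phi0 a0) mulr1 lexx ler01.
    by rewrite normrM normfV [`|_ ^+ _|]ger0_norm ?exprn_ge0 ?(ltW (lam_gt0 m))//; apply.
  by rewrite -mulr_sumr ler_wpM2l//; exact: (sum_inv_lam a0 lam_gt0 lam_incr lam_zero rE).
have cD k : (k0 <= k)%N -> forall e : R, 0 < e -> exists M0, forall M, (M0 <= M)%N ->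
    `|r k - \sum_(m < M) g m / lam m ^+ k| <= e.
  move=> kk e e0; have [|M0 HM0] := Hp1 k _ e e0; first by apply: leq_trans kk; exact: leq_maxl.
  exists M0 => M /HM0 /(_ 0); rewrite lexx ler01 => /(_ isT).
  have [_ ->] := remainder_expand a lam r M k 0 a0.
  rewrite big_ord_recl subn0 expr0 mulr1 phi0 mul1r big1 ?addr0 => [|i _]; last first.
    by rewrite /= exprS mul0r mulr0.
  by under eq_bigr do rewrite mulr0 (Phi0 a0) mulr1.
have h : 0 < 2^-1 :> R by rewrite invr_gt0.
have [M0 HM0] := mittag_leffler e1 (entire_phi a0) (fun k => esym (rE k))
  lam_gt0 lam_mono lam_inf lam_zero cD DT wl h.
have := HM0 M0 (leqnn _); rewrite P0 mul0r subr0.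
have -> : cps (fun k => (k == 0)%:R : R) w = 1.
  have [s _] := fsum_fin (fun=> 1 : CC R) 1; move: s; rewrite big_ord1 => s.
  apply/esym; apply: (fsum_unique s); have := cps_fsum w e1; congr fsum.
  apply/funext => -[|i] /=; first by rewrite expr0 mulr1.
  by rewrite toCC0 mul0r.
rewrite cnorm1; lra.
Qed.

Variable b : R.
Hypothesis b0 : 0 < b.
Hypothesis ab : a < b + 2.
Variable mom : nat -> R.
Hypothesis mom_ge0 : forall i, 0 <= mom i.
Hypothesis mom_bound : forall q e, entire q -> (forall x, 0 <= x <= 1 -> `|ps q x| <= e) ->
  `|ps (fun i => q i * mom i) 1| <= e * mom 0%N.

(** Integrating [Phi b] at w t^2 against a weight multiplies its i-th coefficient by the moment of
    t^(2 i). Only [mom_ge0] and [mom_bound] are assumed about these moments. *)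
Definition transform i := phi b i * mom i.
Notation F := transform.

Lemma mom_le i : mom i <= mom 0%N.
Proof.
pose q n : R := if (n <= i)%N then (n == i)%:R else 0.
have eq : entire q by exact: entire_fin.
have qE x : ps q x = x ^+ i.
  rewrite ps_fin big_ord_recr/= eqxx mul1r big1 ?add0r// => n _.
  by rewrite ltn_eqF ?mul0r.
have := @mom_bound q 1 eq; rewrite mul1r => H; have {H} : `|ps (fun n => q n * mom n) 1| <= mom 0%N.
  apply: H => x /andP[x0 x1]; rewrite qE normrX ger0_norm// exprn_ile1//.
have -> : (fun n => q n * mom n) = (fun n => if (n <= i)%N then (n == i)%:R * mom n else 0).
  by apply/funext => n; rewrite /q; case: ifP; rewrite ?mul0r.
rewrite ps_fin big_ord_recr/= eqxx mul1r expr1n mulr1 big1 ?add0r ?ger0_norm// => n _.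
by rewrite ltn_eqF ?mul0r.
Qed.

Lemma transform_le i : `|F i| <= mom 0%N * `|phi b i|.
Proof. by rewrite normrM mulrC (ger0_norm (mom_ge0 i)) ler_wpM2r// mom_le. Qed.

Lemma entire_transform : entire F.
Proof. by apply: entire_le (entire_phi b0) (mom_ge0 0) transform_le. Qed.

Let eF := entire_transform.

Definition quot k := \sum_(i < k.+1) F i * r (k - i)%N.

(** By the formula for [gcoef] this is - F(lam_m) / (lam_m Phi'(lam_m)). *)
Definition res m := g m * ps F (lam m).

Lemma quotE k : F k = \sum_(i < k.+1) phi a i * quot (k - i)%N.
Proof. by rewrite (inverse_conv F k rE). Qed.

Lemma quot0 : quot 0 = mom 0%N.
Proof. by rewrite /quot big_ord1 (r0 rE) /F phi0 mul1r mulr1. Qed.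

(** The moment functional maps the remainder of order [b] to [quot k] minus the partial residue sum,
    and it is bounded by the sup norm on [0, 1]. *)
Lemma residue_sum_large : exists K, forall k, (K <= k)%N -> residue_sum quot lam res k.
Proof.
have [p Hp] := remainder_sup a0 lam_gt0 lam_incr lam_zero lam_all rE b0.
exists p => k pk e e0.
have m0 := mom_ge0 0.
have m1 : 0 < mom 0%N + 1 by rewrite ltr_wpDl.
have [|M0 HM0] := Hp k pk (e / (mom 0%N + 1)); first by rewrite divr_gt0.
exists M0 => M /HM0 HM.
have [eU _] := remainder_expand a lam r M k 0 b0.
have {}HM := mom_bound eU HM.
apply: le_trans (le_trans HM _); last first.
  by rewrite mulrAC ler_pdivrMr// ler_wpM2l ?(ltW e0)// lerDl.
rewrite le_eqVlt; apply/orP; left; apply/eqP; congr (`|_|).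
have e1 := @entire_fin _ (fun i => F i * r (k - i)%N) k.
have e2 m : entire (fun i => g m / lam m ^+ k * (F i * lam m ^+ i)).
  by apply: entireZ; apply: entire_geo.
have [e3 s3] := ps_sum (index_enum 'I_M) 1 (fun m : 'I_M => e2 m).
have -> : (fun i => phi b i * rho a lam r M k i * mom i) = (fun i =>
   (if (i <= k)%N then F i * r (k - i)%N else 0) +
   -1 * \sum_(m < M) g m / lam m ^+ k * (F i * lam m ^+ i)).
  apply/funext => i; rewrite /rho mulrAC -/(F i) mulrBr mulN1r; congr (_ - _).
    by case: ifP; rewrite ?mulr0.
  by rewrite mulr_sumr; apply: eq_bigr => m _; ring.
rewrite psD//; last by apply: entireZ.
rewrite psZ// s3 ps_fin mulN1r; congr (_ - _).
  by apply: eq_bigr => i _; rewrite expr1n mulr1.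
apply: eq_bigr => m _; rewrite psZ ?ps_geo ?mulr1//; last exact: entire_geo.
by rewrite /res mulrAC.
Qed.

Variable s : R.
Hypothesis s2 : s ^+ 2 = 1.
Hypothesis res_gt0 : forall m, 0 < s * res m.

Let s_norm : `|s| = 1.
Proof. by apply/eqP; rewrite -sqr_norm_eq1 s2. Qed.

(** Multiplying F, [quot] and [res] by the common sign [s] makes the residues positive, as the
    descent requires; both signs are treated at once. *)
Lemma residue_sum_pos k : (0 < k)%N -> residue_sum quot lam res k.
Proof.
move=> k0 e e0; have [K HK] := residue_sum_large.
have es : entire (fun i => s * F i) by exact: entireZ.
have FE k' : s * F k' = \sum_(i < k'.+1) phi a i * (s * quot (k' - i)%N).
  by rewrite quotE mulr_sumr; apply: eq_bigr => i _; rewrite mulrCA.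
have sE k' M : s * quot k' - \sum_(m < M) s * res m / lam m ^+ k' =
    s * (quot k' - \sum_(m < M) res m / lam m ^+ k').
  by rewrite mulrBr; congr (_ - _); rewrite mulr_sumr; apply: eq_bigr => m _; exact/esym/mulrA.
have p0 y : 0 <= y -> 0 < Phi a (- y).
  by move=> y0; have := Phi_neg_ge 0 a0 y0; rewrite phi0 normr1 mulr1; apply: lt_le_trans.
have Fsmall e' : 0 < e' -> exists2 Y, 0 < Y & forall y, Y <= y ->
    `|ps (fun i => s * F i) (- y)| <= e' * y * ps (phi a) (- y).
  apply: (growth a0 b0 ab (mom_ge0 0)) => i.
  by rewrite normrM s_norm mul1r transform_le.
have D0 m : 0 <= s * res m by exact: ltW.
have HK' k' : (K <= k')%N -> residue_sum (fun k => s * quot k) lam (fun m => s * res m) k'.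
  move=> /HK H e' e'0; have [M0 HM0] := H e' e'0; exists M0 => M /HM0.
  by rewrite sE normrM s_norm mul1r.
have := residue_sum_all es (entire_phi a0) FE lam_gt0 lam_mono lam_inf lam_zero p0 Fsmall D0 HK' k0.
move=> /(_ e e0)[M0 HM0]; exists M0 => M /HM0.
by rewrite sE normrM s_norm mul1r.
Qed.

Definition fraction M (w : CC R) := toCC (mom 0%N) + w * \sum_(m < M) toCC (res m) / (toCC (lam m) - w).

Lemma partial_fractions (w : CC R) : (forall m, w != toCC (lam m)) ->
  forall e : R, 0 < e -> exists M0, forall M, (M0 <= M)%N ->
  cnorm (cps F w - cps (phi a) w * fraction M w) <= e.
Proof.
move=> wl e e0.
have DT M : \sum_(m < M) `|res m| / lam m ^+ 1 <= s * quot 1.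
  have E : \sum_(m < M) `|res m| / lam m ^+ 1 = \sum_(m < M) (s * res m) / lam m ^+ 1.
    by apply: eq_bigr => m _; rewrite -[LHS]mul1r -{1}s_norm mulrA -normrM gtr0_norm.
  rewrite E; apply: (@residue_sum_le _ (fun k => s * quot k) lam (fun m => s * res m)) => //.
    by move=> m; exact: ltW.
  move=> e' e'0; have [M0 HM0] := @residue_sum_pos 1%N isT e' e'0; exists M0 => M' /HM0.
  rewrite -[X in X <= _]mul1r -{1}s_norm -normrM mulrBr [s * \sum_(m < M') _]mulr_sumr.
  by under eq_bigr do rewrite mulrA.
have [M0 HM0] := mittag_leffler eF (entire_phi a0) quotE
  lam_gt0 lam_mono lam_inf lam_zero residue_sum_pos DT wl e0.
exists M0 => M /HM0; rewrite big_ord1 expr0 mulr1 expr1 quot0.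
congr (_ <= _); congr cnorm; congr (_ - _ * (_ + _ * _)); apply: eq_bigr => m _.
have ln0 : toCC (lam m) != 0 by rewrite toCC_eq0 gt_eqF.
have wl' : toCC (lam m) - w != 0 by rewrite subr_eq0 eq_sym.
by rewrite expr1 toCCM toCCV; field; rewrite ln0 wl'.
Qed.

Lemma F_lam m : ps F (lam m) != 0.
Proof. by apply/negP => /eqP E; have := res_gt0 m; rewrite /res E !mulr0 ltxx. Qed.

Lemma mom0_gt0 : 0 < mom 0%N.
Proof.
rewrite lt_def mom_ge0 andbT; apply/negP => /eqP m0.
have E : F = (fun i => 0 * F i).
  apply/funext => i; rewrite mul0r; apply/eqP; rewrite -normr_le0.
  by have := transform_le i; rewrite m0 mul0r.
by have := F_lam 0; rewrite E psZ// mul0r eqxx.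
Qed.

Lemma transform_neg y : 0 <= y -> mom 0%N <= ps F (- y).
Proof.
move=> y0; apply: (cvg_lbound (@ps_cvg _ _ (- y) eF)); exists 1%N => // -[//|n] _.
rewrite big_ord_recl expr0 mulr1 /F phi0 mul1r lerDl sumr_ge0// => i _.
rewrite exprNn mulrA [_ * mom _]mulrC -[_ * (-1) ^+ _]mulrA phi_sign//.
by rewrite !mulr_ge0// exprn_ge0.
Qed.

Definition rfraction M x := mom 0%N + x * \sum_(m < M) res m / (lam m - x).

Lemma toCC_neq x : (forall m, x != lam m) -> forall m, toCC x != toCC (lam m).
Proof. by move=> xl m; apply: contraNN (xl m) => /eqP/toCC_inj ->. Qed.

Lemma Phi_real_neq0 x : (forall m, x != lam m) -> Phi a x != 0.
Proof.
move=> /toCC_neq/Phi_complex_neq0; rewrite cps_toCC ?toCC_eq0//; exact: entire_phi.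
Qed.

Lemma real_partial_fractions x : (forall m, x != lam m) ->
  forall e : R, 0 < e -> exists M0, forall M, (M0 <= M)%N ->
  `|ps F x - Phi a x * rfraction M x| <= e.
Proof.
move=> xl e e0; have [M0 HM0] := partial_fractions (toCC_neq xl) e0.
exists M0 => M /HM0; rewrite !cps_toCC//; last exact: entire_phi.
have -> : fraction M (toCC x) = toCC (rfraction M x).
  rewrite /fraction /rfraction toCCD toCCM toCC_sum; congr (_ + _ * _).
  by apply: eq_bigr => m _; rewrite [toCC (_ / (_ - _))]toCCM toCCV toCCB.
by rewrite -toCCM -toCCB cnorm_toCC.
Qed.

(** The points x and y lie in the same component of the complement of the lam_m. *)
Definition same_gap x y := forall m, 0 < (lam m - x) * (lam m - y).

(** The m = 0 term, made positive by [s], of the difference quotient of the fraction between x and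
    y. *)
Definition gap_rate x y := s * res 0 * lam 0 / ((lam 0 - x) * (lam 0 - y)).

Lemma gap_neq x y : same_gap x y -> forall m, x != lam m.
Proof. by move=> H m; apply/negP => /eqP E; have := H m; rewrite E subrr mul0r ltxx. Qed.

Lemma same_gapC x y : same_gap x y -> same_gap y x.
Proof. by move=> H m; rewrite mulrC. Qed.

(** The difference y / (l - y) - x / (l - x) is (y - x) l / ((l - x) (l - y)). Within a gap all
    terms thus have the same sign, and one of them bounds the sum from below. *)
Lemma rfraction_diff M x y : same_gap x y ->
  `|y - x| * gap_rate x y <= `|rfraction M.+1 y - rfraction M.+1 x|.
Proof.
move=> xy; have yl := gap_neq (same_gapC xy); have xl := gap_neq xy.
pose q m := s * res m * lam m / ((lam m - x) * (lam m - y)).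
have q0 m : 0 < q m by rewrite divr_gt0// mulr_gt0.
have -> : rfraction M.+1 y - rfraction M.+1 x =
   (y - x) * \sum_(m < M.+1) res m * lam m / ((lam m - x) * (lam m - y)).
  rewrite /rfraction opprD addrACA subrr add0r !mulr_sumr -sumrB.
  apply: eq_bigr => m _; field.
  by rewrite !subr_eq0 ![lam m == _]eq_sym xl yl.
rewrite normrM ler_wpM2l//.
rewrite -[leRHS]mul1r -{1}s_norm -normrM mulr_sumr.
rewrite (eq_bigr (fun m : 'I_M.+1 => q m)) => [|m _]; last by rewrite /q !mulrA.
rewrite ger0_norm ?sumr_ge0// => [|m _]; last exact: ltW.
by rewrite big_ord_recl lerDl sumr_ge0// => m _; exact: ltW.
Qed.

(** Strict monotonicity of F / Phi in quantitative form, which survives the limit in M. It gives the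
    uniqueness of a zero in a gap, and also its simplicity. *)
Lemma F_lower x y : same_gap x y -> ps F x = 0 ->
  `|Phi a y| * (`|y - x| * gap_rate x y) <= `|ps F y|.
Proof.
move=> xy Fx; have yl := gap_neq (same_gapC xy); have xl := gap_neq xy.
have Px : 0 < `|Phi a x| by rewrite normr_gt0 Phi_real_neq0.
apply/ler_addgt0Pl => e e0; pose Q := 1 + `|Phi a y| / `|Phi a x|.
have Q0 : 0 < Q by rewrite ltr_pwDl// divr_ge0.
have eQ : 0 < e / Q by rewrite divr_gt0.
have [M1 HM1] := real_partial_fractions xl eQ.
have [M2 HM2] := real_partial_fractions yl eQ.
have := HM1 (maxn M1 M2).+1 (leqW (leq_maxl _ _)).
have := HM2 (maxn M1 M2).+1 (leqW (leq_maxr _ _)).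
have := rfraction_diff (maxn M1 M2) xy.
rewrite Fx sub0r normrN normrM; set u := rfraction _ x; set v := rfraction _ y => H1 H2 H3.
have H4 : `|u| <= e / Q / `|Phi a x| by rewrite ler_pdivlMr// mulrC.
have H5 : `|Phi a y| * (`|v| + `|u|) <= e + `|ps F y|.
  have -> : e = e / Q + `|Phi a y| * (e / Q / `|Phi a x|).
    by rewrite /Q; field; rewrite !gt_eqF// ltr_pwDl.
  have H6 : `|Phi a y * v| <= e / Q + `|ps F y|.
    have -> : Phi a y * v = ps F y - (ps F y - Phi a y * v) by ring.
    by apply: le_trans (ler_normB _ _) _; rewrite addrC lerD2r.
  have H7 : `|Phi a y| * `|u| <= `|Phi a y| * (e / Q / `|Phi a x|) by rewrite ler_wpM2l.
  by move: H6; rewrite normrM mulrDr; lra.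
apply: le_trans H5; rewrite ler_wpM2l//.
by apply: le_trans H1 _; exact: ler_normB.
Qed.

Lemma gap_rate_gt0 x y : same_gap x y -> 0 < gap_rate x y.
Proof. by move=> xy; rewrite divr_gt0// mulr_gt0. Qed.

Lemma zero_unique x y : same_gap x y -> ps F x = 0 -> ps F y = 0 -> x = y.
Proof.
move=> xy Fx Fy; have := F_lower xy Fx; rewrite Fy normr0 => H.
have Py : 0 < `|Phi a y| by rewrite normr_gt0 (Phi_real_neq0 (gap_neq (same_gapC xy))).
apply/eqP; rewrite eq_sym -subr_eq0 -normr_le0; move: H.
by rewrite pmulr_rle0// pmulr_lle0// gap_rate_gt0.
Qed.

Lemma zero_gt0 x : ps F x = 0 -> 0 < x.
Proof.
move=> Fx; rewrite ltNge; apply/negP => x0.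
have := @transform_neg (- x); rewrite opprK Fx oppr_ge0 => /(_ x0).
by rewrite leNgt mom0_gt0.
Qed.

Lemma gap_intro_lt x y : x < lam 0 -> y < lam 0 -> same_gap x y.
Proof.
move=> xl yl m; have := lam_mono (leq0n m) => lm.
by rewrite mulr_gt0// subr_gt0; apply: lt_le_trans lm.
Qed.

Lemma gap_intro m x y : lam m < x < lam m.+1 -> lam m < y < lam m.+1 -> same_gap x y.
Proof.
move=> /andP[x1 x2] /andP[y1 y2] k; case: (leqP k m) => km.
  have := lam_mono km => lm; rewrite nmulr_rgt0 subr_lt0; exact: le_lt_trans lm _.
by have := lam_mono km => lm; rewrite mulr_gt0// subr_gt0; apply: lt_le_trans lm.
Qed.

Lemma gap_cases x : (forall m, x != lam m) -> x < lam 0 \/ exists m, lam m < x < lam m.+1.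
Proof.
move=> xl; have [N HN] := lam_inf x.
have : exists n, x <= lam n by exists N; exact: HN.
move=> /ex_minnP[[|m] xm H]; first by left; rewrite lt_neqAle xl.
right; exists m; rewrite [x < _]lt_neqAle xl xm !andbT ltNge.
by apply/negP => /H; rewrite ltnn.
Qed.

Lemma zero_neq x : ps F x = 0 -> forall m, x != lam m.
Proof. by move=> Fx m; apply/negP => /eqP E; have := F_lam m; rewrite -E Fx eqxx. Qed.

(** For s = 1 and 0 < x < lam_0 all terms of the fraction are positive, so it stays above [mom 0]
    and F cannot vanish. *)
Lemma zero_first x : s = 1 -> ps F x = 0 -> lam 0 <= x.
Proof.
move=> s1 Fx; rewrite leNgt; apply/negP => xl.
have x0 := zero_gt0 Fx; have xn := zero_neq Fx; have m0 := mom0_gt0.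
have P0 : 0 < `|Phi a x| by rewrite normr_gt0 Phi_real_neq0.
have e0 : 0 < `|Phi a x| * mom 0%N / 2 by rewrite divr_gt0// mulr_gt0.
have [M0 HM0] := real_partial_fractions xn e0.
have := HM0 M0 (leqnn _); rewrite Fx sub0r normrN normrM leNgt => /negP; apply.
apply: (@lt_le_trans _ _ (`|Phi a x| * mom 0%N)).
  by have := mulr_gt0 P0 m0; lra.
rewrite ler_wpM2l//; apply: le_trans (ler_norm _); rewrite lerDl mulr_ge0 ?(ltW x0)//.
rewrite sumr_ge0// => m _; have := res_gt0 m; rewrite s1 mul1r => r0.
rewrite divr_ge0 ?(ltW r0)// subr_ge0; exact: le_trans (ltW xl) (lam_mono (leq0n m)).
Qed.

(** At a multiple zero F(x + h) would be O(h^2), whereas [F_lower] gives a lower bound linear in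
    h. *)
Lemma zero_simple x : ps F x = 0 -> ps (pseries_diffs F) x != 0.
Proof.
move=> Fx; apply/negP => /eqP d0; have xn := zero_neq Fx.
have [C C0 HC] := ps_taylor (`|x| + 1) eF.
have cP := continuous_Phi a0.
have Px : 0 < `|Phi a x| by rewrite normr_gt0 Phi_real_neq0.
have N1 : \forall y \near x, same_gap x y.
  case: (gap_cases xn) => [xl|[m /andP[x1 x2]]].
    have : nbhs x `]-oo, lam 0[%classic by apply: open_nbhs_nbhs; split => //; rewrite /= in_itv.
    by apply: filterS => y /=; rewrite in_itv/= => yl; apply: gap_intro_lt.
  have : nbhs x `]lam m, lam m.+1[%classic.
    by apply: open_nbhs_nbhs; split => //; rewrite /= in_itv/= x1.
  by apply: filterS => y /=; rewrite in_itv/= => yl; apply: (@gap_intro m) => //; rewrite x1.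
have N2 : \forall y \near x, `|Phi a x| / 2 < `|Phi a y|.
  have cn : `|Phi a y| @[y --> x] --> `|Phi a x| by apply: cvg_norm; exact: cP.
  by apply: (cvgr_gt _ cn); lra.
have L0 : 0 < `|lam 0 - x| * (`|lam 0 - x| + 1).
  rewrite mulr_gt0 ?ltr_wpDl// normr_gt0 subr_eq0 eq_sym; exact: xn.
(* A lower bound for |Phi a (x + h)| times [gap_rate x (x + h)], uniform in small h <= 1. *)
pose k := `|Phi a x| / 2 * (s * res 0 * lam 0 / (`|lam 0 - x| * (`|lam 0 - x| + 1))).
have k0 : 0 < k by rewrite mulr_gt0// divr_gt0// mulr_gt0.
have := filterI N1 N2; rewrite -nbhs_ballE => -[d /= dd0 Hd].
pose h := Num.min (d / 2) (Num.min 1 (k / (2 * (C + 1)))).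
have C10 : 0 < 2 * (C + 1) by rewrite mulr_gt0// ltr_wpDl.
have dd2 : 0 < d / 2 by rewrite divr_gt0.
have h0 : 0 < h by rewrite !lt_min dd2 ltr01 divr_gt0.
have h1 : h <= 1 by rewrite !ge_min lexx /= orbT.
have hd : h < d by apply: (@le_lt_trans _ _ (d / 2)); [rewrite ge_min lexx|lra].
have hk : C * h < k.
  have : h <= k / (2 * (C + 1)) by rewrite !ge_min lexx !orbT.
  rewrite ler_pdivlMr// => H; apply: lt_le_trans H; rewrite mulrC ltr_pM2l//; lra.
have [|xy Py] := Hd (x + h).
  by rewrite /ball /= opprD addrA subrr add0r normrN gtr0_norm.
have yx : x + h - x = h by rewrite addrAC subrr add0r.
have := HC x (x + h); rewrite Fx d0 mulr0 !subr0 yx => H.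
have {}H : `|ps F (x + h)| <= C * h ^+ 2.
  apply: H; rewrite ?lerDl// (le_trans (ler_normD _ _))// lerD2l gtr0_norm//.
have := le_trans (F_lower xy Fx) H; rewrite yx [`|h|]gtr0_norm//.
apply/negP; rewrite -ltNge (_ : C * h ^+ 2 = C * h * h); last by rewrite expr2 mulrA.
apply: (@lt_le_trans _ _ (k * h)); first by rewrite ltr_pM2r.
rewrite [h * _]mulrC mulrA ler_wpM2r ?(ltW h0)// /k.
apply: ler_pM; [lra| |exact: ltW|].
  by rewrite divr_ge0 ?(ltW L0)// mulr_ge0 ?(ltW (res_gt0 0)) ?(ltW (lam_gt0 0)).
have p0 := xy 0%N.
rewrite /gap_rate; apply: ler_wpM2l; first by apply: mulr_ge0; exact: ltW.
rewrite lef_pV2 ?posrE// -(gtr0_norm p0) normrM ler_wpM2l//.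
rewrite opprD addrA (le_trans (ler_normB _ _))// lerD2l gtr0_norm//.
Qed.

Lemma Im_pole (d L : R) (w : CC R) : complex.Im w != 0 ->
  complex.Im (w * (toCC d / (toCC L - w))) =
  d * L * complex.Im w / ((L - complex.Re w) ^+ 2 + complex.Im w ^+ 2).
Proof.
case: w => x y /= y0.
have n0 : (L - x) ^+ 2 + y ^+ 2 != 0.
  by rewrite gt_eqF// ltr_wpDl ?sqr_ge0// exprn_even_gt0.
by rewrite add0r sqrrN; field.
Qed.

(** Off the real axis the imaginary parts of the terms have a common sign. The m = 0 term therefore
    keeps all fractions away from 0, and Phi does not vanish there either. *)
Lemma zero_real (w : CC R) : cps F w = 0 -> complex.Im w = 0.
Proof.
move=> Fw; apply/eqP; have [//|y0] := boolP (complex.Im w == 0); exfalso.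
have wl m : w != toCC (lam m) by apply: contraNN y0 => /eqP ->.
have P0 := cnorm_gt0 (Phi_complex_neq0 wl).
pose y := complex.Im w.
pose n m := (lam m - complex.Re w) ^+ 2 + y ^+ 2.
have n0 m : 0 < n m by rewrite ltr_wpDl ?sqr_ge0// exprn_even_gt0.
have fI M : complex.Im (fraction M w) = y * \sum_(m < M) res m * lam m / n m.
  rewrite /fraction ImD add0r mulr_sumr (Im_sum M (fun m => w * (toCC (res m) / (toCC (lam m) - w)))).
  by rewrite mulr_sumr; apply: eq_bigr => m _; rewrite Im_pole// -/y -/(n m); ring.
pose k := `|y| * (s * res 0 * lam 0 / n 0%N).
have k0 : 0 < k by rewrite mulr_gt0 ?normr_gt0// divr_gt0// mulr_gt0.
have fk M : k <= cnorm (fraction M.+1 w).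
  apply: le_trans (Im_le_cnorm _); rewrite fI normrM ler_wpM2l//.
  rewrite -[leRHS]mul1r -{1}s_norm -normrM mulr_sumr.
  have q0 m : 0 <= s * res m * lam m / n m by rewrite divr_ge0 ?(ltW (n0 m))// mulr_ge0 ?(ltW (res_gt0 m)) ?(ltW (lam_gt0 m)).
  rewrite (eq_bigr (fun m : 'I_M.+1 => s * res m * lam m / n m)) => [|m _]; last by rewrite !mulrA.
  rewrite ger0_norm ?sumr_ge0// big_ord_recl lerDl sumr_ge0// => m _; exact: q0.
have e0 : 0 < cnorm (cps (phi a) w) * k / 2 by rewrite divr_gt0// mulr_gt0.
have [M0 HM0] := partial_fractions wl e0.
have := HM0 M0.+1 (leqnSn _); rewrite Fw sub0r cnormN cnormM leNgt => /negP; apply.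
apply: (@lt_le_trans _ _ (cnorm (cps (phi a) w) * k)).
  by have := mulr_gt0 P0 k0; lra.
by rewrite ler_wpM2l ?cnorm_ge0.
Qed.

Lemma zero_exists x y : x < y -> ps F x * ps F y < 0 -> exists2 z, x < z < y & ps F z = 0.
Proof.
move=> xy Fxy.
have [||z zxy Fz] := @IVT R (ps F) x y 0 (ltW xy).
- by apply: continuous_subspaceT => z; exact: continuous_ps.
- exact/min_max_le0/ltW.
exists z => //; move: zxy; rewrite in_itv/= => /andP[xz zy].
rewrite !lt_neqAle xz zy !andbT; apply/andP; split; apply/eqP => E.
  by move: Fxy; rewrite E Fz mul0r ltxx.
by move: Fxy; rewrite -E Fz mulr0 ltxx.
Qed.

End Interlacing.

(** * Alternation of the sign of the derivative at consecutive zeros *)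

Section SignAlternation.
Variable R : realType.
Variable a : R.
Hypothesis a0 : 0 < a.
Variables (lam : nat -> R).
Hypothesis lam_gt0 : forall m, 0 < lam m.
Hypothesis lam_incr : forall m n, (m < n)%N -> lam m < lam n.
Hypothesis lam_zero : forall m, Phi a (lam m) = 0.
Hypothesis lam_all : forall y, 0 < y -> Phi a y = 0 -> exists m, y = lam m.

Let d m := ps (pseries_diffs (phi a)) (lam m).

Let same_sign u v : u <= v -> (forall z, u <= z <= v -> Phi a z != 0) -> 0 < Phi a u * Phi a v.
Proof.
move=> uv H; rewrite ltNge; apply/negP => P0.
have [||z zxy Fz] := @IVT R (Phi a) u v 0 uv.
- by apply: continuous_subspaceT => z; exact: continuous_Phi.
- exact: min_max_le0.
by have := H z zxy; rewrite Fz eqxx.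
Qed.

Let dE_d m : dE a (lam m) 1 = lam m * d m.
Proof. by rewrite dE_dPhi /d phi_diffs// psZ//; apply: entire_phi; rewrite addr_gt0. Qed.

Let d_neq0 m : d m != 0.
Proof.
have := dE1_neq0 a0 lam_zero m; rewrite dE_d; apply: contraNN => /eqP ->.
by rewrite mulr0.
Qed.

(** Phi keeps its sign between consecutive zeros. Just after lam_m it has the sign of [d m], just
    before lam_(m+1) the opposite of that of [d m.+1]; the induction starts from Phi(0) = 1. *)
Let d_sign m : (-1) ^+ m * d m < 0.
Proof.
have ep := entire_phi a0.
elim: m => [|m IH].
  have [h [h0 hl _ H]] := sign_near ep (lam_zero 0) (d_neq0 0) (lam_gt0 0).
  have := @same_sign 0 (lam 0 - h); rewrite (Phi0 a0) mul1r => Q.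
  have P : 0 < Phi a (lam 0 - h).
    apply: Q => [|z /andP[z0 zl]]; first by rewrite subr_ge0 ltW.
    apply/negP => /eqP Pz; move: z0; rewrite le_eqVlt => /predU1P[zE|z0].
      by move: Pz; rewrite -zE (Phi0 a0) => /eqP; rewrite oner_eq0.
    have [k zk] := lam_all z0 Pz; have := lam_le lam_incr (leq0n k); rewrite -zk; lra.
  by move: H; rewrite expr0 mul1r pmulr_llt0.
(* Half the gap, so that the two test points stay in order. *)
have g0 : 0 < (lam m.+1 - lam m) / 2 by rewrite divr_gt0// subr_gt0 lam_incr.
have [h [h0 hl H _]] := sign_near ep (lam_zero m) (d_neq0 m) g0.
have [k [k0 kl _ K]] := sign_near ep (lam_zero m.+1) (d_neq0 m.+1) g0.
have P : 0 < Phi a (lam m + h) * Phi a (lam m.+1 - k).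
  apply: same_sign => [|z /andP[z1 z2]]; first lra.
  have lm := lam_gt0 m.
  apply/negP => /eqP Pz; have z0 : 0 < z by lra.
  have [n zn] := lam_all z0 Pz; case: (leqP n m) => nm.
    have := lam_le lam_incr nm; rewrite -zn; lra.
  have := lam_le lam_incr nm; rewrite -zn; lra.
have : 0 < ((-1) ^+ m * d m) * ((-1) ^+ m.+1 * d m.+1).
  have -> : ((-1) ^+ m * d m) * ((-1) ^+ m.+1 * d m.+1) = ((-1) ^+ m * (-1) ^+ m) * - (d m * d m.+1).
    by rewrite exprS; ring.
  rewrite -exprMn mulrNN mul1r expr1n mul1r oppr_gt0.
  have : (d m * Phi a (lam m + h)) * (d m.+1 * Phi a (lam m.+1 - k)) < 0 by rewrite pmulr_rlt0.
  have -> : (d m * Phi a (lam m + h)) * (d m.+1 * Phi a (lam m.+1 - k)) =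
    d m * d m.+1 * (Phi a (lam m + h) * Phi a (lam m.+1 - k)) by ring.
  by rewrite pmulr_llt0.
by rewrite nmulr_rgt0.
Qed.

Lemma gcoef_sign m : 0 < (-1) ^+ m * gcoef a lam m.
Proof.
rewrite /gcoef dE_d mulrN oppr_gt0 invfM mulrCA pmulr_rlt0 ?invr_gt0//.
have -> : (-1) ^+ m / d m = (-1) ^+ m * d m * (d m)^-1 ^+ 2 by field; exact: d_neq0.
by rewrite pmulr_llt0 ?d_sign// exprn_even_gt0// invr_eq0 d_neq0.
Qed.

End SignAlternation.

(** * The Gamma function and the zeros of [bessel_J] *)

Section GammaFunction.
Variable R : realType.
Notation mu := (@lebesgue_measure R).
Implicit Types (x t : R) (n : nat).

Lemma integrable_scale (i : interval R) k (f : R -> R) : mu.-integrable [set` i] (EFin \o f) ->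
  mu.-integrable [set` i] (EFin \o (fun t => k * f t)).
Proof. by move=> H; have := integrableZl _ k H => /(_ (measurable_itv _)). Qed.

Definition gamma_density x t := t `^ (x - 1) * expR (- t).

(** A compact exhaustion of the positive axis, on which the density is continuous; n + 2 keeps each
    interval nondegenerate. *)
Definition pos_itv n : set R := `[n.+2%:R^-1, n.+2%:R].

Definition gamma_part x n := \int[mu]_(t in pos_itv n) gamma_density x t.

Lemma pos_itv_lt n : 0 < n.+2%:R^-1 :> R /\ n.+2%:R^-1 < n.+2%:R :> R.
Proof.
have n0 : 0 < n.+2%:R :> R by rewrite ltr0n.
have n1 : 1 < n.+2%:R :> R by rewrite ltr1n.
by rewrite invr_gt0; split => //; apply: (@lt_trans _ _ 1) => //; rewrite invf_lt1.
Qed.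

Lemma pos_itv_gt0 n t : pos_itv n t -> 0 < t.
Proof.
have [H _] := pos_itv_lt n.
by rewrite /pos_itv /= in_itv/= => /andP[/(lt_le_trans H)].
Qed.

Lemma pos_itv_mono : {homo pos_itv : n m / (n <= m)%N >-> (n <= m)%O}.
Proof.
move=> n m nm; apply/subsetPset => t; rewrite /pos_itv /= !in_itv/= => /andP[t1 t2].
apply/andP; split.
  by apply: le_trans t1; rewrite lef_pV2 ?posrE ?ltr0n// ler_nat !ltnS.
by apply: le_trans t2 _; rewrite ler_nat !ltnS.
Qed.

Lemma pos_itv_bigcup : \bigcup_n pos_itv n = `]0, +oo[%classic.
Proof.
apply/seteqP; split => [t [n _ /pos_itv_gt0]|t]; first by rewrite /= in_itv/= andbT.
rewrite /= in_itv/= andbT => t0.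
pose n := (Num.trunc t + Num.trunc t^-1)%N.
exists n => //; rewrite /pos_itv /= in_itv/=; apply/andP; split.
  rewrite -[t]invrK lef_pV2 ?posrE ?invr_gt0 ?ltr0n//.
  apply/ltW/(lt_le_trans (truncnS_gt _)); rewrite ler_nat ltnS; exact: leq_trans (leq_addl _ _) (leqnSn _).
apply/ltW/(lt_le_trans (truncnS_gt _)); rewrite ler_nat ltnS; exact: leq_trans (leq_addr _ _) (leqnSn _).
Qed.

Lemma is_derive_continuous (f : R -> R) t df : is_derive t (1:R) f df -> {for t, continuous f}.
Proof.
move=> d; apply: differentiable_continuous; apply/derivable1_diffP.
exact: (@ex_derive _ _ _ _ _ _ _ d).
Qed.

Lemma ftc_pos (F f : R -> R) a b : 0 < a -> a < b ->
  (forall t, 0 < t -> is_derive t (1:R) F (f t)) -> (forall t, 0 < t -> {for t, continuous f}) ->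
  mu.-integrable `[a, b] (EFin \o f) /\ (\int[mu]_(t in `[a, b]) (f t)%:E)%E = (F b - F a)%:E.
Proof.
move=> a0 ab dF cf0.
have b0 := lt_trans a0 ab.
have cf : {within `[a, b], continuous f}.
  apply: continuous_in_subspaceT => t; rewrite inE/= in_itv/= => /andP[ta _].
  exact: cf0 (lt_le_trans a0 ta).
split; first by apply: continuous_compact_integrable => //; exact: segment_compact.
rewrite (@continuous_FTC2 _ f F a b)//.
- split.
  + by move=> t; rewrite in_itv/= => /andP[ta _]; exact: (@ex_derive _ _ _ _ _ _ _ (dF t (lt_trans a0 ta))).
  + by apply: cvg_at_right_filter; exact: is_derive_continuous (dF a a0).
  + by apply: cvg_at_left_filter; exact: is_derive_continuous (dF b b0).
- by move=> t; rewrite in_itv/= => /andP[ta _]; rewrite derive1E; have H := dF t (lt_trans a0 ta); rewrite derive_val.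
Qed.

Lemma is_derive_power_exp x t : 0 < t ->
  is_derive t (1:R) (fun t => t `^ x * expR (- t)) (x * gamma_density x t - gamma_density (x + 1) t).
Proof.
move=> t0; have H1 := is_derive1_powR x t0.
have H2 : is_derive t (1:R) (fun t : R => expR (- t)) (- expR (- t)).
  have H : is_derive t (1:R) (fun t : R => - t) (-1) by apply: is_deriveN.
  have := @is_derive1_comp _ expR (fun t : R => - t) t _ _ (is_derive_expR (- t)) H.
  by rewrite mulrN1.
apply: (is_derive_eq (is_deriveM H1 H2)).
by rewrite /gamma_density addrK /GRing.scale /=; ring.
Qed.

Lemma gamma_density_ge0 x t : 0 <= gamma_density x t.
Proof. by rewrite mulr_ge0 ?powR_ge0 ?expR_ge0. Qed.

Lemma measurable_gamma_density x : measurable_fun [set: R] (gamma_density x).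
Proof.
apply: measurable_funM; first exact: measurable_powR.
apply: measurableT_comp; first exact: measurable_expR.
exact: measurable_funN.
Qed.

Lemma gamma_density_derive x t : 0 < t -> is_derive t (1:R) (gamma_density x)
  ((x - 1) * gamma_density (x - 1) t - gamma_density x t).
Proof. by move=> t0; have := is_derive_power_exp (x - 1) t0; rewrite subrK. Qed.

Lemma gamma_density_integrable x n : mu.-integrable (pos_itv n) (EFin \o gamma_density x).
Proof.
have [a0 ab] := pos_itv_lt n.
apply: continuous_compact_integrable; first exact: segment_compact.
apply: continuous_in_subspaceT => t; rewrite inE => /pos_itv_gt0 t0.
exact: is_derive_continuous (gamma_density_derive x t0).
Qed.

Lemma gamma_part_rec x n : x * gamma_part x n - gamma_part (x + 1) n =
  n.+2%:R `^ x * expR (- n.+2%:R) - n.+2%:R^-1 `^ x * expR (- n.+2%:R^-1).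
Proof.
have [a0 ab] := pos_itv_lt n.
have i1 := gamma_density_integrable x n; have i2 := gamma_density_integrable (x + 1) n.
have D t : 0 < t -> {for t, continuous (fun t => x * gamma_density x t - gamma_density (x + 1) t)}.
  move=> t0; have c1 := is_derive_continuous (gamma_density_derive x t0).
  have c2 := is_derive_continuous (gamma_density_derive (x + 1) t0).
  by apply: cvgB => //; apply: cvgM => //; exact: cvg_cst.
have [_ H] := ftc_pos a0 ab (is_derive_power_exp x) D.
rewrite /gamma_part -RintegralZl//; last exact: measurable_itv.
rewrite -RintegralB//; [|exact: measurable_itv|]; first by rewrite /Rintegral H.
exact: integrable_scale.
Qed.

Lemma power_exp_le N t : 0 <= t -> t ^+ N.+1 * expR (- t) <= N.+1`!%:R.
Proof.
move=> t0; rewrite expRN ler_pdivrMr ?expR_gt0// mulrC -ler_pdivrMr ?ltr0n ?fact_gt0//.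
by apply: le_trans (expR_ge1Dxn N t0); rewrite lerDr.
Qed.

Lemma powR_le_pow x N t : 0 < t -> 0 <= x -> x <= N%:R -> t `^ x <= 1 + t ^+ N.
Proof.
move=> t0 x0 xN; have [t1|t1] := leP 1 t.
  rewrite -powR_mulrn ?(ltW t0)//; apply: ler_wpDl => //.
  by rewrite ler_powR.
have : t `^ x <= 1 `^ x by rewrite ge0_ler_powR// ?nnegrE ltW.
by rewrite powR1 => /le_trans; apply; rewrite lerDl exprn_ge0// ltW.
Qed.

(* The density is dominated by a multiple of the derivative of the bounded
   function [- (x * (1 + t `^ x))^-1]. *)
Lemma gamma_part_bounded x : 0 < x -> exists C, forall n, gamma_part x n <= C.
Proof.
move=> x0.
pose N := (Num.trunc (2 * x))%N.
(* With u = t^x and 2 x <= N + 1, one has (1 + u)^2 <= 2 + 2 u^2 <= 4 + 2 t^(N+1), while t^(N+1)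
   e^(-t) <= (N+1)!. *)
pose C : R := 4 + 2 * N.+1`!%:R.
have C0 : 0 <= C by rewrite /C addr_ge0// mulr_ge0.
pose F t : R := - (x^-1 * (1 + t `^ x)^-1).
pose f t : R := t `^ (x - 1) * (1 + t `^ x) ^- 2.
have p1 t : 0 < 1 + t `^ x by rewrite ltr_pwDl// powR_ge0.
have dp t : 0 < t -> is_derive t (1:R) (fun t => 1 + t `^ x) (x * t `^ (x - 1)).
  move=> t0; have H := is_derive1_powR x t0.
  by apply: (is_derive_eq (is_deriveD (is_derive_cst (1:R) t (1:R)) H)); rewrite add0r.
have dF t : 0 < t -> is_derive t (1:R) F (f t).
  move=> t0; have H := dp t t0; have pn : 1 + t `^ x != 0 by rewrite gt_eqF.
  have H2 := @is_deriveV _ (fun t => 1 + t `^ x) t _ _ pn H.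
  apply: (is_derive_eq (is_deriveN (is_deriveZ x^-1 H2))).
  by rewrite /f /GRing.scale /=; field; rewrite pn gt_eqF.
have cf t : 0 < t -> {for t, continuous f}.
  move=> t0; have c1 := is_derive_continuous (is_derive1_powR (x - 1) t0).
  have c2 := is_derive_continuous (dp t t0).
  apply: cvgM => //; apply: cvgV; last by apply: cvgM.
  by rewrite expf_neq0// gt_eqF.
have fle t : 0 < t -> gamma_density x t <= C * f t.
  move=> t0; rewrite /gamma_density /f mulrCA ler_wpM2l ?powR_ge0//.
  rewrite ler_pdivlMr ?exprn_gt0//.
  set u := t `^ x; have u0 : 0 <= u by exact: powR_ge0.
  have uu : u ^+ 2 <= 1 + t ^+ N.+1.
    rewrite -powR_mulrn ?powR_ge0// -powRrM; apply: powR_le_pow => //; first by rewrite mulr_ge0// ltW.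
    by rewrite mulrC; apply/ltW; exact: truncnS_gt.
  have e1 : expR (- t) <= 1 by rewrite expR_le1 oppr_le0 ltW.
  have e0 := expR_ge0 (- t).
  have := power_exp_le N (ltW t0) => H.
  apply: (@le_trans _ _ (expR (- t) * (4 + 2 * t ^+ N.+1))).
    rewrite ler_wpM2l//; have := sqr_ge0 (1 - u); rewrite !expr2; rewrite expr2 in uu; nra.
  rewrite mulrDr /C lerD//; first by rewrite ler_piMl.
  by rewrite mulrCA ler_wpM2l// mulrC.
exists (C / x) => n; have [a0 ab] := pos_itv_lt n.
have [if' H] := ftc_pos a0 ab dF cf.
have ig := gamma_density_integrable x n.
apply: (@le_trans _ _ (\int[mu]_(t in pos_itv n) (C * f t))).
  apply: le_Rintegral => //; first exact: measurable_itv.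
    exact: integrable_scale.
  by move=> t /pos_itv_gt0; exact: fle.
rewrite RintegralZl//; last exact: measurable_itv.
rewrite ler_wpM2l// /Rintegral H /= /F opprK addrC.
rewrite lerBlDr ler_wpDr ?mulr_ge0 ?invr_ge0 ?(ltW x0) ?(ltW (p1 _))//.
by rewrite ler_piMr ?invr_ge0 ?(ltW x0)// invf_le1// lerDl powR_ge0.
Qed.

(** Monotone convergence along the exhaustion. The uniform bound makes the extended integral finite,
    so that its real value [Gamma x] is the limit. *)
Lemma gamma_cvg x : 0 < x -> gamma_part x n @[n --> \oo] --> Gamma x /\
  forall n, gamma_part x n <= Gamma x.
Proof.
move=> x0; have [C HC] := gamma_part_bounded x0.
have mg D : measurable_fun D (EFin \o gamma_density x).
  by apply/measurable_EFinP; apply: measurable_funTS; exact: measurable_gamma_density.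
have g0 (t : R) : (0 <= (gamma_density x t)%:E)%E by rewrite lee_fin gamma_density_ge0.
have H : (\int[mu]_(t in pos_itv n) (EFin \o gamma_density x) t)%E @[n --> \oo] -->
    (\int[mu]_(t in \bigcup_n pos_itv n) (EFin \o gamma_density x) t)%E.
  apply: ge0_nondecreasing_set_cvg_integral => //; first exact: pos_itv_mono.
  - by move=> i; exact: measurable_itv.
  - by move=> i; exact: mg.
  - by move=> i t _; exact: g0.
rewrite pos_itv_bigcup in H.
have E n : (\int[mu]_(t in pos_itv n) (EFin \o gamma_density x) t)%E = (gamma_part x n)%:E.
  rewrite /gamma_part /Rintegral fineK//; apply: integrable_fin_num; first exact: measurable_itv.
  exact: gamma_density_integrable.
have le n : ((gamma_part x n)%:E <= \int[mu]_(t in `]0%R, +oo[) (EFin \o gamma_density x) t)%E.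
  rewrite -E; apply: ge0_subset_integral; [exact: measurable_itv|exact: measurable_itv|exact: mg|by move=> t _; exact: g0|].
  by rewrite -pos_itv_bigcup; exact: bigcup_sup.
have fin : (\int[mu]_(t in `]0%R, +oo[) (EFin \o gamma_density x) t)%E \is a fin_num.
  rewrite ge0_fin_numE; last by apply: integral_ge0 => t _; exact: g0.
  apply: (@le_lt_trans _ _ C%:E); last exact: ltry.
  rewrite -(cvg_lim _ H)//; apply: lime_le; first by apply/cvg_ex; eexists; exact: H.
  by apply: nearW => n; rewrite E lee_fin.
have GE : (\int[mu]_(t in `]0%R, +oo[) (EFin \o gamma_density x) t)%E = (Gamma x)%:E.
  by rewrite /Gamma /Rintegral fineK.
rewrite GE in H le; split; last by move=> n; rewrite -lee_fin.
by apply: fine_cvg; apply: cvg_trans H; apply: near_eq_cvg; apply: nearW => n; rewrite E.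
Qed.

Lemma Gamma_rec x : 0 < x -> Gamma (x + 1) = x * Gamma x.
Proof.
move=> x0; have [H1 _] := gamma_cvg x0.
have x1 : 0 < x + 1 by rewrite addr_gt0.
have [H2 _] := gamma_cvg x1.
have a0 : n.+2%:R^-1 @[n --> \oo] --> (0 : R).
  by have := @cvg_harmonic R; rewrite -(cvg_shiftS (@harmonic R)).
have c1 : n.+2%:R^-1 `^ x * expR (- n.+2%:R^-1) @[n --> \oo] --> (0 : R).
  apply: (@squeeze_cvgr _ _ _ _ (fun=> 0) (fun n => n.+2%:R^-1 `^ x)).
  - apply: nearW => n; rewrite mulr_ge0 ?powR_ge0 ?expR_ge0//= ler_piMr ?powR_ge0//.
  - exact: cvg_cst.
  - move: (powR_cvg0 x0) => /cvg_at_rightP; apply; split => //.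
pose N := Num.trunc x.
have c2 : n.+2%:R `^ x * expR (- n.+2%:R) @[n --> \oo] --> (0 : R).
  apply: (@squeeze_cvgr _ _ _ _ (fun=> 0) (fun n => N.+2`!%:R * n.+2%:R^-1)).
  - apply: nearW => n; rewrite mulr_ge0 ?powR_ge0 ?expR_ge0//=.
    have n0 : 0 < n.+2%:R :> R by rewrite ltr0n.
    rewrite ler_pdivlMr//; apply: le_trans (power_exp_le N.+1 (ltW n0)).
    rewrite mulrAC ler_wpM2r ?expR_ge0// exprSr; apply: ler_wpM2r; first exact: ltW.
    rewrite -powR_mulrn ?(ltW n0)// ler_powR ?ler1n//.
    by apply/ltW; exact: truncnS_gt.
  - exact: cvg_cst.
  - by rewrite -[X in _ --> X](mulr0 N.+2`!%:R); apply: cvgM => //; exact: cvg_cst.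
have H3 : x * gamma_part x n - gamma_part (x + 1) n @[n --> \oo] --> x * Gamma x - Gamma (x + 1).
  exact: (cvgB (cvgM (cvg_cst x) H1) H2).
have H4 : x * gamma_part x n - gamma_part (x + 1) n @[n --> \oo] --> (0 : R).
  have fE : (fun n => x * gamma_part x n - gamma_part (x + 1) n) =
    (fun n => n.+2%:R `^ x * expR (- n.+2%:R) - n.+2%:R^-1 `^ x * expR (- n.+2%:R^-1)).
    by apply/funext => n; exact: gamma_part_rec.
  by rewrite fE; have := cvgB c2 c1; rewrite subr0; exact.
apply/eqP; rewrite eq_sym -subr_eq0; apply/eqP.
exact: (cvg_unique (@Rhausdorff R) H3 H4).
Qed.

Lemma Gamma_gt0 x : 0 < x -> 0 < Gamma x.
Proof.
move=> x0; have [_ H] := gamma_cvg x0; apply: lt_le_trans (H 0%N).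
(* A lower bound for the density on [1, 2], where 0 <= ln t <= 1 and t <= 2. *)
pose c := expR (- `|x - 1| - 2).
have c0 : 0 < c by exact: expR_gt0.
have sub : `[1, 2]%classic `<=` pos_itv 0.
  move=> t; rewrite /pos_itv /= !in_itv/= => /andP[t1 t2]; rewrite t2 andbT.
  lra.
have ig := gamma_density_integrable x 0.
have E : mu `[1, 2]%classic = 1%E.
  by have := lebesgue_measure_itv `[1 : R, 2]; rewrite /= lte_fin ltr1n => ->; rewrite -EFinD; congr EFin; lra.
apply: (@lt_le_trans _ _ (\int[mu]_(t in `[1, 2]) c)).
  rewrite Rintegral_cst//.
  rewrite (_ : fine _ = 1) ?mulr1//; exact: (congr1 fine E).
rewrite -lee_fin /gamma_part /Rintegral !fineK; last 2 first.
- by apply: integrable_fin_num; [exact: measurable_itv|exact: ig].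
- rewrite integral_cst; last exact: measurable_itv.
  by apply: (@eq_ind _ 1%E (fun u => (c%:E * u)%E \is a fin_num)); [rewrite mule1|exact: esym E].
apply: (@le_trans _ _ (\int[mu]_(t in `[1%R, 2%R]) (gamma_density x t)%:E)%E).
  apply: ge0_le_integral => //.
  - by move=> t _; rewrite lee_fin ltW.
  - by apply/measurable_EFinP; apply: measurable_funTS; exact: measurable_gamma_density.
  move=> t; rewrite /= in_itv/= => /andP[t1 t2]; rewrite lee_fin /gamma_density /c.
  have t0 : 0 < t by lra.
  rewrite /powR gt_eqF// -expRD ler_expR lerD//; last lra.
  rewrite -lerN2 opprK; apply: le_trans (ler_norm _) _; rewrite normrN normrM ler_piMr//.
  rewrite ger0_norm ?ln_ge0//.
  have := @le_ln1Dx R (t - 1); rewrite (_ : 1 + (t - 1) = t); last by ring.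
  by move=> H'; apply: le_trans (H' _) _; lra.
apply: ge0_subset_integral => //.
- exact: measurable_itv.
- by apply/measurable_EFinP; apply: measurable_funTS; exact: measurable_gamma_density.
- by move=> t _; rewrite lee_fin gamma_density_ge0.
Qed.

Lemma Gamma_pochhammer x m : 0 < x -> Gamma (m%:R + x) = Gamma x * pochhammer x m.
Proof.
move=> x0; elim: m => [|m IH]; first by rewrite add0r pochhammer0 mulr1.
rewrite -natr1 addrAC Gamma_rec ?ltr_wpDl// IH pochhammerS.
by rewrite addrC; ring.
Qed.

Lemma bessel_J_Phi (nu x : R) : -1 < nu -> 0 < x ->
  bessel_J nu x = (x / 2) `^ nu / Gamma (nu + 1) * Phi (nu + 1) (x ^+ 2 / 4).
Proof.
move=> nu1 x0; have a0 : 0 < nu + 1 by lra.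
have x2 : 0 < x / 2 by rewrite divr_gt0.
have G0 := Gamma_gt0 a0.
rewrite /Phi -psZ; last exact: entire_phi.
rewrite /bessel_J /ps; congr (limn _); apply/funext => n; rewrite /pseries /series/=.
apply: eq_bigr => m _; rewrite -addrA Gamma_pochhammer// powRD ?(gt_eqF x2) ?implybT//.
rewrite -natrM powR_mulrn ?(ltW x2)// exprM.
have -> : (x / 2) ^+ 2 = x ^+ 2 / 4 by field.
rewrite /phi; have p0 := pochhammer_gt0 m a0; field.
by rewrite !gt_eqF// ltr0n fact_gt0.
Qed.

Lemma bessel_J_eq0 (nu x : R) : -1 < nu -> 0 < x -> bessel_J nu x = 0 <-> Phi (nu + 1) (x ^+ 2 / 4) = 0.
Proof.
move=> nu1 x0; have a0 : 0 < nu + 1 by lra.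
have G0 := Gamma_gt0 a0.
rewrite bessel_J_Phi//; split => [/eqP|->]; last by rewrite mulr0.
rewrite mulf_eq0 => /orP[|/eqP//].
by rewrite gt_eqF// divr_gt0// powR_gt0// divr_gt0.
Qed.

End GammaFunction.

(** * The Hankel transform *)

Section ComplexSeries.
Variable R : realType.
Implicit Types (a : nat -> CC R) (w z : CC R) (c : nat -> R).

Lemma normCC_le (z e : CC R) : 0 < e -> cnorm z <= complex.Re e -> `|z| <= e.
Proof. by rewrite cnormE ltcE lecE /= => /andP[-> _]. Qed.

Lemma fsum_lim a l : fsum a l -> limn (series a) = l.
Proof.
move=> [C C0 H]; apply: cvg_lim; first exact: norm_hausdorff.
apply/cvgrPdist_le => e e0.
have e1 : 0 < complex.Re e by move: e0; rewrite ltcE => /andP[].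
have q1 : `|2^-1 : R| < 1 by rewrite ger0_norm; lra.
have := cvg_geometric C q1 => /cvgrPdist_le /(_ _ e1); apply: filterS => n.
rewrite sub0r normrN /= => H1; apply: normCC_le => //.
rewrite seriesEord; apply: le_trans (H n) _.
by apply: le_trans H1; rewrite ler_norm.
Qed.

Lemma entire_Re c w : entire c -> entire (fun i => c i * complex.Re (w ^+ i)) /\
  entire (fun i => c i * complex.Im (w ^+ i)).
Proof.
move=> ec; have eg := entire_geo (cnorm w) ec.
split; apply: (@entire_le _ _ _ 1 eg) => // i; rewrite mul1r !normrM ler_wpM2l//
  [leRHS]ger0_norm ?exprn_ge0 ?cnorm_ge0// -cnormX.
  exact: Re_le_cnorm.
exact: Im_le_cnorm.
Qed.

(** For fixed w, both parts of the series at w x are real entire series in x. This reduces the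
    complex integral in [hankel] to real ones. *)
Lemma cps_toCCM c w x : entire c ->
  complex.Re (cps c (w * toCC x)) = ps (fun i => c i * complex.Re (w ^+ i)) x /\
  complex.Im (cps c (w * toCC x)) = ps (fun i => c i * complex.Im (w ^+ i)) x.
Proof.
move=> ec; have [eR eI] := entire_Re w ec.
have [C C0 HC] := cps_fsum (w * toCC x) ec.
have tE i : toCC (c i) * (w * toCC x) ^+ i = toCC (c i * x ^+ i) * w ^+ i.
  by rewrite exprMn toCCM toCCX; ring.
have q4 n : 4^-1 ^+ n <= 2^-1 ^+ n :> R by rewrite lerXn2r ?nnegrE; lra.
split; apply/eqP; rewrite -subr_eq0; apply/eqP.
  have [D D0 HD] := ps_tail eR (normr_ge0 x).
  apply: (@half_eq0 _ _ (C + D)) => n.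
  rewrite -(subrKA (\sum_(i < n) c i * complex.Re (w ^+ i) * x ^+ i)).
  apply: le_trans (ler_normD _ _) _; rewrite [leRHS]mulrDl; apply: lerD.
    apply: le_trans (HC n); apply: le_trans (Re_le_cnorm _).
    rewrite ReB (Re_sum n (fun i => toCC (c i) * (w * toCC x) ^+ i)).
    rewrite le_eqVlt; apply/orP; left; apply/eqP; congr (`|_ - _|).
    by apply: eq_bigr => i _; rewrite tE Re_toCCM; ring.
  by rewrite distrC; apply: le_trans (HD n x (lexx _)) _; rewrite ler_wpM2l.
have [D D0 HD] := ps_tail eI (normr_ge0 x).
apply: (@half_eq0 _ _ (C + D)) => n.
rewrite -(subrKA (\sum_(i < n) c i * complex.Im (w ^+ i) * x ^+ i)).
apply: le_trans (ler_normD _ _) _; rewrite [leRHS]mulrDl; apply: lerD.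
  apply: le_trans (HC n); apply: le_trans (Im_le_cnorm _).
  rewrite ImB (Im_sum n (fun i => toCC (c i) * (w * toCC x) ^+ i)).
  rewrite le_eqVlt; apply/orP; left; apply/eqP; congr (`|_ - _|).
  by apply: eq_bigr => i _; rewrite tE Im_toCCM; ring.
by rewrite distrC; apply: le_trans (HD n x (lexx _)) _; rewrite ler_wpM2l.
Qed.

Lemma bessel_JJ_cps (nu : R) z : -1 < nu -> bessel_JJ nu z = cps (phi (nu + 1)) ((z / 2) ^+ 2).
Proof.
move=> nu1; have b0 : 0 < nu + 1 by lra.
apply: fsum_lim; have := cps_fsum ((z / 2) ^+ 2) (entire_phi b0); congr fsum.
apply/funext => m; rewrite -exprM /phi toCCM toCCV toCCM toCC_nat toCCX toCCN toCC1.
by rewrite mulrAC.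
Qed.

Lemma cps_difference_quotient c z : entire c -> exists2 K, 0 <= K & forall h : CC R, h != 0 -> cnorm h <= 1 ->
  cnorm (cps (pseries_diffs c) ((z / 2) ^+ 2) * (z / 2) -
    h^-1 * (cps c (((h + z) / 2) ^+ 2) - cps c ((z / 2) ^+ 2))) <= K * cnorm h.
Proof.
move=> ec; pose W h : CC R := ((h + z) / 2) ^+ 2.
pose D := cps (pseries_diffs c) (W 0).
have z0 := cnorm_ge0 z.
pose B := (cnorm z + 1) ^+ 2.
have [C C0 HC] := cps_taylor B ec.
have n2 : cnorm (2 : CC R)^-1 = 2^-1 by rewrite cnormV -(toCC_nat R 2) cnorm_toCC ger0_norm.
have WB h : cnorm h <= 1 -> cnorm (W h) <= B.
  move=> h1; rewrite /W cnormX cnormM n2 /B; apply: lerXn2r; rewrite ?nnegrE.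
  - by rewrite mulr_ge0 ?cnorm_ge0.
  - by rewrite addr_ge0.
  apply: (@le_trans _ _ (cnorm (h + z))); first by rewrite ler_piMr ?cnorm_ge0//; lra.
  by apply: le_trans (cnormD _ _) _; lra.
have W0B : cnorm (W 0) <= B by apply: WB; rewrite cnorm0.
exists (C * B + cnorm D) => [|h h0 h1]; first by rewrite addr_ge0 ?cnorm_ge0// mulr_ge0// sqr_ge0.
have -> : (z / 2) ^+ 2 = W 0 by rewrite /W add0r.
rewrite -/(W h) -/D.
pose E := cps c (W h) - cps c (W 0) - (W h - W 0) * D.
have dW : W h - W 0 = h * ((2 * z + h) * (2^-1 * 2^-1)) by rewrite /W; field.
have -> : D * (z / 2) - h^-1 * (cps c (W h) - cps c (W 0)) = - (h^-1 * E + h * (2^-1 * 2^-1) * D).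
  have -> : cps c (W h) - cps c (W 0) = E + (W h - W 0) * D by rewrite /E subrK.
  by rewrite dW; field.
have hn := cnorm_gt0 h0.
have := HC _ _ W0B (WB h h1); rewrite -/D -/E => HE.
have qn : cnorm ((2 * z + h) * (2^-1 * 2^-1)) <= cnorm z + 1.
  rewrite !cnormM n2; have := cnormD (2 * z) h; rewrite cnormM -(toCC_nat R 2) cnorm_toCC ger0_norm//; lra.
rewrite cnormN; apply: le_trans (cnormD _ _) _; rewrite mulrDl; apply: lerD.
  rewrite cnormM cnormV ler_pdivrMl//; apply: le_trans HE _.
  rewrite dW cnormM.
  have := cnorm_ge0 ((2 * z + h) * (2^-1 * 2^-1)); move: (cnorm (_ * (_ * _))) qn => Q qn Q0.
  have -> : C * (cnorm h * Q) ^+ 2 = C * cnorm h ^+ 2 * Q ^+ 2 by ring.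
  have -> : cnorm h * (C * B * cnorm h) = C * cnorm h ^+ 2 * B by ring.
  apply: ler_wpM2l; first by apply: mulr_ge0 => //; exact: sqr_ge0.
  by rewrite /B lerXn2r ?nnegrE//; lra.
rewrite !cnormM n2 mulrC ler_wpM2l ?cnorm_ge0//; lra.
Qed.

Lemma cps_derivable c z : entire c ->
  derivable (fun z : CC R => cps c ((z / 2) ^+ 2)) z 1 /\
  derive1 (fun z : CC R => cps c ((z / 2) ^+ 2)) z = cps (pseries_diffs c) ((z / 2) ^+ 2) * (z / 2).
Proof.
move=> ec; set f := fun z : CC R => _; set d := _ * _.
have H : h^-1 *: (f (h + z) - f z) @[h --> 0^'] --> d.
  have [K K0 HK] := cps_difference_quotient z ec.
  apply/cvgrPdist_le => e e0.
  have e1 : 0 < complex.Re e by move: e0; rewrite ltcE => /andP[].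
  pose r := Num.min 1 (complex.Re e / (K + 1)).
  have K1 : 0 < K + 1 by rewrite ltr_wpDl.
  have r0 : 0 < r by rewrite lt_min ltr01 divr_gt0.
  have r0' : 0 < toCC r by rewrite ltcE /= eqxx.
  near=> h.
  have h0 : h != 0 by near: h; exact: nbhs_dnbhs_neq.
  have : `|h| < toCC r by near: h; exact: dnbhs0_lt.
  rewrite cnormE ltcE /= eqxx /= lt_min => /andP[h1 hr].
  apply: normCC_le => //; apply: le_trans (HK h h0 (ltW h1)) _.
  apply: (@le_trans _ _ ((K + 1) * cnorm h)); first by rewrite ler_wpM2r ?cnorm_ge0// lerDl.
  by move: hr; rewrite ltr_pdivlMr// mulrC => /ltW.
split; last by rewrite /derive1; exact: (cvg_lim (@norm_hausdorff _ _) H).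
rewrite /derivable; apply/cvg_ex; exists d.
have -> : (fun h : CC R => h^-1 *: ((f \o shift z) (h *: 1) - f z)) = (fun h => h^-1 *: (f (h + z) - f z)).
  by apply/funext => h /=; rewrite /GRing.scale /= mulr1.
exact: H.
Unshelve. all: by end_near. Qed.

End ComplexSeries.

(** * The transform as a power series with moment coefficients *)

Section HankelTransform.
Variable R : realType.
Notation mu := (@lebesgue_measure R).
Variables (nu : R) (f : R -> R).
Hypothesis hnu : -1 < nu.
Hypothesis fpos : forall t : R, t \in `]0, 1[ -> 0 < f t.
Hypothesis fint : mu.-integrable `]0, 1[ (EFin \o f).
Hypothesis fint' : nu < - (1 / 2) ->
    mu.-integrable `]0, 1[ (fun t : R => (t `^ (nu + 1 / 2) * `|f t|)%:E).

Definition weight t := t `^ (nu + 1 / 2) * f t.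

Lemma weight_ge0 t : t \in `]0, 1[ -> 0 <= weight t.
Proof. by move=> t01; rewrite mulr_ge0 ?powR_ge0// ltW// fpos. Qed.

Lemma measurable_weight : measurable_fun (`]0, 1[%classic : set R) (EFin \o weight).
Proof.
apply/measurable_EFinP; apply: measurable_funM.
  by apply: measurable_funTS; exact: measurable_powR.
by apply/measurable_EFinP; exact: (measurable_int mu fint).
Qed.

(** For nu >= -1/2 the power of t is at most 1 on (0, 1) and f dominates; otherwise it is the extra
    hypothesis. *)
Lemma weight_integrable : mu.-integrable `]0, 1[ (EFin \o weight).
Proof.
have [n1|n1] := ltP nu (- (1 / 2)).
  apply: (eq_integrable _ _ _ _ (fint' n1)); first exact: measurable_itv.
  move=> t; rewrite inE/= => t01; rewrite /weight gtr0_norm// fpos//.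
apply: (le_integrable _ _ _ fint); [exact: measurable_itv|exact: measurable_weight|].
move=> t /= t01; rewrite lee_fin normrM ler_piMl// ger0_norm ?powR_ge0//.
move: t01; rewrite in_itv/= => /andP[t0 t1].
have p0 : 0 <= nu + 1 / 2 by lra.
have := @ge0_ler_powR _ _ p0 t 1; rewrite !nnegrE powR1; apply; rewrite ?ler01 ?ltW//.
Qed.

(** Moments in t^2, because the kernel is a series in (z / 2)^2 t^2. *)
Definition hmom i := \int[mu]_(t in `]0, 1[) (weight t * (t ^+ 2) ^+ i).

Lemma weighted_integrable (g : R -> R) (B : R) : continuous g -> (forall x, 0 <= x <= 1 -> `|g x| <= B) ->
  mu.-integrable `]0, 1[ (EFin \o (fun t => weight t * g (t ^+ 2))).
Proof.
move=> cg gB.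
have cg2 : continuous (fun t : R => g (t ^+ 2)).
  by move=> t; apply: continuous_comp; [exact: exprn_continuous|exact: cg].
apply: (le_integrable _ _ _ (integrable_scale B weight_integrable)); first exact: measurable_itv.
  apply/measurable_EFinP; apply: measurable_funM; first by apply/measurable_EFinP; exact: measurable_weight.
  by apply: measurable_funTS; exact: continuous_measurable_fun.
move=> t /= t01; rewrite lee_fin !normrM mulrC; apply: ler_wpM2r => //.
apply: le_trans (ler_norm _); apply: gB; rewrite sqr_ge0 exprn_ile1//; move: t01; rewrite in_itv/= => /andP[]; lra.
Qed.

Lemma weighted_norm_le (g : R -> R) (B : R) : continuous g -> (forall x, 0 <= x <= 1 -> `|g x| <= B) ->
  `|\int[mu]_(t in `]0, 1[) (weight t * g (t ^+ 2))| <= B * hmom 0.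
Proof.
move=> cg gB; have ig := weighted_integrable cg gB.
have E0 : hmom 0 = \int[mu]_(t in `]0, 1[) weight t.
  by apply: eq_Rintegral => t _; rewrite expr0 mulr1.
rewrite E0; apply: le_trans (le_normr_Rintegral _ ig) _; first exact: measurable_itv.
rewrite -RintegralZl//; last exact: weight_integrable.
apply: le_Rintegral => //.
- by apply: (integrable_norm ig).
- exact: integrable_scale weight_integrable.
move=> t /= t01; rewrite normrM mulrC (ger0_norm (weight_ge0 t01)).
apply: ler_wpM2r; first exact: weight_ge0.
apply: gB; rewrite sqr_ge0 exprn_ile1//; move: t01; rewrite in_itv/= => /andP[]; lra.
Qed.

Lemma hmom_ge0 i : 0 <= hmom i.
Proof.
apply: Rintegral_ge0 => t t01; rewrite mulr_ge0 ?weight_ge0//.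
by rewrite exprn_ge0// sqr_ge0.
Qed.

(** The partial sums converge uniformly on [0, 1] with error C 4^(-n), so the integral can be taken
    term by term. *)
Lemma weighted_ps q : entire q ->
  \int[mu]_(t in `]0, 1[) (weight t * ps q (t ^+ 2)) = ps (fun i => q i * hmom i) 1.
Proof.
move=> eq; have [C C0 HC] := ps_tail eq (@ler01 R).
have cq := continuous_ps eq.
have x1 (x : R) : 0 <= x <= 1 -> `|x| <= 1 by move=> /andP[x0 xl]; rewrite ger0_norm.
have iq : mu.-integrable `]0, 1[ (EFin \o (fun t => weight t * ps q (t ^+ 2))).
  apply: (@weighted_integrable _ C) => // x /x1 H.
  by have := HC 0%N x H; rewrite big_ord0 subr0 expr0 mulr1.
pose S n x := \sum_(i < n) q i * x ^+ i.
have cS n : continuous (S n).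
  elim: n => [|n IH].
    by have -> : S 0%N = (fun=> 0); [apply/funext => x; rewrite /S big_ord0|exact: cont_cst].
  have -> : S n.+1 = (fun x => S n x + q n * x ^+ n) by apply/funext => x; rewrite /S big_ord_recr.
  apply: contD => //; apply: contM; [exact: cont_cst|exact: exprn_continuous].
have S1 n x : 0 <= x <= 1 -> `|S n x| <= \sum_(i < n) `|q i|.
  move=> /andP[x0 xl]; apply: le_trans (ler_norm_sum _ _ _) _; apply: ler_sum => i _.
  by rewrite normrM ler_piMr// normrX ger0_norm// exprn_ile1.
have iS n := weighted_integrable (cS n) (S1 n).
have iX n : mu.-integrable `]0, 1[ (EFin \o (fun t => weight t * (t ^+ 2) ^+ n)).
  apply: (@weighted_integrable (fun x => x ^+ n) 1); first exact: exprn_continuous.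
  by move=> x /andP[x0 xl]; rewrite normrX ger0_norm// exprn_ile1.
have ES n : \int[mu]_(t in `]0, 1[) (weight t * S n (t ^+ 2)) = \sum_(i < n) q i * hmom i.
  elim: n => [|n IH].
    rewrite big_ord0 -[RHS](mul0r (\int[mu]_(t in `]0, 1[) weight t)) -RintegralZl//; last exact: weight_integrable.
    by apply: eq_Rintegral => t _; rewrite /S big_ord0 mulr0 mul0r.
  have Zn : q n * hmom n = \int[mu]_(t in `]0, 1[) (q n * (weight t * (t ^+ 2) ^+ n)).
    by rewrite RintegralZl//; exact: iX.
  rewrite big_ord_recr/= -IH Zn.
  rewrite -RintegralD//; last exact: integrable_scale (iX n).
  by apply: eq_Rintegral => t _; rewrite /S big_ord_recr/=; ring.
have em : entire (fun i => q i * hmom i).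
  apply: (entire_le (q := q) (K := hmom 0)) => //; first exact: hmom_ge0.
  move=> i; rewrite normrM mulrC; apply: ler_wpM2r => //.
  have := @weighted_norm_le (fun x => x ^+ i) 1 (@exprn_continuous _ i); rewrite mul1r; apply.
  by move=> x /andP[x0 xl]; rewrite normrX ger0_norm// exprn_ile1.
have [D D0 HD] := ps_tail em (@ler01 R).
apply/eqP; rewrite -subr_eq0; apply/eqP.
apply: (@geo_eq0 _ _ (C * hmom 0 + D)) => n.
rewrite -(subrKA (\sum_(i < n) q i * hmom i)).
apply: le_trans (ler_normD _ _) _; rewrite [leRHS]mulrDl; apply: lerD.
  rewrite -ES -RintegralB//.
  rewrite [X in `|X|](_ : _ = \int[mu]_(t in `]0, 1[) (weight t * (ps q (t ^+ 2) - S n (t ^+ 2)))); last first.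
    by apply: eq_Rintegral => t _; rewrite mulrBr.
  rewrite mulrAC; apply: (@weighted_norm_le (fun x => ps q x - S n x)); first exact: contB.
  by move=> x /x1 H; exact: HC.
rewrite distrC; have := HD n 1; rewrite normr1 => /(_ (lexx _)).
by under eq_bigr do rewrite expr1n mulr1.
Qed.

Lemma hmom_bound q e : entire q -> (forall x, 0 <= x <= 1 -> `|ps q x| <= e) ->
  `|ps (fun i => q i * hmom i) 1| <= e * hmom 0.
Proof.
by move=> eq H; rewrite -weighted_ps//; apply: weighted_norm_le => //; exact: continuous_ps.
Qed.

Lemma hankel_cps (z : CC R) : hankel nu f z = cps (transform (nu + 1) hmom) ((z / 2) ^+ 2).
Proof.
have b0 : 0 < nu + 1 by move: hnu; lra.
have ep := entire_phi b0; set w := (z / 2) ^+ 2.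
have eF := entire_transform b0 hmom_ge0 hmom_bound.
have JE (t : R) : bessel_JJ nu (z * toCC t) = cps (phi (nu + 1)) (w * toCC (t ^+ 2)).
  have -> : w * toCC (t ^+ 2) = (z * toCC t / 2) ^+ 2 by rewrite /w toCCX -exprMn mulrAC.
  exact: bessel_JJ_cps.
have [eR eI] := entire_Re w ep.
rewrite /hankel /complex_integral; apply/eqP; rewrite eq_complex.
have [FR FI] := cps_toCCM w 1 eF; rewrite toCC1 mulr1 in FR FI.
apply/andP; split; apply/eqP.
  rewrite FR (_ : (fun i => _) = (fun i => phi (nu + 1) i * complex.Re (w ^+ i) * hmom i)); last first.
    by apply/funext => i; rewrite /transform mulrAC.
  rewrite -weighted_ps//=; apply: eq_Rintegral => t _.
  by rewrite JE Re_toCCM; have [-> _] := cps_toCCM w (t ^+ 2) ep.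
rewrite FI (_ : (fun i => _) = (fun i => phi (nu + 1) i * complex.Im (w ^+ i) * hmom i)); last first.
  by apply/funext => i; rewrite /transform mulrAC.
rewrite -weighted_ps//=; apply: eq_Rintegral => t _.
by rewrite JE Im_toCCM; have [_ ->] := cps_toCCM w (t ^+ 2) ep.
Qed.

End HankelTransform.

Section Quarter.
Variable R : realType.
Implicit Types x y : R.

Definition quarter x := x ^+ 2 / 4.

Lemma quarter_lt x y : 0 <= x -> 0 <= y -> (quarter x < quarter y) = (x < y).
Proof. by move=> x0 y0; rewrite /quarter ltr_pM2r ?invr_gt0// ltr_sqr. Qed.

Lemma quarter_inj x y : 0 <= x -> 0 <= y -> quarter x = quarter y -> x = y.
Proof.
move=> x0 y0 E; case: (ltrgtP x y) => //; rewrite -quarter_lt// E ltxx//.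
Qed.

Lemma quarter_sqrt y : 0 <= y -> quarter (2 * Num.sqrt y) = y.
Proof. by move=> y0; rewrite /quarter exprMn sqr_sqrtr//; field. Qed.

Lemma quarter_ge0 x : 0 <= quarter x.
Proof. by rewrite divr_ge0// sqr_ge0. Qed.

End Quarter.

(** * Zeros of the transform in the original variable *)

Section HankelZeros.
Variable R : realType.
Variables (nu mu : R) (f : R -> R).
Hypothesis hnu : -1 < nu.
Hypothesis hmu : -1 < mu.
Hypothesis hmunu : mu < nu + 2.
Hypothesis fpos : forall t : R, t \in `]0, 1[ -> 0 < f t.
Hypothesis fint : (@lebesgue_measure R).-integrable `]0, 1[ (EFin \o f).
Hypothesis fint' : nu < - (1 / 2) ->
    (@lebesgue_measure R).-integrable `]0, 1[ (fun t : R => (t `^ (nu + 1 / 2) * `|f t|)%:E).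
Variable j : nat -> R.
Hypothesis j_enum : enumerates_bessel_zeros mu j.

Notation F := (transform (nu + 1) (hmom nu f)).
Notation hk x := (hankel nu f (toCC x)).

Let a0 : 0 < mu + 1. Proof. by move: hmu; lra. Qed.
Let b0 : 0 < nu + 1. Proof. by move: hnu; lra. Qed.
Let ab : mu + 1 < nu + 1 + 2. Proof. by move: hmunu; lra. Qed.

Let mom_ge0 := @hmom_ge0 R nu f fpos.
Let mom_bound := hmom_bound fpos fint fint'.
Let eF : entire F := entire_transform b0 mom_ge0 mom_bound.

(** Since [j] is indexed from 0, this belongs to the customary j_(mu, m+1). Hence the factor (-1)^m
    in [sign], against (-1)^(m+1) in [hankel_sigma]. *)
Definition sq_zero m := quarter (j m).
Notation lam := sq_zero.

Let j_incr m n : (m < n)%N -> j m < j n.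
Proof. by case: j_enum => H _; exact: H. Qed.

Let j_zero m : 0 < j m /\ bessel_J mu (j m) = 0.
Proof.
case: j_enum => _ E.
by have : [set x | 0 < x /\ bessel_J mu x = 0] (j m) by rewrite -E; exists m.
Qed.

Let j_gt0 m : 0 < j m := proj1 (j_zero m).

Let lam_gt0 m : 0 < lam m.
Proof. by rewrite /sq_zero /quarter divr_gt0// exprn_gt0// j_gt0. Qed.

Let lam_incr m n : (m < n)%N -> lam m < lam n.
Proof. by move=> mn; rewrite /sq_zero quarter_lt ?ltW ?j_gt0// j_incr. Qed.

Let lam_zero m : Phi (mu + 1) (lam m) = 0.
Proof. by have [j0 jz] := j_zero m; exact: (proj1 (bessel_J_eq0 hmu j0) jz). Qed.

Let lam_all y : 0 < y -> Phi (mu + 1) y = 0 -> exists m, y = lam m.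
Proof.
move=> y0; rewrite -{1}(quarter_sqrt (ltW y0)) => P0.
have x0 : 0 < 2 * Num.sqrt y by rewrite mulr_gt0// sqrtr_gt0.
case: j_enum => _ E.
have : range j (2 * Num.sqrt y) by rewrite E; split => //; exact: (proj2 (bessel_J_eq0 hmu x0) P0).
by move=> [m _ jm]; exists m; rewrite /sq_zero jm quarter_sqrt// ltW.
Qed.

Lemma hankel_real x : hk x = toCC (ps F (quarter x)).
Proof.
rewrite (hankel_cps hnu fpos fint fint').
have -> : (toCC x / 2) ^+ 2 = toCC (quarter x).
  by rewrite /quarter toCCM toCCX toCCV toCC_nat; field.
exact: cps_toCC eF.
Qed.

Variable s : R.
Hypothesis s2 : s ^+ 2 = 1.
Hypothesis sign : forall m, 0 < s * ((-1) ^+ m * ps F (lam m)).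

Let res_gt0 m : 0 < s * res (mu + 1) lam (nu + 1) (hmom nu f) m.
Proof.
have G := gcoef_sign a0 lam_gt0 lam_incr lam_zero lam_all m; have S := sign m.
rewrite /res; move: (gcoef _ _ _) (ps F (lam m)) G S => A B G S.
have -> : s * (A * B) = ((-1) ^+ m * (-1) ^+ m) * (s * (A * B)).
  by rewrite -exprMn mulrNN mul1r expr1n mul1r.
have -> : (-1) ^+ m * (-1) ^+ m * (s * (A * B)) = ((-1) ^+ m * A) * (s * ((-1) ^+ m * B)) by ring.
exact: mulr_gt0.
Qed.

Let alternate m : ps F (lam m) * ps F (lam m.+1) < 0.
Proof.
have := mulr_gt0 (sign m) (sign m.+1).
move: (ps F (lam m)) (ps F (lam m.+1)) => A B.
have -> : s * ((-1) ^+ m * A) * (s * ((-1) ^+ m.+1 * B)) = s ^+ 2 * ((-1) ^+ m * (-1) ^+ m) * - (A * B).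
  by rewrite exprS; ring.
by rewrite s2 mul1r -exprMn mulrNN mul1r expr1n mul1r oppr_gt0.
Qed.

Let inverse := series_inverse (phi0 (mu + 1)).

(** A zero w = (z / 2)^2 is real and positive, so z is real and nonzero; the factor z / 2 of the
    chain rule then preserves simplicity. *)
Lemma hankel_zero_real_simple z : hankel nu f z = 0 ->
  complex.Im z = 0 /\ simple_zero (hankel nu f) z.
Proof.
move=> Hz; have [r rE] := inverse.
have hE : hankel nu f = (fun z => cps F ((z / 2) ^+ 2)).
  by apply/funext => u; exact: (hankel_cps hnu fpos fint fint').
have wz : cps F ((z / 2) ^+ 2) = 0 by rewrite -Hz hE.
have Iw := zero_real a0 lam_gt0 lam_incr lam_zero lam_all rE b0 ab mom_ge0 mom_bound s2 res_gt0 wz.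
have [x wx] : exists x, (z / 2) ^+ 2 = toCC x.
  exists (complex.Re ((z / 2) ^+ 2)); apply/eqP; rewrite eq_complex; apply/andP; split => //.
  by rewrite Iw.
have Fx : ps F x = 0 by move: wz; rewrite wx (cps_toCC _ eF) => /toCC_inj.
have x0 := zero_gt0 b0 mom_ge0 mom_bound res_gt0 Fx.
split.
  have zz : z * z = toCC (4 * x).
    by rewrite toCCM -wx toCC_nat; field.
  case: z {Hz wz Iw wx} zz => u v zz; have := congr1 (@complex.Re R) zz; have := congr1 (@complex.Im R) zz.
  rewrite /= => Iz Rz; apply/eqP; apply/negPn/negP => v0.
  have : u * v = 0 by lra.
  move=> /eqP; rewrite mulf_eq0 (negPf v0) orbF => /eqP u0.
  have : 0 < v ^+ 2 by rewrite exprn_even_gt0.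
  by move: Rz; rewrite u0 expr2; lra.
have [dz Dz] := cps_derivable z eF; rewrite -hE in dz Dz.
split => //; rewrite Dz wx cps_toCC; last exact: entire_diffs.
rewrite mulf_neq0//.
  rewrite toCC_eq0; exact: (zero_simple a0 lam_gt0 lam_incr lam_zero lam_all rE b0 ab mom_ge0 mom_bound s2 res_gt0 Fx).
apply/negP => /eqP z0; move: wx; rewrite z0 expr2 mul0r => /esym/eqP.
by rewrite toCC_eq0 (gt_eqF x0).
Qed.

Let unique_zero u v : 0 <= u -> u < v -> ps F (quarter u) * ps F (quarter v) < 0 ->
  (forall y y', quarter u < y < quarter v -> quarter u < y' < quarter v -> same_gap lam y y') ->
  exists! x, u < x < v /\ hk x = 0.
Proof.
move=> u0 uv Fuv gap; have [r rE] := inverse.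
have v0 : 0 <= v by apply: le_trans u0 (ltW uv).
have quv : quarter u < quarter v by rewrite quarter_lt.
have [y yuv Fy] := zero_exists b0 mom_ge0 mom_bound quv Fuv.
have y0 : 0 <= y by case/andP: yuv => /ltW uy _; apply: le_trans uy; exact: quarter_ge0.
have x0 : 0 <= 2 * Num.sqrt y by rewrite mulr_ge0// sqrtr_ge0.
exists (2 * Num.sqrt y); split.
  rewrite hankel_real quarter_sqrt// Fy; split => //.
    have v0' := quarter_sqrt y0; case/andP: yuv => uy yv.
  by rewrite -(quarter_lt u0 x0) -(quarter_lt x0 v0) v0' uy.
move=> x' [/andP[ux' x'v]]; rewrite hankel_real => /toCC_inj Fx'.
have x'0 : 0 <= x' by apply: le_trans u0 (ltW ux').
apply: quarter_inj => //; rewrite quarter_sqrt//.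
apply: (zero_unique a0 lam_gt0 lam_incr lam_zero lam_all rE b0 ab mom_ge0 mom_bound s2 res_gt0 _ Fy Fx').
by apply: gap; rewrite // (quarter_lt u0 x'0) (quarter_lt x'0 v0) ux'.
Qed.

Lemma hankel_zero_gap m : exists! x, j m < x < j m.+1 /\ hk x = 0.
Proof.
apply: unique_zero; [exact/ltW/j_gt0|exact: j_incr|exact: alternate|].
move=> y y'; exact: gap_intro.
Qed.

(** For s = -1 the values F(0) > 0 and F(lam_0) < 0 force a sign change before lam_0. *)
Lemma hankel_zero_first : s = -1 -> exists! x, 0 < x < j 0 /\ hk x = 0.
Proof.
move=> s1; apply: unique_zero => //.
  have -> : quarter 0 = - 0 :> R by rewrite /quarter expr0n mul0r oppr0.
  have := transform_neg b0 mom_ge0 mom_bound (lexx 0).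
  have := mom0_gt0 b0 mom_ge0 mom_bound res_gt0 => m0 /(lt_le_trans m0) F0.
  by rewrite pmulr_rlt0//; have := sign 0; rewrite s1 expr0 mul1r mulN1r oppr_gt0.
move=> y y' /andP[_ y1] /andP[_ y2]; exact: (gap_intro_lt lam_incr).
Qed.

Lemma hankel_zero_cases x : 0 < x -> hk x = 0 ->
  (s = -1 /\ x < j 0) \/ exists m, j m < x < j m.+1.
Proof.
move=> x0; rewrite hankel_real => /toCC_inj Fx; have [r rE] := inverse.
have xn := zero_neq res_gt0 Fx.
have [xl|[m mx]] := gap_cases a0 lam_gt0 lam_incr lam_zero rE xn; last first.
  by right; exists m; move: mx; rewrite (quarter_lt (ltW (j_gt0 _)) (ltW x0)) (quarter_lt (ltW x0) (ltW (j_gt0 _))).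
left; split; last by move: xl; rewrite (quarter_lt (ltW x0) (ltW (j_gt0 _))).
move: s2 => /eqP; rewrite sqrf_eq1 => /orP[/eqP s1|/eqP//].
have := zero_first a0 lam_gt0 lam_incr lam_zero lam_all rE b0 ab mom_ge0 mom_bound s2 res_gt0 s1 Fx.
by rewrite leNgt xl.
Qed.

Lemma hankel_zeros_infinite : infinite_set [set z : CC R | hankel nu f z = 0].
Proof.
have /choice[x xP] : forall m, exists x, j m < x < j m.+1 /\ hk x = 0.
  by move=> m; have [x [Hx _]] := hankel_zero_gap m; exists x.
have x_incr m n : (m < n)%N -> x m < x n.
  move=> mn; have [/andP[_ xm] _] := xP m; have [/andP[xn _] _] := xP n.
  apply: lt_trans xm (le_lt_trans _ xn).
  by move: mn; rewrite leq_eqVlt => /predU1P[->//|/j_incr/ltW].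
move=> fin; apply: infinite_nat.
rewrite (_ : [set: nat] = (fun m => toCC (x m)) @^-1` [set z : CC R | hankel nu f z = 0]); last first.
  by apply/seteqP; split => // m _ /=; have [] := xP m.
apply: finite_preimage fin => m n _ _ /toCC_inj xmn.
by case: (ltngtP m n) => // /x_incr; rewrite xmn ltxx.
Qed.

End HankelZeros.

Theorem theorem4p1 (R : realType) (nu mu : R) (f : R -> R)
  (hnu : -1 < nu) (hmu : -1 < mu) (hmunu : mu < nu + 2)
  (fpos : forall t : R, t \in `]0, 1[ -> 0 < f t)
  (fint : (@lebesgue_measure R).-integrable `]0, 1[ (EFin \o f))
  (fint' : nu < - (1 / 2) ->
    (@lebesgue_measure R).-integrable `]0, 1[
      (fun t : R => (t `^ (nu + 1 / 2) * `|f t|)%:E))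
  (hsigma :
    (forall m : nat, (0 < m)%N -> 0 < hankel_sigma nu mu f m) \/
    (forall m : nat, (0 < m)%N -> hankel_sigma nu mu f m < 0)) :
  [/\ infinite_set [set z : CC R | hankel nu f z = 0],
      forall z : CC R, hankel nu f z = 0 ->
        complex.Im z = 0 /\ simple_zero (hankel nu f) z,
      (forall m : nat, (0 < m)%N -> 0 < hankel_sigma nu mu f m) ->
        (forall m : nat, (0 < m)%N ->
          exists! x : R, bessel_zero mu m < x < bessel_zero mu m.+1 /\
            hankel nu f (toCC x) = 0) /\
        (forall x : R, 0 < x -> hankel nu f (toCC x) = 0 ->
          exists2 m : nat, (0 < m)%N &
            bessel_zero mu m < x < bessel_zero mu m.+1)
    & (forall m : nat, (0 < m)%N -> hankel_sigma nu mu f m < 0) ->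
        [/\ exists! x : R, 0 < x < bessel_zero mu 1 /\ hankel nu f (toCC x) = 0,
            forall m : nat, (0 < m)%N ->
              exists! x : R, bessel_zero mu m < x < bessel_zero mu m.+1 /\
                hankel nu f (toCC x) = 0
          & forall x : R, 0 < x -> hankel nu f (toCC x) = 0 ->
              0 < x < bessel_zero mu 1 \/
              exists2 m : nat, (0 < m)%N &
                bessel_zero mu m < x < bessel_zero mu m.+1]].
Proof.
(* If the zeros had no enumeration, [bessel_zero] would be constantly [0] and
   the signs of [hankel_sigma] would alternate. *)
have [[j0 Hj0]|none] := pselect (exists j, enumerates_bessel_zeros mu j); last first.
  have bz m : bessel_zero mu m = 0.
    by rewrite /bessel_zero xgetPN// => j Hj; apply: none; exists j.
  exfalso; move: hsigma; rewrite /hankel_sigma => -[] H; have := H 1%N isT; have := H 2%N isT;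
    rewrite !bz !exprS expr0 mulr1 mulrNN mulr1 mul1r !mulN1r; rewrite ?oppr_gt0 ?oppr_lt0 => H1 H2;
    by have := lt_trans H1 H2; rewrite ltxx.
pose j := xget (fun=> 0) [set j | enumerates_bessel_zeros mu j].
have jE : enumerates_bessel_zeros mu j by apply: (@xgetPex _ (fun=> 0) [set j | enumerates_bessel_zeros mu j]); exists j0.
have sigmaE m : hankel_sigma nu mu f m.+1 =
    toCC ((-1) ^+ m * ps (transform (nu + 1) (hmom nu f)) (quarter (j m))).
  rewrite /hankel_sigma (_ : bessel_zero mu m.+1 = j m)//.
  by rewrite (hankel_real hnu fpos fint fint') toCCM toCCX toCCN !exprS !mulN1r opprK.
have toCC_gt0 (x : R) : (0 < toCC x) = (0 < x) by rewrite ltcE /= eqxx.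
have toCC_lt0 (x : R) : (toCC x < 0) = (x < 0) by rewrite ltcE /= eqxx.
have pos : (forall m : nat, (0 < m)%N -> 0 < hankel_sigma nu mu f m) ->
  forall m, 0 < 1 * ((-1) ^+ m * ps (transform (nu + 1) (hmom nu f)) (quarter (j m))).
  by move=> H m; have := H m.+1 isT; rewrite sigmaE toCC_gt0 mul1r.
have neg : (forall m : nat, (0 < m)%N -> hankel_sigma nu mu f m < 0) ->
  forall m, 0 < -1 * ((-1) ^+ m * ps (transform (nu + 1) (hmom nu f)) (quarter (j m))).
  by move=> H m; have := H m.+1 isT; rewrite sigmaE toCC_lt0 mulN1r oppr_gt0.
have one2 : (1 : R) ^+ 2 = 1 by rewrite expr1n.
have mone2 : (-1 : R) ^+ 2 = 1 by rewrite sqrrN expr1n.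
split.
- case: hsigma => [/pos|/neg] S.
    exact: (hankel_zeros_infinite hnu hmu hmunu fpos fint fint' jE one2 S).
  exact: (hankel_zeros_infinite hnu hmu hmunu fpos fint fint' jE mone2 S).
- move=> z; case: hsigma => [/pos|/neg] S.
    exact: (hankel_zero_real_simple hnu hmu hmunu fpos fint fint' jE one2 S).
  exact: (hankel_zero_real_simple hnu hmu hmunu fpos fint fint' jE mone2 S).
- move=> /pos S; split => [[//|m] _|x x0 Hx].
    exact: (hankel_zero_gap hnu hmu hmunu fpos fint fint' jE one2 S m).
  (* The first alternative would require s = -1, whereas s = 1 here. *)
  have [[one _]|[m jx]] := hankel_zero_cases hnu hmu hmunu fpos fint fint' jE one2 S x0 Hx; last by exists m.+1.
  lra.
- move=> /neg S; split => [|[//|m] _|x x0 Hx].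
  + exact: (hankel_zero_first hnu hmu hmunu fpos fint fint' jE mone2 S).
  + exact: (hankel_zero_gap hnu hmu hmunu fpos fint fint' jE mone2 S m).
  have [[_ xj]|[m jx]] := hankel_zero_cases hnu hmu hmunu fpos fint fint' jE mone2 S x0 Hx; last by right; exists m.+1.
  by left; rewrite x0.
Qed.
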